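(* Let $k$ be a field and let $A$ be a right noetherian locally finite $\mathbb{N}$-graded $k$-algebra (i.e. $\dim_k A_n<\infty$ for all $n$). Let $X$ be the projective space with homogeneous coordinate ring $A$, i.e. $\mathrm{Mod}\,X=\mathrm{Tails}\,A$, with quotient functor $\pi:\mathrm{GrMod}\,A\to\mathrm{Mod}\,X$. Let $M$ be an infinite dimensional graded right $A$-module such that $\dim_k M/N<\infty$ for all non-zero graded submodules $N\subset M$. If $A$ satisfies the condition $\chi_1$ of Artin and Zhang, then $\pi M\cong\mathcal{O}_p$ for some closed point $p\in X$.
   Context: A (non-commutative) space $X$ is a Grothendieck category $\mathrm{Mod}\,X$. $\mathrm{GrMod}\,A$ is the category of $\mathbb{Z}$-graded right $A$-modules with degree-zero homomorphisms, $\mathrm{Fdim}\,A$ is its full subcategory of direct limits of finite dimensional modules, and $\mathrm{Tails}\,A=\mathrm{GrMod}\,A/\mathrm{Fdim}\,A$ is the quotient category. Condition $\chi_1$: for every finitely generated graded right $A$-module $N$ and $j=0,1$, the graded vector space $\underline{\mathrm{Ext}}^j_A(A/A_{\ge 1},N)=\bigoplus_{n\in\mathbb{Z}}\mathrm{Ext}^j_{\mathrm{GrMod}\,A}(A/A_{\ge 1},N(n))$ is finite dimensional over $k$. A closed subspace of $X$ is a full subcategory of $\mathrm{Mod}\,X$ closed under subquotients whose inclusion functor has both a left and a right adjoint. A closed point $p$ of $X$ is a closed subspace $\mathrm{Mod}\,p$ that is equivalent to the category of right $D$-modules for some division ring $D$; $\mathcal{O}_p$ denotes the unique (up to isomorphism)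 simple object of $\mathrm{Mod}\,p$. *)

(* Defs.v *)
From HB Require Import structures.
From mathcomp Require Import all_boot all_order all_algebra.
From mathcomp Require Import zify boolp.

Set Implicit Arguments.
Unset Strict Implicit.
Unset Printing Implicit Defensive.

Import GRing.Theory.
Local Open Scope ring_scope.

(* Each hom type carries an equivalence relation [heq], which plays the role of
   equality of morphisms. *)
Record category := Category {
  ob :> Type;
  hom : ob -> ob -> Type;
  heq : forall x y, hom x y -> hom x y -> Prop;
  idc : forall x, hom x x;
  cmp : forall x y z, hom y z -> hom x y -> hom x z;
  heq_refl : forall x y (f : hom x y), heq f f;
  heq_sym : forall x y (f g : hom x y), heq f g -> heq g f;
  heq_trans : forall x y (f g h : hom x y), heq f g -> heq g h -> heq f h;
  cmp_heq : forall x y z (g g' : hom y z) (f f' : hom x y),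
    heq g g' -> heq f f' -> heq (cmp g f) (cmp g' f');
  cmpA : forall x y z t (h : hom z t) (g : hom y z) (f : hom x y),
    heq (cmp h (cmp g f)) (cmp (cmp h g) f);
  cmp_idl : forall x y (f : hom x y), heq (cmp (idc y) f) f;
  cmp_idr : forall x y (f : hom x y), heq (cmp f (idc x)) f
}.

Arguments hom {_} _ _.
Arguments heq {_ _ _} _ _.
Arguments idc {_} _.
Arguments cmp {_ _ _ _} _ _.

Notation "f =h g" := (heq f g) (at level 70, no associativity).
Notation "g \oh f" := (cmp g f) (at level 40, left associativity).

Record functor (C D : category) := Functor {
  fob :> C -> D;
  fmap : forall x y : C, hom x y -> hom (fob x) (fob y);
  fmap_heq : forall (x y : C) (f g : hom x y), f =h g -> fmap f =h fmap g;
  fmap_id : forall x : C, fmap (idc x) =h idc (fob x);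
  fmap_cmp : forall (x y z : C) (g : hom y z) (f : hom x y),
    fmap (g \oh f) =h fmap g \oh fmap f
}.

Lemma idfunctor_id (C : category) (x : C) : idc x =h idc x.
Proof. exact: heq_refl. Qed.

Lemma idfunctor_cmp (C : category) (x y z : C) (g : hom y z) (f : hom x y) :
  g \oh f =h g \oh f.
Proof. exact: heq_refl. Qed.

Definition idfunctor (C : category) : functor C C :=
  @Functor C C (fun x => x) (fun _ _ f => f) (fun _ _ _ _ fg => fg)
    (@idfunctor_id C) (@idfunctor_cmp C).

Section FunctorComposition.
Variables (C D E : category) (G : functor D E) (F : functor C D).

Lemma cfunctor_heq (x y : C) (f g : hom x y) :
  f =h g -> fmap G (fmap F f) =h fmap G (fmap F g).
Proof. by move=> fg; do 2!apply: fmap_heq. Qed.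

Lemma cfunctor_id (x : C) : fmap G (fmap F (idc x)) =h idc (G (F x)).
Proof. exact: heq_trans (fmap_heq _ (fmap_id _ _)) (fmap_id _ _). Qed.

Lemma cfunctor_cmp (x y z : C) (g : hom y z) (f : hom x y) :
  fmap G (fmap F (g \oh f)) =h fmap G (fmap F g) \oh fmap G (fmap F f).
Proof. exact: heq_trans (fmap_heq _ (fmap_cmp _ _ _)) (fmap_cmp _ _ _). Qed.

Definition cfunctor : functor C E :=
  @Functor C E (fun x => G (F x)) (fun _ _ f => fmap G (fmap F f))
    cfunctor_heq cfunctor_id cfunctor_cmp.

End FunctorComposition.

Definition is_iso (C : category) (x y : C) (f : hom x y) : Prop :=
  exists g : hom y x, g \oh f =h idc x /\ f \oh g =h idc y.

Definition isomorphic (C : category) (x y : C) : Prop :=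
  exists f : hom x y, is_iso f.

Definition is_mono (C : category) (x y : C) (f : hom x y) : Prop :=
  forall (z : C) (g h : hom z x), f \oh g =h f \oh h -> g =h h.

Definition is_epi (C : category) (x y : C) (f : hom x y) : Prop :=
  forall (z : C) (g h : hom y z), g \oh f =h h \oh f -> g =h h.

Definition is_zero (C : category) (x : C) : Prop :=
  forall y : C, (exists f : hom x y, forall g, g =h f) /\
                (exists f : hom y x, forall g, g =h f).

Definition simple (C : category) (x : C) : Prop :=
  ~ is_zero x /\
  forall (y : C) (f : hom y x), is_mono f -> is_zero y \/ is_iso f.

Definition natural_iso (C D : category) (F G : functor C D) : Prop :=
  exists u : forall x : C, hom (F x) (G x),
    (forall x, is_iso (u x)) /\
    (forall (x y : C) (f : hom x y), u y \oh fmap F f =h fmap G f \oh u x).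

Definition equivalent (C D : category) : Prop :=
  exists (F : functor C D) (G : functor D C),
    natural_iso (cfunctor G F) (idfunctor C) /\
    natural_iso (cfunctor F G) (idfunctor D).

(* [F] is left adjoint to [G] *)
Definition adjoint (C D : category) (F : functor C D) (G : functor D C) : Prop :=
  exists (phi : forall (x : C) (y : D), hom (F x) y -> hom x (G y))
         (psi : forall (x : C) (y : D), hom x (G y) -> hom (F x) y),
    [/\ forall x y (f g : hom (F x) y), f =h g -> phi x y f =h phi x y g,
        forall x y (f g : hom x (G y)), f =h g -> psi x y f =h psi x y g,
        forall x y (f : hom (F x) y), psi x y (phi x y f) =h f,
        forall x y (g : hom x (G y)), phi x y (psi x y g) =h g
      & forall (x x' : C) (y y' : D) (a : hom x' x) (b : hom y y')
               (f : hom (F x) y),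
          phi x' y' (b \oh f \oh fmap F a) =h fmap G b \oh phi x y f \oh a].

Section FullSubcategory.
Variables (C : category) (P : C -> Prop).

Definition full_subcategory : category :=
  @Category {x : C | P x} (fun x y => hom (sval x) (sval y))
    (fun x y f g => f =h g) (fun x => idc (sval x)) (fun x y z g f => g \oh f)
    (fun _ _ => @heq_refl C _ _) (fun _ _ => @heq_sym C _ _)
    (fun _ _ => @heq_trans C _ _) (fun _ _ _ => @cmp_heq C _ _ _)
    (fun _ _ _ _ => @cmpA C _ _ _ _) (fun _ _ => @cmp_idl C _ _)
    (fun _ _ => @cmp_idr C _ _).

Definition inclusion : functor full_subcategory C :=
  @Functor full_subcategory C (fun x => sval x) (fun _ _ f => f)
    (fun _ _ _ _ fg => fg) (fun x => heq_refl (idc (sval x)))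
    (fun _ _ _ g f => heq_refl (g \oh f)).

End FullSubcategory.

Definition closed_under_subquotients (C : category) (P : C -> Prop) : Prop :=
  (forall (x y : C) (f : hom y x), is_mono f -> P x -> P y) /\
  (forall (x y : C) (f : hom x y), is_epi f -> P x -> P y).

Definition closed_subspace (C : category) (P : C -> Prop) : Prop :=
  [/\ closed_under_subquotients P,
      exists L : functor C (full_subcategory P), adjoint L (inclusion P)
    & exists R : functor C (full_subcategory P), adjoint (inclusion P) R].

(* Right modules over [D] are left modules over the converse ring [D^c]. *)
Section RightModules.
Variable D : nzRingType.

Definition modhom (U V : lmodType D^c) := {linear U -> V}.
Definition modhom_eq (U V : lmodType D^c) (f g : modhom U V) : Prop :=
  forall x, f x = g x.
Definition modhom_id (U : lmodType D^c) : modhom U U := idfun.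
Definition modhom_cmp (U V W : lmodType D^c) (g : modhom V W) (f : modhom U V) :
  modhom U W := g \o f.

Lemma modhom_eq_refl U V (f : modhom U V) : modhom_eq f f.
Proof. by []. Qed.
Lemma modhom_eq_sym U V (f g : modhom U V) : modhom_eq f g -> modhom_eq g f.
Proof. by move=> fg x. Qed.
Lemma modhom_eq_trans U V (f g h : modhom U V) :
  modhom_eq f g -> modhom_eq g h -> modhom_eq f h.
Proof. by move=> fg gh x; rewrite fg gh. Qed.
Lemma modhom_cmp_eq U V W (g g' : modhom V W) (f f' : modhom U V) :
  modhom_eq g g' -> modhom_eq f f' ->
  modhom_eq (modhom_cmp g f) (modhom_cmp g' f').
Proof. by move=> gg ff x /=; rewrite ff gg. Qed.
Lemma modhom_cmpA U V W X (h : modhom W X) (g : modhom V W) (f : modhom U V) :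
  modhom_eq (modhom_cmp h (modhom_cmp g f)) (modhom_cmp (modhom_cmp h g) f).
Proof. by []. Qed.
Lemma modhom_idl U V (f : modhom U V) : modhom_eq (modhom_cmp (modhom_id V) f) f.
Proof. by []. Qed.
Lemma modhom_idr U V (f : modhom U V) : modhom_eq (modhom_cmp f (modhom_id U)) f.
Proof. by []. Qed.

Definition right_modules : category :=
  Category modhom_eq_refl modhom_eq_sym modhom_eq_trans modhom_cmp_eq
    modhom_cmpA modhom_idl modhom_idr.

End RightModules.

Definition division_ring (D : unitRingType) : Prop :=
  forall d : D, d != 0 -> d \is a GRing.unit.

Definition closed_point (C : category) (P : C -> Prop) : Prop :=
  closed_subspace P /\
  exists D : unitRingType,
    division_ring D /\ equivalent (full_subcategory P) (right_modules D).

Record submodule (R : pzRingType) (V : lmodType R) := Submodule {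
  smem :> V -> Prop;
  smem0 : smem 0;
  smemD : forall x y, smem x -> smem y -> smem (x + y);
  smemZ : forall a x, smem x -> smem (a *: x)
}.

Section SubQuotient.
Variables (R : pzRingType) (V : lmodType R) (N : submodule V).

Lemma smemN x : N x -> N (- x).
Proof. by move=> /(smemZ (-1)); rewrite scaleN1r. Qed.

Lemma smemB x y : N x -> N y -> N (x - y).
Proof. by move=> Nx Ny; apply: smemD => //; apply: smemN. Qed.

Lemma smem_sum (I : Type) (r : seq I) (P : pred I) (F : I -> V) :
  (forall i, P i -> N (F i)) -> N (\sum_(i <- r | P i) F i).
Proof. by move=> NF; elim/big_ind: _ => //; [exact: smem0|exact: smemD]. Qed.

Definition smemb : {pred V} := fun x => `[< N x >].

Lemma smembP x : reflect (N x) (x \in smemb).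
Proof. exact: asboolP. Qed.

Lemma smemb_closed : subsemimod_closed smemb.
Proof.
split; first split.
- exact/smembP/smem0.
- by move=> x y /smembP Nx /smembP Ny; apply/smembP/smemD.
- by move=> a x /smembP Nx; apply/smembP/smemZ.
Qed.

HB.instance Definition _ := GRing.isSubmodClosed.Build R V smemb smemb_closed.

Definition submod : Type := {x : V | x \in smemb}.
HB.instance Definition _ := SubChoice.on submod.
HB.instance Definition _ := [SubChoice_isSubLmodule of submod by <:].

Definition quomod : Type := Quotient.quot (smemb : zmodClosed V).
HB.instance Definition _ := GRing.Zmodule.on quomod.
HB.instance Definition _ := EqQuotient.on quomod.

Definition quo (x : V) : quomod := (\pi_quomod x)%qT.
Definition lift_quo (q : quomod) : V := repr q.

Lemma lift_quoK q : quo (lift_quo q) = q.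
Proof. exact: reprK. Qed.

Lemma quo_eq x y : quo x = quo y <-> N (x - y).
Proof.
split=> [/eqP|Nxy].
  by rewrite /quo -(Quotient.idealrBE (smemb : zmodClosed V)) => /smembP.
by apply/eqP; rewrite /quo -(Quotient.idealrBE (smemb : zmodClosed V)); apply/smembP.
Qed.

Lemma quoB : {morph quo : x y / x - y}.
Proof. by move=> x y; rewrite /quo /quomod raddfB. Qed.
Lemma quo0 : quo 0 = 0.
Proof. by rewrite -(subrr 0) quoB subrr. Qed.
Lemma quoD : {morph quo : x y / x + y}.
Proof.
move=> x y; rewrite -{1}[y]opprK quoB; congr (_ + _).
by rewrite -[- y]sub0r quoB quo0 sub0r opprK.
Qed.

Definition quo_scale (a : R) (q : quomod) : quomod := quo (a *: lift_quo q).

Lemma quo_scaleE a x : quo_scale a (quo x) = quo (a *: x).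
Proof.
by apply/quo_eq; rewrite -scalerBr; apply: smemZ; apply/quo_eq; rewrite lift_quoK.
Qed.

Lemma quo_scaleA a b q : quo_scale a (quo_scale b q) = quo_scale (a * b) q.
Proof. by rewrite -[q]lift_quoK !quo_scaleE scalerA. Qed.
Lemma quo_scale1 : left_id 1 quo_scale.
Proof. by move=> q; rewrite -[q]lift_quoK quo_scaleE scale1r. Qed.
Lemma quo_scaleDr : right_distributive quo_scale +%R.
Proof.
move=> a p q; rewrite -[p]lift_quoK -[q]lift_quoK.
by rewrite -quoD !quo_scaleE scalerDr quoD.
Qed.
Lemma quo_scaleDl q : {morph quo_scale^~ q : a b / a + b}.
Proof.
by move=> a b /=; rewrite -[q]lift_quoK !quo_scaleE scalerDl quoD.
Qed.

HB.instance Definition _ := GRing.Zmodule_isLmodule.Build R quomod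
  quo_scaleA quo_scale1 quo_scaleDr quo_scaleDl.

Lemma quoZ a x : quo (a *: x) = a *: quo x.
Proof. by rewrite -quo_scaleE. Qed.

Lemma quo_is_linear : linear quo.
Proof. by move=> a x y; rewrite quoD quoZ. Qed.

HB.instance Definition _ := GRing.isLinear.Build R V quomod _ quo quo_is_linear.

End SubQuotient.

(* A decomposition as a direct sum of subspaces [A_n] is given by the maps
   [acomp n] that send an element to its component in [A_n]; thus
   [A_n = {a | acomp n a = a}]. *)
Record gralg (k : fieldType) := GrAlg {
  galg :> algType k;
  acomp : nat -> galg -> galg;
  acomp_linear : forall n (c : k) (a b : galg),
    acomp n (c *: a + b) = c *: acomp n a + acomp n b;
  acomp_comp : forall n m a,
    acomp n (acomp m a) = if n == m then acomp m a else 0;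
  acomp_sum : forall a, exists2 s : seq nat, uniq s & a = \sum_(n <- s) acomp n a;
  acomp1 : acomp 0 1 = 1;
  acompM : forall n m a b,
    acomp n a = a -> acomp m b = b -> acomp (n + m) (a * b) = a * b
}.

Definition ract (k : fieldType) (A : algType k) (M : lmodType A^c) (x : M) (a : A) :
  M := (a : A^c) *: x.

Notation "x *r a" := (ract x a) (at level 40, left associativity).

(* [M_i = {x | comp i x = x}] *)
Record grmod (k : fieldType) (A : gralg k) := GrMod {
  gmod :> lmodType A^c;
  comp : int -> gmod -> gmod;
  compD : forall i x y, comp i (x + y) = comp i x + comp i y;
  comp_comp : forall i j x,
    comp i (comp j x) = if i == j then comp j x else 0;
  comp_sum : forall x, exists2 s : seq int, uniq s & x = \sum_(i <- s) comp i x;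
  comp_ract : forall i n x (a : A),
    comp i x = x -> acomp n a = a -> comp (i + n%:Z) (x *r a) = x *r a
}.

Record grhom (k : fieldType) (A : gralg k) (M N : grmod A) := GrHom {
  gfun :> {linear M -> N};
  gfun_comp : forall i x, gfun (comp i x) = comp i (gfun x)
}.

Record grsub (k : fieldType) (A : gralg k) (M : grmod A) := GrSub {
  gsub :> submodule M;
  gsub_comp : forall i x, gsub x -> gsub (comp i x)
}.

Section Graded.
Variables (k : fieldType) (A : gralg k).
Implicit Types (M N P Q : grmod A) (a b : A).

Lemma acompD n : {morph @acomp k A n : a b / a + b}.
Proof. by move=> a b; rewrite -[a in LHS]scale1r acomp_linear scale1r. Qed.

Lemma acomp0 n : acomp n (0 : A) = 0.
Proof. by apply: (addrI (acomp n 0)); rewrite -acompD !addr0. Qed.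

Lemma acompZ n c a : acomp n (c *: a) = c *: acomp n a.
Proof. by rewrite -[c *: a]addr0 acomp_linear acomp0 addr0. Qed.

Lemma acompB n : {morph @acomp k A n : a b / a - b}.
Proof. by move=> a b; rewrite acompD -scaleN1r acompZ scaleN1r. Qed.

Lemma comp0 M i : comp i (0 : M) = 0.
Proof. by apply: (addrI (comp i 0)); rewrite -compD !addr0. Qed.

Lemma compN M i (x : M) : comp i (- x) = - comp i x.
Proof. by apply: (addrI (comp i x)); rewrite -compD !subrr comp0. Qed.

Lemma compB M i (x y : M) : comp i (x - y) = comp i x - comp i y.
Proof. by rewrite compD compN. Qed.

Lemma comp_bigsum M i (I : Type) (r : seq I) (P : pred I) (F : I -> M) :
  comp i (\sum_(j <- r | P j) F j) = \sum_(j <- r | P j) comp i (F j).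
Proof. exact: (big_morph _ (compD i) (comp0 M i)). Qed.

Lemma acomp_bigsum n (I : Type) (r : seq I) (P : pred I) (F : I -> A) :
  acomp n (\sum_(j <- r | P j) F j) = \sum_(j <- r | P j) acomp n (F j).
Proof. exact: (big_morph _ (acompD n) (acomp0 n)). Qed.

Lemma ractA M (x : M) a b : x *r a *r b = x *r (a * b).
Proof. by rewrite /ract scalerA. Qed.
Lemma ract1 M (x : M) : x *r 1 = x.
Proof. by rewrite /ract scale1r. Qed.
Lemma ractDr M (x : M) a b : x *r (a + b) = x *r a + x *r b.
Proof. by rewrite /ract scalerDl. Qed.
Lemma ractDl M (x y : M) a : (x + y) *r a = x *r a + y *r a.
Proof. by rewrite /ract scalerDr. Qed.
Lemma ract0l M a : (0 : M) *r a = 0.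
Proof. by rewrite /ract scaler0. Qed.
Lemma ract0r M (x : M) : x *r 0 = 0.
Proof. by rewrite /ract scale0r. Qed.
Lemma ractBr M (x : M) a b : x *r (a - b) = x *r a - x *r b.
Proof. by rewrite /ract scalerBl. Qed.
Lemma ractBl M (x y : M) a : (x - y) *r a = x *r a - y *r a.
Proof. by rewrite /ract scalerBr. Qed.
Lemma ract_sumr M (x : M) (I : Type) (r : seq I) (P : pred I) (F : I -> A) :
  x *r (\sum_(j <- r | P j) F j) = \sum_(j <- r | P j) x *r F j.
Proof. exact: (big_morph _ (ractDr x) (ract0r x)). Qed.
Lemma ract_suml M a (I : Type) (r : seq I) (P : pred I) (F : I -> M) :
  (\sum_(j <- r | P j) F j) *r a = \sum_(j <- r | P j) F j *r a.
Proof. exact: (big_morph (fun x => ract x a) (fun x y => ractDl x y a) (ract0l M a)). Qed.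

Definition kact M (c : k) (x : M) : M := x *r c%:A.

Lemma kactZ M (x : M) c a : x *r (c *: a) = kact c (x *r a).
Proof. by rewrite /kact ractA -scalerAr mulr1. Qed.
Lemma kactA M (x : M) c a : kact c x *r a = kact c (x *r a).
Proof. by rewrite /kact !ractA -scalerAr -scalerAl mulr1 mul1r. Qed.

Lemma acomp_scalar c : acomp 0 (c%:A : A) = c%:A.
Proof. by rewrite acompZ acomp1. Qed.

Lemma acomp_id n a : acomp n (acomp n a) = acomp n a.
Proof. by rewrite acomp_comp eqxx. Qed.
Lemma comp_id M i (x : M) : comp i (comp i x) = comp i x.
Proof. by rewrite comp_comp eqxx. Qed.

Lemma comp_sum_on M (x : M) (s : seq int) :
  uniq s -> (forall i, i \notin s -> comp i x = 0) -> x = \sum_(i <- s) comp i x.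
Proof.
move=> us xs; have [t ut xt] := comp_sum x.
rewrite {1}xt (bigID (mem s)) /= [X in _ + X]big1 ?addr0; last by move=> i /xs.
rewrite [RHS](bigID (mem t)) /= [X in _ + X]big1 ?addr0; last first.
  move=> i it; rewrite xt comp_bigsum big1_seq // => j /andP[_ jt].
  by rewrite comp_comp; case: eqP => // ij; rewrite ij jt in it.
rewrite -big_filter -[RHS]big_filter; apply: perm_big; apply: uniq_perm.
- exact: filter_uniq.
- exact: filter_uniq.
- by move=> i; rewrite !mem_filter andbC.
Qed.

Lemma comp_supp M (x : M) : exists2 s : seq int, uniq s &
  forall i, i \notin s -> comp i x = 0.
Proof.
have [s us xs] := comp_sum x; exists s => // i si.
rewrite xs comp_bigsum big1_seq // => j /andP[_ js].
by rewrite comp_comp; case: eqP => // ij; rewrite ij js in si.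
Qed.

Lemma comp_ract_homog M i n (x : M) a :
  acomp n a = a -> comp i (x *r a) = comp (i - n%:Z) x *r a.
Proof.
move=> ha; have [s us xs] := comp_sum x.
rewrite {1}xs ract_suml comp_bigsum [in RHS]xs comp_bigsum ract_suml.
apply: eq_bigr => j _.
rewrite -[comp j x *r a](comp_ract (i := j) (n := n)) ?comp_id //.
rewrite !comp_comp; have -> : (i - n%:Z == j) = (i == j + n%:Z) by rewrite subr_eq.
case: eqP => _; last by rewrite ract0l.
by apply: comp_ract; rewrite ?comp_id.
Qed.

Lemma comp_kact M i (x : M) c : comp i (kact c x) = kact c (comp i x).
Proof. by rewrite /kact (comp_ract_homog _ _ (acomp_scalar c)) subr0. Qed.

Lemma gfunR M N (f : {linear M -> N}) (x : M) a : f (x *r a) = f x *r a.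
Proof. by rewrite /ract linearZ. Qed.

Definition grhom_eq M N (f g : grhom M N) : Prop := forall x, f x = g x.

Lemma grhom_id_comp M i (x : M) :
  (idfun : {linear M -> M}) (comp i x) = comp i ((idfun : {linear M -> M}) x).
Proof. by []. Qed.
Definition grhom_id M : grhom M M := GrHom (@grhom_id_comp M).

Lemma grhom_cmp_comp M N P (g : grhom N P) (f : grhom M N) i (x : M) :
  (g \o f : {linear M -> P}) (comp i x) = comp i ((g \o f : {linear M -> P}) x).
Proof. by rewrite /= !gfun_comp. Qed.
Definition grhom_cmp M N P (g : grhom N P) (f : grhom M N) : grhom M P :=
  GrHom (@grhom_cmp_comp M N P g f).

Lemma grhom_eq_refl M N (f : grhom M N) : grhom_eq f f.
Proof. by []. Qed.
Lemma grhom_eq_sym M N (f g : grhom M N) : grhom_eq f g -> grhom_eq g f.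
Proof. by move=> fg x. Qed.
Lemma grhom_eq_trans M N (f g h : grhom M N) :
  grhom_eq f g -> grhom_eq g h -> grhom_eq f h.
Proof. by move=> fg gh x; rewrite fg gh. Qed.
Lemma grhom_cmp_eq M N P (g g' : grhom N P) (f f' : grhom M N) :
  grhom_eq g g' -> grhom_eq f f' -> grhom_eq (grhom_cmp g f) (grhom_cmp g' f').
Proof. by move=> gg ff x /=; rewrite ff gg. Qed.
Lemma grhom_cmpA M N P Q (h : grhom P Q) (g : grhom N P) (f : grhom M N) :
  grhom_eq (grhom_cmp h (grhom_cmp g f)) (grhom_cmp (grhom_cmp h g) f).
Proof. by []. Qed.
Lemma grhom_idl M N (f : grhom M N) : grhom_eq (grhom_cmp (grhom_id N) f) f.
Proof. by []. Qed.
Lemma grhom_idr M N (f : grhom M N) : grhom_eq (grhom_cmp f (grhom_id M)) f.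
Proof. by []. Qed.

Definition GrModules : category :=
  Category grhom_eq_refl grhom_eq_sym grhom_eq_trans grhom_cmp_eq
    grhom_cmpA grhom_idl grhom_idr.

Section GradedSubQuotient.
Variables (M : grmod A) (N : grsub M).

Lemma sub_comp_in i (x : submod N) : comp i (val x) \in smemb N.
Proof. by apply/smembP; apply: gsub_comp; apply/smembP; case: x. Qed.

Definition sub_comp i (x : submod N) : submod N := Sub (comp i (val x)) (sub_comp_in i x).

Lemma sub_compD i x y : sub_comp i (x + y) = sub_comp i x + sub_comp i y.
Proof. by apply: val_inj; rewrite /= compD. Qed.
Lemma sub_comp_comp i j x :
  sub_comp i (sub_comp j x) = if i == j then sub_comp j x else 0.
Proof. by apply: val_inj; rewrite /= comp_comp; case: eqP. Qed.
Lemma sub_comp_sum x : exists2 s : seq int, uniq s & x = \sum_(i <- s) sub_comp i x.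
Proof.
have [s us xs] := comp_sum (val x); exists s => //.
by apply: val_inj; rewrite raddf_sum.
Qed.
Lemma val_ract (x : submod N) a : val (x *r a) = val x *r a.
Proof. by rewrite /ract linearZ. Qed.
Lemma sub_comp_ract i n x a :
  sub_comp i x = x -> acomp n a = a -> sub_comp (i + n%:Z) (x *r a) = x *r a.
Proof.
move=> hx ha; apply: val_inj; change (comp (i + n%:Z) (val (x *r a)) = val (x *r a)).
rewrite !val_ract; apply: comp_ract => //.
by rewrite -[in RHS]hx.
Qed.

Definition grsubmod : grmod A :=
  GrMod sub_compD sub_comp_comp sub_comp_sum sub_comp_ract.

Definition quo_comp i (q : quomod N) : quomod N := quo N (comp i (lift_quo q)).

Lemma quo_compE i x : quo_comp i (quo N x) = quo N (comp i x).
Proof.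
by apply/quo_eq; rewrite -compB; apply: gsub_comp; apply/quo_eq; rewrite lift_quoK.
Qed.
Lemma quo_compD i p q : quo_comp i (p + q) = quo_comp i p + quo_comp i q.
Proof. by rewrite -[p]lift_quoK -[q]lift_quoK -quoD !quo_compE compD quoD. Qed.
Lemma quo_comp_comp i j q :
  quo_comp i (quo_comp j q) = if i == j then quo_comp j q else 0.
Proof.
by rewrite -[q]lift_quoK !quo_compE comp_comp; case: eqP; rewrite ?quo0.
Qed.
Lemma quo_comp_sum q : exists2 s : seq int, uniq s & q = \sum_(i <- s) quo_comp i q.
Proof.
have [s us xs] := comp_sum (lift_quo q); exists s => //.
rewrite -{1}[q]lift_quoK {1}xs raddf_sum; apply: eq_bigr => i _.
by rewrite /= -quo_compE lift_quoK.
Qed.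
Lemma quo_ract x a : quo N (x *r a) = quo N x *r a.
Proof. by rewrite /ract quoZ. Qed.
Lemma quo_comp_ract i n q a :
  quo_comp i q = q -> acomp n a = a -> quo_comp (i + n%:Z) (q *r a) = q *r a.
Proof.
move=> hq ha; rewrite -{1 2}hq /quo_comp -/(quo_comp _ _) -quo_ract quo_compE.
by rewrite comp_ract ?comp_id.
Qed.

Definition grquotient : grmod A :=
  GrMod quo_compD quo_comp_comp quo_comp_sum quo_comp_ract.

End GradedSubQuotient.

Section Shift.
Variables (M : grmod A) (n : int).

Lemma shift_comp_comp i j (x : M) :
  comp (n + i) (comp (n + j) x) = if i == j then comp (n + j) x else 0.
Proof. by rewrite comp_comp (inj_eq (addrI n)). Qed.
Lemma shift_comp_sum (x : M) :
  exists2 s : seq int, uniq s & x = \sum_(i <- s) comp (n + i) x.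
Proof.
have [s us xs] := comp_sum x; exists [seq i - n | i <- s].
  by rewrite map_inj_uniq //; apply: addIr.
by rewrite big_map {1}xs; apply: eq_bigr => i _; rewrite addrC subrK.
Qed.
Lemma shift_comp_ract i m (x : M) a :
  comp (n + i) x = x -> acomp m a = a -> comp (n + (i + m%:Z)) (x *r a) = x *r a.
Proof. by rewrite addrA; apply: comp_ract. Qed.

(* [M(n)], with [M(n)_i = M_(n + i)] *)
Definition shift : grmod A :=
  @GrMod k A M (fun i => comp (n + i)) (fun i => @compD k A M (n + i))
    shift_comp_comp shift_comp_sum shift_comp_ract.

End Shift.

Section Regular.
Let AA : lmodType A^c := (A^c)^o.

Definition regular_comp (i : int) (x : AA) : AA :=
  if i is Posz n then acomp n x else 0.

Lemma regular_compD i x y : regular_comp i (x + y) = regular_comp i x + regular_comp i y.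
Proof. by case: i => n /=; [exact: acompD | rewrite addr0]. Qed.
Lemma regular_comp_comp i j x :
  regular_comp i (regular_comp j x) = if i == j then regular_comp j x else 0.
Proof.
case: i j => n [] m //=; try exact: acomp_comp.
- exact: acomp0.
- by rewrite if_same.
Qed.
Lemma regular_comp_sum x :
  exists2 s : seq int, uniq s & x = \sum_(i <- s) regular_comp i x.
Proof.
have [s us xs] := acomp_sum (x : A); exists [seq Posz n | n <- s].
  by rewrite map_inj_uniq // => ? ? [].
by rewrite big_map.
Qed.
Lemma regular_comp_ract i n (x : AA) a :
  regular_comp i x = x -> acomp n a = a -> regular_comp (i + n%:Z) (x *r a) = x *r a.
Proof.
case: i => m /= hx ha; first exact: (acompM hx ha).
rewrite -hx (_ : _ *r a = 0); first by case: (_ + _) => p //=; apply: acomp0.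
by rewrite /ract scaler0.
Qed.

Definition regular : grmod A :=
  GrMod regular_compD regular_comp_comp regular_comp_sum regular_comp_ract.

End Regular.

(* [A_{>= m}], the elements whose components of degree [< m] vanish *)
Section Tail.
Variable m : nat.

Definition tail_mem (x : regular) : Prop := forall n, (n < m)%N -> acomp n (x : A) = 0.

Lemma tail_mem0 : tail_mem 0.
Proof. by move=> n _; apply: acomp0. Qed.
Lemma tail_memD x y : tail_mem x -> tail_mem y -> tail_mem (x + y).
Proof. by move=> hx hy n nm; rewrite [LHS]acompD hx // hy // addr0. Qed.
Lemma tail_memR (x : regular) a : tail_mem x -> tail_mem (x *r a).
Proof.
move=> hx n nm; have [s _ ->] := acomp_sum a; rewrite ract_sumr.
rewrite [LHS]acomp_bigsum big1 // => j _.
change (comp (n%:Z) (x *r acomp j a) = 0 :> regular).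
rewrite (comp_ract_homog _ _ (acomp_id j a)).
suff -> : comp (n%:Z - j%:Z) x = 0 by rewrite ract0l.
have [le_jn|lt_nj] := leqP j n.
  by rewrite subzn //; apply: hx; apply: leq_ltn_trans (leq_subr _ _) nm.
by case E: (n%:Z - j%:Z) => [p|p] //; lia.
Qed.

Definition tail_submodule : submodule regular :=
  @Submodule _ _ tail_mem tail_mem0 tail_memD (fun a x => @tail_memR x a).

Lemma tail_comp i (x : regular) : tail_mem x -> tail_mem (comp i x).
Proof.
move=> hx n nm; case: i => p /=; last exact: acomp0.
by rewrite /regular_comp acomp_comp; case: eqP => // <-; apply: hx.
Qed.

Definition tail : grsub regular :=
  @GrSub k A regular tail_submodule tail_comp.

End Tail.

Definition locally_finite : Prop :=
  forall n, exists (m : nat) (s : 'I_m -> A),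
    (forall i, acomp n (s i) = s i) /\
    forall a, acomp n a = a -> exists c : 'I_m -> k, a = \sum_i c i *: s i.

Definition right_ideal (I : A -> Prop) : Prop :=
  [/\ I 0, forall a b, I a -> I b -> I (a + b)
    & forall a b, I a -> I (a * b)].

Definition right_noetherian : Prop :=
  forall I, right_ideal I -> exists (m : nat) (g : 'I_m -> A),
    (forall i, I (g i)) /\
    forall a, I a -> exists b : 'I_m -> A, a = \sum_i g i * b i.

Definition finite_dim M : Prop :=
  exists (m : nat) (s : 'I_m -> M), forall x, exists c : 'I_m -> k,
    x = \sum_i kact (c i) (s i).

Definition finitely_generated M : Prop :=
  exists (m : nat) (s : 'I_m -> M), forall x, exists a : 'I_m -> A,
    x = \sum_i s i *r a i.

Record directed_system := DirectedSystem {
  ds_index : Type;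
  ds_le : ds_index -> ds_index -> Prop;
  ds_inh : inhabited ds_index;
  ds_refl : forall i, ds_le i i;
  ds_trans : forall i j l, ds_le i j -> ds_le j l -> ds_le i l;
  ds_dir : forall i j, exists l, ds_le i l /\ ds_le j l;
  ds_ob : ds_index -> grmod A;
  ds_map : forall i j, ds_le i j -> grhom (ds_ob i) (ds_ob j);
  ds_map_id : forall i (ii : ds_le i i), grhom_eq (ds_map ii) (grhom_id _);
  ds_map_cmp : forall i j l (ij : ds_le i j) (jl : ds_le j l) (il : ds_le i l),
    grhom_eq (ds_map il) (grhom_cmp (ds_map jl) (ds_map ij))
}.

Definition is_cocone (S : directed_system) M
    (u : forall i : ds_index S, grhom (ds_ob i) M) : Prop :=
  forall i j (ij : ds_le i j), grhom_eq (grhom_cmp (u j) (ds_map ij)) (u i).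

Definition is_direct_limit (S : directed_system) M
    (u : forall i : ds_index S, grhom (ds_ob i) M) : Prop :=
  is_cocone u /\
  forall N (v : forall i : ds_index S, grhom (ds_ob i) N), is_cocone v ->
    exists h : grhom M N, (forall i, grhom_eq (grhom_cmp h (u i)) (v i)) /\
      forall h' : grhom M N,
        (forall i, grhom_eq (grhom_cmp h' (u i)) (v i)) -> grhom_eq h' h.

Definition Fdim M : Prop :=
  exists (S : directed_system) (u : forall i : ds_index S, grhom (ds_ob i) M),
    (forall i : ds_index S, finite_dim (ds_ob i)) /\ is_direct_limit u.

(* The following facts lead to [tors_Fdim] and [Fdim_tors]: a module is in
   [Fdim] iff the annihilator of each of its elements has finite codimension. *)

Definition cofinite (J : A -> Prop) : Prop :=
  exists (m : nat) (s : 'I_m -> A), forall a, exists c : 'I_m -> k,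
    J (a - \sum_i c i *: s i).

Definition tors M (x : M) : Prop := cofinite (fun a => x *r a = 0).

Lemma cofiniteT (T : finType) (J : A -> Prop) (s : T -> A) :
  (forall a, exists c : T -> k, J (a - \sum_i c i *: s i)) -> cofinite J.
Proof.
move=> h; exists #|T|, (fun i => s (enum_val i)) => a.
have [c hc] := h a; exists (fun i => c (enum_val i)).
by rewrite -(big_enum_val (fun i => c i *: s i)).
Qed.

Lemma cofinite_sub (J K : A -> Prop) :
  (forall a, J a -> K a) -> cofinite J -> cofinite K.
Proof.
by move=> JK [m [s hs]]; exists m, s => a; have [c /JK] := hs a; exists c.
Qed.

Lemma cofinite_rel m (R : A -> 'rV[k]_m -> Prop) :
  (forall c a b u v, R a u -> R b v -> R (c *: a + b) (c *: u + v)) ->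
  (forall a, exists u, R a u) -> cofinite (fun a => R a 0).
Proof.
move=> Rlin Rtot.
pose P n := exists (s : 'I_n -> A) (C : 'M[k]_(n, m)),
  row_free C /\ forall i, R (s i) (row i C).
have R0 : R 0 0.
  have [u Ru] := Rtot 0; have := Rlin (-1) _ _ _ _ Ru Ru.
  by rewrite scaler0 addr0 scaleN1r addNr.
have exP : exists n, `[< P n >].
  exists 0; apply/asboolP; exists (fun=> 0), 0; split; last by case.
  by rewrite /row_free mxrank0.
have leP n : `[< P n >] -> (n <= m)%N.
  by move=> /asboolP[s [C [/eqP rC _]]]; rewrite -rC rank_leq_col.
case: (ex_maxnP exP leP) => n /asboolP[s [C [freeC RC]]] maxn.
exists n, s => a; have [u Ru] := Rtot a.
have [/submxP[D uD]|nuC] := boolP (u <= C)%MS.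
  exists (fun i => D 0 i).
  have : forall r : seq 'I_n, R (\sum_(i <- r) D 0 i *: s i)
      (\sum_(i <- r) D 0 i *: row i C).
    elim=> [|i r IH]; first by rewrite !big_nil.
    by rewrite !big_cons; apply: Rlin.
  move=> /(_ (index_enum _)); rewrite -mulmx_sum_row -uD => Ru'.
  have := Rlin (-1) _ _ _ _ Ru' Ru.
  by rewrite !scaleN1r addNr addrC.
suff : `[< P (1 + n)%N >] by move=> /maxn; rewrite ltnn.
apply/asboolP; exists (fun i => match split i with inl _ => a | inr j => s j end),
  (col_mx u C); split.
  rewrite /row_free eqn_leq rank_leq_row /=.
  suff : (n < \rank (u + C)%MS)%N by rewrite addsmxE.
  have lt : (C < u + C)%MS.
    by rewrite /ltmx addsmxSr /=; apply: contra nuC; apply: submx_trans; apply: addsmxSl.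
  by move: lt; rewrite ltmxErank (eqP freeC) => /andP[].
move=> i; case: (splitP i) => j ij.
  have -> : i = lshift n j by apply: val_inj.
  by rewrite rowKu row_id.
have -> : i = rshift 1 j by apply: val_inj.
by rewrite rowKd.
Qed.

Lemma kactDr M c : {morph @kact M c : x y / x + y}.
Proof. by move=> x y; rewrite /kact ractDl. Qed.
Lemma kactDl M c d (x : M) : kact (c + d) x = kact c x + kact d x.
Proof. by rewrite /kact scalerDl ractDr. Qed.
Lemma kactM M c d (x : M) : kact (c * d) x = kact c (kact d x).
Proof. by rewrite /kact ractA -scalerAl mul1r scalerA mulrC. Qed.
Lemma kact0 M c : kact c (0 : M) = 0.
Proof. exact: ract0l. Qed.
Lemma kactN1 M (x : M) : kact (-1) x = - x.
Proof. by rewrite /kact /ract scaleN1r scaleN1r. Qed.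
Lemma kact_sumr M c (I : Type) (r : seq I) (P : pred I) (F : I -> M) :
  kact c (\sum_(j <- r | P j) F j) = \sum_(j <- r | P j) kact c (F j).
Proof. exact: (big_morph _ (kactDr c) (kact0 M c)). Qed.

Lemma smem_kact M (B : submodule M) c x : B x -> B (kact c x).
Proof. exact: smemZ. Qed.

Lemma smem_ract M (B : submodule M) x a : B x -> B (x *r a).
Proof. exact: smemZ. Qed.

(* If [xA] is finite dimensional modulo [B], then so is [A] modulo the
   annihilator of [x] modulo [B]. *)
Lemma cofinite_span M (B : submodule M) (x : M) m (s : 'I_m -> M) :
  (forall a, exists c : 'I_m -> k, B (x *r a - \sum_i kact (c i) (s i))) ->
  cofinite (fun a => B (x *r a)).
Proof.
move=> h; pose R a (u : 'rV[k]_m) := B (x *r a - \sum_i kact (u 0 i) (s i)).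
have : cofinite (fun a => R a 0).
  apply: cofinite_rel => [c a b u v Ra Rb|a].
    suff -> : R (c *: a + b) (c *: u + v) =
      B (kact c (x *r a - \sum_i kact (u 0 i) (s i)) +
         (x *r b - \sum_i kact (v 0 i) (s i))).
      by apply: smemD => //; apply: smem_kact.
    rewrite /R; congr (B _); rewrite ractDr kactZ.
    rewrite -[- \sum_(i < m) kact (u 0 i) _]kactN1 kactDr.
    rewrite -kactM mulrC kactM kactN1 kact_sumr addrACA -opprD -big_split /=.
    by congr (_ - _); apply: eq_bigr => i _; rewrite !mxE kactDl kactM.
  have [c hc] := h a; exists (\row_i c i); rewrite /R.
  by under eq_bigr do rewrite mxE.
apply: cofinite_sub => a; rewrite /R big1 ?subr0 // => i _.
by rewrite mxE /kact scale0r ract0r.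
Qed.

Lemma cofinite_colon (K : A -> Prop) a :
  right_ideal K -> cofinite K -> cofinite (fun b => K (a * b)).
Proof.
case=> K0 KD KM [m [s hs]].
have KZ c x : K x -> K (c *: x).
  by move=> Kx; rewrite -[c *: x]mulr1 -scalerAl scalerAr; apply: KM.
pose R b (u : 'rV[k]_m) := K (a * b - \sum_i u 0 i *: s i).
have : cofinite (fun b => R b 0).
  apply: cofinite_rel => [c b b' u v Rb Rb'|b].
    rewrite /R (_ : _ - _ = c *: (a * b - \sum_i u 0 i *: s i) +
        (a * b' - \sum_i v 0 i *: s i)); first by apply: KD => //; apply: KZ.
    rewrite mulrDr -scalerAr scalerBr scaler_sumr addrACA -opprD -big_split /=.
    by congr (_ - _); apply: eq_bigr => i _; rewrite !mxE scalerDl scalerA.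
  have [c hc] := hs (a * b); exists (\row_i c i); rewrite /R.
  by under eq_bigr do rewrite mxE.
apply: cofinite_sub => b; rewrite /R big1 ?subr0 // => i _.
by rewrite mxE scale0r.
Qed.

Lemma cofiniteT_ext (J K : A -> Prop) :
  right_noetherian -> right_ideal J -> right_ideal K -> cofinite J ->
  (forall a, J a -> cofinite (fun b => K (a * b))) -> cofinite K.
Proof.
move=> noeth Jid [K0 KD KM] [m [s hs]] JK.
have [r [g [Jg gJ]]] := noeth _ Jid.
have KZ c x : K x -> K (c *: x).
  by move=> Kx; rewrite -[c *: x]mulr1 -scalerAl scalerAr; apply: KM.
have Ksum (I : Type) (q : seq I) (F : I -> A) :
    (forall i, K (F i)) -> K (\sum_(i <- q) F i).
  by move=> KF; elim/big_ind: _.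
have /choice[n hn] : forall l : 'I_r, exists n : {n : nat & 'I_n -> A},
    forall b, exists c : 'I_(tag n) -> k, K (g l * (b - \sum_i c i *: tagged n i)).
  by move=> l; have [n [t ht]] := JK _ (Jg l); exists (Tagged (fun n => 'I_n -> A) t).
pose T := ('I_m + {l : 'I_r & 'I_(tag (n l))})%type.
apply: (@cofiniteT T K (fun t => match t with
  | inl i => s i | inr p => g (tag p) * tagged (n (tag p)) (tagged p) end)) => a.
have [c hc] := hs a; have [b hb] := gJ _ hc.
have /choice[d hd] : forall l : 'I_r, exists d : nat -> k,
    K (g l * (b l - \sum_i d (val i) *: tagged (n l) i)).
  move=> l; have [d hd] := hn l (b l).
  exists (fun j => if insub j is Some i then d i else 0).
  by under eq_bigr => i _ do rewrite (valK i).
exists (fun t : T => match t with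
  | inl i => c i | inr p => d (tag p) (nat_of_ord (tagged p)) end).
rewrite big_sumType /= opprD addrA hb.
have -> : \sum_(i : {l : 'I_r & 'I_(tag (n l))})
    d (tag i) (nat_of_ord (tagged i)) *: (g (tag i) * tagged (n (tag i)) (tagged i)) =
  \sum_l \sum_i d l (nat_of_ord i) *: (g l * tagged (n l) i).
  exact/esym/(sig_big_dep (fun=> true) (fun _ _ => true)
     (fun l (i : 'I_(tag (n l))) => d l (nat_of_ord i) *: (g l * tagged (n l) i))).
rewrite -sumrB; apply: Ksum => l; move: (hd l).
rewrite mulrBr mulr_sumr; congr (K (_ - _)).
by apply: eq_bigr => i _; rewrite -scalerAr.
Qed.

Section MkGrHom.
Variables (M N : grmod A) (f : M -> N) (f_lin : linear f).
Hypothesis f_comp : forall i x, f (comp i x) = comp i (f x).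
Definition mklinear : {linear M -> N} :=
  HB.pack f (GRing.isLinear.Build A^c M N _ f f_lin).
Definition mkgrhom : grhom M N := @GrHom k A M N mklinear f_comp.
End MkGrHom.

Section InclusionProjection.
Variable M : grmod A.

Definition grval_fun (N : grsub M) (x : grsubmod N) : M := val x.
Lemma grval_linear (N : grsub M) : linear (@grval_fun N).
Proof. by move=> a x y; rewrite /grval_fun linearP. Qed.
Lemma grval_comp (N : grsub M) i (x : grsubmod N) :
  grval_fun (comp i x) = comp i (grval_fun x).
Proof. by []. Qed.
Definition grval (N : grsub M) : grhom (grsubmod N) M :=
  mkgrhom (@grval_linear N) (@grval_comp N).

Section Incl.
Variables (N N' : grsub M) (NN' : forall x, N x -> N' x).

Lemma incl_in (x : submod N) : val x \in smemb N'.
Proof. by apply/smembP/NN'/smembP; case: x. Qed.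
Definition incl (x : grsubmod N) : grsubmod N' := Sub (val x) (incl_in x).
Lemma incl_linear : linear incl.
Proof.
move=> a x y; apply: val_inj.
exact: etrans (grval_linear a x y) (esym (grval_linear a (incl x) (incl y))).
Qed.
Lemma incl_comp i (x : grsubmod N) : incl (comp i x) = comp i (incl x).
Proof. exact: val_inj. Qed.
Definition grincl : grhom (grsubmod N) (grsubmod N') := mkgrhom incl_linear incl_comp.
End Incl.

Definition grquo_fun (N : grsub M) (x : M) : grquotient N := quo N x.
Lemma grquo_linear (N : grsub M) : linear (@grquo_fun N).
Proof. by move=> a x y; rewrite /grquo_fun quoD quoZ. Qed.
Lemma grquo_comp (N : grsub M) i (x : M) :
  grquo_fun N (comp i x) = comp i (grquo_fun N x).
Proof. by rewrite -[RHS]/(quo_comp i (quo N x)) quo_compE. Qed.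
Definition grquo (N : grsub M) : grhom M (grquotient N) :=
  mkgrhom (@grquo_linear N) (@grquo_comp N).

Lemma grzero_linear P : linear (fun _ : M => 0 : P).
Proof. by move=> a x y; rewrite scaler0 addr0. Qed.
Lemma grzero_comp P i (x : M) : 0 = comp i (0 : P).
Proof. by rewrite comp0. Qed.
Definition grzero P : grhom M P := mkgrhom (@grzero_linear P) (@grzero_comp P).

End InclusionProjection.

Lemma val_kact M (N : grsub M) c (x : grsubmod N) :
  val (kact c x : submod N) = kact c (val (x : submod N)).
Proof. exact: val_ract. Qed.

Lemma finite_dim_sub M (N : grsub M) (T : finType) (s : T -> M) :
  (forall t, N (s t)) ->
  (forall x, N x -> exists c : T -> k, x = \sum_t kact (c t) (s t)) ->
  finite_dim (grsubmod N).
Proof.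
move=> Ns hs; have Ns' t : s t \in smemb N by apply/smembP.
exists #|T|, (fun i => Sub (s (enum_val i)) (Ns' (enum_val i))) => x.
have [|c hc] := hs (val x); first by apply/smembP; case: x.
exists (fun i => c (enum_val i)); apply: val_inj.
rewrite raddf_sum hc (big_enum_val (fun t => kact (c t) (s t))).
apply: eq_bigr => i _.
exact: esym (@val_kact M N _ (Sub (s (enum_val i)) (Ns' (enum_val i)))).
Qed.

Lemma trivial_submodule M : exists B : submodule M, forall x, B x <-> x = 0.
Proof.
have B0 : (0 : M) = 0 by [].
have BD (x y : M) : x = 0 -> y = 0 -> x + y = 0 by move=> -> ->; rewrite addr0.
have BZ (a : A^c) (x : M) : x = 0 -> a *: x = 0 by move=> ->; rewrite scaler0.
by exists (@Submodule _ M (fun x => x = 0) B0 BD BZ).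
Qed.

Lemma gfun_kact M N (f : grhom M N) c (x : M) : f (kact c x) = kact c (f x).
Proof. exact: gfunR. Qed.

Lemma finite_dim_tors M (x : M) : finite_dim M -> tors x.
Proof.
case=> m [s hs]; have [B hB] := trivial_submodule M.
have : cofinite (fun a => B (x *r a)).
  apply: (@cofinite_span M B x m s) => a; have [c hc] := hs (x *r a).
  by exists c; apply/hB; rewrite -hc subrr.
by apply: cofinite_sub => a /hB.
Qed.

Lemma tors_gfun M N (f : grhom M N) (x : M) : tors x -> tors (f x).
Proof. by apply: cofinite_sub => a xa; rewrite -gfunR xa linear0. Qed.

Lemma Fdim_tors M (x : M) : Fdim M -> tors x.
Proof.
case=> S [u [fdS [uc ulim]]].
pose U (y : M) := exists i (z : ds_ob i), u i z = y.
have U0 : U 0 by case: (ds_inh S) => i; exists i, 0; rewrite linear0.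
have UD y y' : U y -> U y' -> U (y + y').
  move=> [i [z <-]] [j [z' <-]]; have [l [il jl]] := ds_dir i j.
  exists l, (ds_map il z + ds_map jl z').
  by rewrite linearD -(uc _ _ il z) -(uc _ _ jl z').
have UZ (a : A^c) y : U y -> U (a *: y).
  by move=> [i [z <-]]; exists i, (a *: z); rewrite linearZ.
have UC j y : U y -> U (comp j y).
  by move=> [i [z <-]]; exists i, (comp j z); rewrite gfun_comp.
pose V : grsub M := @GrSub _ _ M (@Submodule _ _ U U0 UD UZ) UC.
have [|h [_ huniq]] := ulim (grquotient V) (fun i => grzero (ds_ob i) (grquotient V)).
  by move=> i j ij z.
have e1 : grhom_eq (grquo V) h.
  apply: huniq => i z; apply/eqP; rewrite -[X in _ == X](quo0 V); apply/eqP/quo_eq.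
  by rewrite subr0; exists i, z.
have e2 : grhom_eq (grzero M _) h by apply: huniq => i z.
have : quo V x = quo V 0 by rewrite quo0 -[RHS]/(grzero M (grquotient V) x) e2 -e1.
move/quo_eq; rewrite subr0 => -[i [z <-]].
exact/tors_gfun/finite_dim_tors/fdS.
Qed.

(* the graded submodule generated by the homogeneous components of [x] *)
Section Hull.
Variables (M : grmod A) (x : M).

Definition hull_mem (y : M) : Prop :=
  forall j, exists a, comp j y = comp j (x *r a).

Lemma hull_mem0 : hull_mem 0.
Proof. by move=> j; exists 0; rewrite ract0r. Qed.
Lemma hull_memD y z : hull_mem y -> hull_mem z -> hull_mem (y + z).
Proof.
move=> hy hz j; have [[a ha] [b hb]] := (hy j, hz j).
by exists (a + b); rewrite ractDr !compD ha hb.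
Qed.
Lemma hull_memR (y : M) b : hull_mem y -> hull_mem (y *r b).
Proof.
move=> hy; have [s _ ->] := acomp_sum b; rewrite ract_sumr.
elim: s => [|n s IH]; first by rewrite big_nil; exact: hull_mem0.
rewrite big_cons; apply: hull_memD IH => j.
have [a ha] := hy (j - n%:Z); exists (a * acomp n b).
by rewrite -ractA !(comp_ract_homog _ _ (acomp_id n b)) ha.
Qed.
Lemma hull_comp i y : hull_mem y -> hull_mem (comp i y).
Proof.
move=> hy j; rewrite comp_comp; case: eqP => [<-|_]; first exact: hy.
by exists 0; rewrite ract0r comp0.
Qed.

Definition hull : grsub M :=
  @GrSub _ _ M (@Submodule _ M hull_mem hull_mem0 hull_memD
    (fun a y => @hull_memR y a)) hull_comp.

Lemma hull_self : hull x.
Proof. by move=> j; exists 1; rewrite ract1. Qed.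

Lemma hull_finite_dim : tors x -> finite_dim (grsubmod hull).
Proof.
case=> m [t ht].
have /choice[sp hsp] : forall i : 'I_m, exists s : seq int,
    forall j, j \notin s -> comp j (x *r t i) = 0.
  by move=> i; have [s _ hs] := comp_supp (x *r t i); exists s.
pose S := undup (flatten [seq sp i | i <- enum 'I_m]).
have hS j : j \notin S -> forall i, comp j (x *r t i) = 0.
  move=> jS i; apply: hsp; apply: contra jS => jsp; rewrite mem_undup.
  by apply/flattenP; exists (sp i) => //; apply: map_f; rewrite mem_enum.
have hx a j : exists c : 'I_m -> k,
    comp j (x *r a) = \sum_i kact (c i) (comp j (x *r t i)).
  have [c hc] := ht a; exists c.
  have -> : x *r a = \sum_i kact (c i) (x *r t i).
    move/eqP: hc; rewrite ractBr subr_eq0 => /eqP ->.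
    by rewrite ract_sumr; apply: eq_bigr => i _; rewrite kactZ.
  by rewrite comp_bigsum; apply: eq_bigr => i _; rewrite comp_kact.
apply: (@finite_dim_sub M hull ('I_(size S) * 'I_m)%type
  (fun p => comp (nth 0 S p.1) (x *r t p.2))).
  by move=> [p i] /=; apply/hull_comp/hull_memR/hull_self.
move=> y hy.
have /choice[c hc] : forall j, exists c : 'I_m -> k,
    comp j y = \sum_i kact (c i) (comp j (x *r t i)).
  by move=> j; have [a ->] := hy j; apply: hx.
exists (fun p : 'I_(size S) * 'I_m => c (nth 0 S p.1) p.2).
rewrite [LHS](@comp_sum_on _ y S) ?undup_uniq //; last first.
  by move=> j jS; rewrite hc big1 // => i _; rewrite (hS j jS) kact0.
rewrite (big_nth 0) big_mkord.
rewrite -(pair_bigA _ (fun (p : 'I_(size S)) (i : 'I_m) =>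
  kact (c (nth 0 S p) i) (comp (nth 0 S p) (x *r t i)))) /=.
by apply: eq_bigr => p _; rewrite {1}hc.
Qed.

End Hull.

Section SubmoduleSum.
Variables (M : grmod A) (N N' : grsub M).

Definition sum_mem (y : M) : Prop := exists a b : M, [/\ N a, N' b & y = a + b].

Lemma sum_mem0 : sum_mem 0.
Proof. by exists 0, 0; split; rewrite ?addr0 //; apply: smem0. Qed.
Lemma sum_memD y z : sum_mem y -> sum_mem z -> sum_mem (y + z).
Proof.
move=> [a [b [Na Nb ->]]] [a' [b' [Na' Nb' ->]]].
by exists (a + a'), (b + b'); split; rewrite 1?addrACA //; apply: smemD.
Qed.
Lemma sum_memZ (c : A^c) y : sum_mem y -> sum_mem (c *: y).
Proof.
move=> [a [b [Na Nb ->]]].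
by exists (c *: a), (c *: b); split; rewrite ?scalerDr //; apply: smemZ.
Qed.
Lemma sum_comp i y : sum_mem y -> sum_mem (comp i y).
Proof.
move=> [a [b [Na Nb ->]]].
by exists (comp i a), (comp i b); split; rewrite ?compD //; apply: gsub_comp.
Qed.

Definition grsum : grsub M :=
  @GrSub _ _ M (@Submodule _ M sum_mem sum_mem0 sum_memD sum_memZ) sum_comp.

Lemma grsum_l x : N x -> grsum x.
Proof. by exists x, 0; split; rewrite ?addr0 //; apply: smem0. Qed.
Lemma grsum_r x : N' x -> grsum x.
Proof. by exists 0, x; split; rewrite ?add0r //; apply: smem0. Qed.

Lemma grsum_finite_dim :
  finite_dim (grsubmod N) -> finite_dim (grsubmod N') -> finite_dim (grsubmod grsum).
Proof.
move=> [m [s hs]] [m' [s' hs']].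
apply: (@finite_dim_sub M grsum ('I_m + 'I_m')%type
  (fun p => match p with inl i => val (s i) | inr i => val (s' i) end)).
  by case=> i; [apply: grsum_l|apply: grsum_r]; apply/smembP; case: (_ i).
move=> x [a [b [Na Nb ->]]].
have [c hc] := hs (Sub a (introT (smembP _ _) Na)).
have [d hd] := hs' (Sub b (introT (smembP _ _) Nb)).
exists (fun p => match p with inl i => c i | inr i => d i end).
rewrite big_sumType /=; congr (_ + _).
  rewrite -[LHS](SubK (submod N) (introT (smembP _ _) Na)) hc raddf_sum.
  by apply: eq_bigr => i _; exact: val_kact.
rewrite -[LHS](SubK (submod N') (introT (smembP _ _) Nb)) hd raddf_sum.
by apply: eq_bigr => i _; exact: val_kact.
Qed.

End SubmoduleSum.

(* If every element of [M] is torsion, then [M] is the direct limit of its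
   finite dimensional graded submodules. *)
Section TorsionFdim.
Variables (M : grmod A) (torsM : forall x : M, tors x).

Definition fdsub : Type := {N : grsub M | finite_dim (grsubmod N)}.
Definition fdsub_le (N N' : fdsub) : Prop := forall x, sval N x -> sval N' x.
Definition fdsub_hull (x : M) : fdsub := 
  exist (fun N : grsub M => finite_dim (grsubmod N)) (hull x) (hull_finite_dim (torsM x)).

Lemma fdsub_refl (N : fdsub) : fdsub_le N N.
Proof. by []. Qed.
Lemma fdsub_trans (N N' N'' : fdsub) : fdsub_le N N' -> fdsub_le N' N'' -> fdsub_le N N''.
Proof. by move=> h h' x /h/h'. Qed.
Lemma fdsub_dir (N N' : fdsub) : exists N'' : fdsub, fdsub_le N N'' /\ fdsub_le N' N''.
Proof.
exists (exist (fun N : grsub M => finite_dim (grsubmod N)) _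
  (grsum_finite_dim (svalP N) (svalP N'))).
by split=> x; [apply: grsum_l|apply: grsum_r].
Qed.

Definition fdsub_ob (N : fdsub) : grmod A := grsubmod (sval N).
Definition fdsub_map (N N' : fdsub) (le : fdsub_le N N') : grhom (fdsub_ob N) (fdsub_ob N') :=
  grincl le.

Lemma fdsub_map_id (N : fdsub) (le : fdsub_le N N) : grhom_eq (fdsub_map le) (grhom_id _).
Proof. by move=> x; apply: val_inj. Qed.
Lemma fdsub_map_cmp (N N' N'' : fdsub) (l : fdsub_le N N') (l' : fdsub_le N' N'')
    (l'' : fdsub_le N N'') :
  grhom_eq (fdsub_map l'') (grhom_cmp (fdsub_map l') (fdsub_map l)).
Proof. by move=> x; apply: val_inj. Qed.

Definition fdsub_system : directed_system :=
  DirectedSystem (inhabits (fdsub_hull 0)) fdsub_refl fdsub_trans fdsub_dir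
    fdsub_map_id fdsub_map_cmp.

Lemma tors_Fdim : Fdim M.
Proof.
exists fdsub_system, (fun N : fdsub => grval (sval N)); split; first by move=> N; exact: (svalP (N : fdsub)).
split=> [N N' le x //|P v vc].
have vE (N N' : fdsub) (x : fdsub_ob N) (y : fdsub_ob N') :
    val x = val y :> M -> v N x = v N' y.
  move=> xy; have [N'' [le le']] := fdsub_dir N N'.
  rewrite -(vc _ _ le x) -(vc _ _ le' y); congr (v N'' _); exact: val_inj.
pose el (N : fdsub) (x : M) (Nx : sval N x) : fdsub_ob N :=
  Sub x (introT (smembP _ _) Nx).
pose h0 (x : M) : P := v (fdsub_hull x) (@el (fdsub_hull x) x (hull_self x)).
have hE (N : fdsub) (x : fdsub_ob N) : v N x = h0 (val x) by apply: vE.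
have h0lin : linear h0.
  move=> a x y; have [N [le le']] := fdsub_dir (fdsub_hull x) (fdsub_hull y).
  pose x' := @el N x (le _ (hull_self x)); pose y' := @el N y (le' _ (hull_self y)).
  have -> : h0 x = v N x' by rewrite hE.
  have -> : h0 y = v N y' by rewrite hE.
  by rewrite -linearP hE linearP.
have hcomp i x : h0 (comp i x) = comp i (h0 x).
  pose x' := @el (fdsub_hull x) x (hull_self x).
  by rewrite -[x]/(val x') -(hE _ x') -gfun_comp hE.
exists (mkgrhom h0lin hcomp); split=> [N x|h' h'v x]; first by rewrite /= -hE.
exact: h'v (fdsub_hull x) (@el (fdsub_hull x) x (hull_self x)).
Qed.

End TorsionFdim.

Lemma Fdim_subP M (N : grsub M) :
  Fdim (grsubmod N) <-> forall x, N x -> tors x.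
Proof.
split=> [fN x Nx|tN].
  exact: (tors_gfun (grval N)
    (Fdim_tors (Sub x (introT (smembP _ _) Nx) : grsubmod N) fN)).
apply: tors_Fdim => x; have : tors (val x) by apply/tN/smembP; case: x.
by apply: cofinite_sub => a xa; apply: val_inj; rewrite val_ract xa.
Qed.

Lemma Fdim_quoP M (N : grsub M) :
  Fdim (grquotient N) <-> forall x, cofinite (fun a => N (x *r a)).
Proof.
have E (x : M) a : quo N x *r a = 0 <-> N (x *r a).
  by rewrite -quo_ract -(quo0 N) quo_eq subr0.
split=> [fN x|tN].
  by have := Fdim_tors (quo N x : grquotient N) fN; apply: cofinite_sub => a /E.
apply: tors_Fdim => q; rewrite -[q]lift_quoK.
by have := tN (lift_quo q); apply: cofinite_sub => a /E.
Qed.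

(* A morphism [pi M -> pi N] of the quotient category is represented by a morphism
   [f : M' -> N/N'] of graded modules, where [M/M'] and [N'] are in [Fdim A].  It is
   encoded by its graph, the relation [R = {(x, y) | x \in M', f x = y + N'}], from
   which [M' = {x | exists y, R x y}] and [N' = {y | R 0 y}] are recovered. *)
Record grrel M N := GrRel {
  rel_mem :> M -> N -> Prop;
  rel0 : rel_mem 0 0;
  relD : forall x x' y y', rel_mem x y -> rel_mem x' y' -> rel_mem (x + x') (y + y');
  relR : forall x y a, rel_mem x y -> rel_mem (x *r a) (y *r a);
  rel_comp : forall i x y, rel_mem x y -> rel_mem (comp i x) (comp i y)
}.

Section Relations.
Variables (M N : grmod A) (R : grrel M N).

Definition dom_mem (x : M) : Prop := exists y, R x y.
Lemma dom_mem0 : dom_mem 0.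
Proof. by exists 0; apply: rel0. Qed.
Lemma dom_memD x x' : dom_mem x -> dom_mem x' -> dom_mem (x + x').
Proof. by move=> [y xy] [y' xy']; exists (y + y'); apply: relD. Qed.
Lemma dom_memZ (a : A^c) x : dom_mem x -> dom_mem (a *: x).
Proof. by move=> [y xy]; exists (y *r a); apply: relR. Qed.
Lemma dom_comp i x : dom_mem x -> dom_mem (comp i x).
Proof. by move=> [y xy]; exists (comp i y); apply: rel_comp. Qed.
Definition dom : grsub M :=
  @GrSub _ _ M (@Submodule _ M dom_mem dom_mem0 dom_memD dom_memZ) dom_comp.

Definition ind_mem (y : N) : Prop := R 0 y.
Lemma ind_memD y y' : ind_mem y -> ind_mem y' -> ind_mem (y + y').
Proof. by move=> hy hy'; rewrite /ind_mem -[0]addr0; apply: relD. Qed.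
Lemma ind_memZ (a : A^c) y : ind_mem y -> ind_mem (a *: y).
Proof. by move=> hy; have := relR a hy; rewrite ract0l. Qed.
Lemma ind_comp i y : ind_mem y -> ind_mem (comp i y).
Proof. by move=> hy; have := rel_comp i hy; rewrite comp0. Qed.
Definition ind : grsub N :=
  @GrSub _ _ N (@Submodule _ N ind_mem (rel0 R) ind_memD ind_memZ) ind_comp.

Lemma relB x x' y y' : R x y -> R x' y' -> R (x - x') (y - y').
Proof.
move=> h h'; apply: relD => //; have := relR (-1) h'.
by rewrite /ract !scaleN1r.
Qed.

Lemma rel_ind x y y' : R x y -> R x y' -> ind (y - y').
Proof. by move=> h h'; have := relB h h'; rewrite subrr. Qed.

End Relations.

Record tails_hom M N := TailsHom {
  th_rel :> grrel M N;
  th_dom : Fdim (grquotient (dom th_rel));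
  th_ind : Fdim (grsubmod (ind th_rel))
}.

(* equality in the direct limit of the groups [Hom(M', N/N')] *)
Definition tails_eq M N (R S : tails_hom M N) : Prop :=
  exists (M' : grsub M) (N' : grsub N),
    [/\ Fdim (grquotient M') /\ Fdim (grsubmod N'),
        forall x, M' x -> dom R x /\ dom S x,
        forall y, ind R y \/ ind S y -> N' y
      & forall x y y', M' x -> R x y -> S x y' -> N' (y - y')].

Hypothesis noeth : right_noetherian.

Lemma ideal_colon M (B : submodule M) (x : M) : right_ideal (fun a => B (x *r a)).
Proof.
split; first by rewrite ract0r; apply: smem0.
- by move=> a b Ba Bb; rewrite ractDr; apply: smemD.
- by move=> a b Ba; rewrite -ractA; apply: smem_ract.
Qed.

Lemma ideal_ann M (x : M) : right_ideal (fun a => x *r a = 0).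
Proof.
split; first exact: ract0r.
- by move=> a b Ba Bb; rewrite ractDr Ba Bb addr0.
- by move=> a b Ba; rewrite -ractA Ba ract0l.
Qed.

Lemma tors_ext M (J : A -> Prop) (x : M) :
  right_ideal J -> cofinite J -> (forall a, J a -> tors (x *r a)) -> tors x.
Proof.
move=> Jid cJ h; apply: (cofiniteT_ext noeth Jid (ideal_ann x) cJ) => a /h.
by apply: cofinite_sub => b; rewrite ractA.
Qed.

Lemma torsR M (x : M) a : tors x -> tors (x *r a).
Proof.
move=> /(cofinite_colon a (ideal_ann x)).
by apply: cofinite_sub => b; rewrite ractA.
Qed.

Lemma torsD M (x y : M) : tors x -> tors y -> tors (x + y).
Proof.
move=> tx ty; apply: (tors_ext (ideal_ann x) tx) => a xa.
by rewrite ractDl xa add0r; apply: torsR.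
Qed.

Lemma torsN M (x : M) : tors x -> tors (- x).
Proof. by move=> /(torsR (-1)); rewrite /ract scaleN1r. Qed.

Lemma tors0 M : tors (0 : M).
Proof. by exists 0, (fun=> 0) => a; exists (fun=> 0); rewrite ract0l. Qed.

Lemma th_dom_cofinite M N (R : tails_hom M N) x : cofinite (fun a => dom R (x *r a)).
Proof. exact: (Fdim_quoP (dom R)).1 (th_dom R) x. Qed.

Lemma th_ind_tors M N (R : tails_hom M N) y : ind R y -> tors y.
Proof. exact: (Fdim_subP (ind R)).1 (th_ind R) y. Qed.

Lemma tails_eqP M N (R S : tails_hom M N) :
  tails_eq R S <-> forall x y y', R x y -> S x y' -> tors (y - y').
Proof.
split=> [[M' [N' [[fM' fN'] _ _ h]]] x y y' Rxy Sxy'|h].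
  apply: (tors_ext (ideal_colon M' x)); first exact: (Fdim_quoP M').1 fM' x.
  move=> a Ma; rewrite ractBl.
  by apply: (Fdim_subP N').1 fN' _ _; apply: h Ma _ _; apply: relR.
pose MU x := dom R x /\ dom S x.
have MU0 : MU 0 by split; apply: smem0.
have MUD x x' : MU x -> MU x' -> MU (x + x').
  by move=> [? ?] [? ?]; split; apply: smemD.
have MUZ (a : A^c) x : MU x -> MU (a *: x) by move=> [? ?]; split; apply: smemZ.
have MUC i x : MU x -> MU (comp i x) by move=> [? ?]; split; apply: gsub_comp.
pose M' : grsub M := @GrSub _ _ M (@Submodule _ M MU MU0 MUD MUZ) MUC.
pose NU y := exists x z z', [/\ R x z, S x z' & y = z - z'].
have NU0 : NU 0 by exists 0, 0, 0; rewrite subrr; split=> //; apply: rel0.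
have NUD y y' : NU y -> NU y' -> NU (y + y').
  move=> [x [z [z' [h1 h2 ->]]]] [x' [t [t' [h1' h2' ->]]]].
  exists (x + x'), (z + t), (z' + t'); split; try exact: relD.
  by rewrite opprD addrACA.
have NUZ (a : A^c) y : NU y -> NU (a *: y).
  move=> [x [z [z' [h1 h2 ->]]]]; exists (x *r a), (z *r a), (z' *r a).
  by split; [exact: relR|exact: relR|rewrite -ractBl].
have NUC i y : NU y -> NU (comp i y).
  move=> [x [z [z' [h1 h2 ->]]]]; exists (comp i x), (comp i z), (comp i z').
  by split; [exact: rel_comp|exact: rel_comp|rewrite compB].
pose N' : grsub N := @GrSub _ _ N (@Submodule _ N NU NU0 NUD NUZ) NUC.
exists M', N'; split=> //.
- split; last by apply/Fdim_subP => y [x [z [z' [? ? ->]]]]; apply: h; eassumption.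
  apply/Fdim_quoP => x.
  apply: (cofiniteT_ext noeth (ideal_colon (dom R) x) (ideal_colon M' x)
    (th_dom_cofinite R x)) => a Ra.
  have := th_dom_cofinite S (x *r a); apply: cofinite_sub => b.
  by rewrite -ractA => Sb; split=> //; apply: smem_ract.
- move=> y [hy|hy]; first by exists 0, y, 0; rewrite subr0; split=> //; apply: rel0.
  exists 0, 0, (- y); rewrite sub0r opprK; split=> //; first exact: rel0.
  by apply: (smemN hy).
- by move=> x y y' _ h1 h2; exists x, y, y'.
Qed.

Lemma tails_eq_sub M N (R S : tails_hom M N) :
  (forall x y, R x y -> S x y) -> tails_eq R S.
Proof.
move=> RS; apply/tails_eqP => x y y' /RS h h'.
exact: th_ind_tors (rel_ind h h').
Qed.

Lemma tails_eq_refl M N (R : tails_hom M N) : tails_eq R R.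
Proof. exact: tails_eq_sub. Qed.

Lemma tails_eq_sym M N (R S : tails_hom M N) : tails_eq R S -> tails_eq S R.
Proof.
move=> /tails_eqP RS; apply/tails_eqP => x y y' h h'.
by rewrite -opprB; apply/torsN/(RS x).
Qed.

Lemma tails_eq_trans M N (R S T : tails_hom M N) :
  tails_eq R S -> tails_eq S T -> tails_eq R T.
Proof.
move=> /tails_eqP RS /tails_eqP ST; apply/tails_eqP => x y y' h h'.
apply: (tors_ext (ideal_colon (dom S) x) (th_dom_cofinite S x)) => a [z hz].
rewrite ractBl -(subrK z (y *r a)) -addrA; apply: torsD.
  by apply: RS hz; apply: relR.
by apply: (ST _ _ _ hz); apply: relR.
Qed.

Section Graph.
Variables (M N : grmod A) (f : grhom M N).

Definition graph_mem (x : M) (y : N) : Prop := y = f x.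
Lemma graph0 : graph_mem 0 0.
Proof. by rewrite /graph_mem linear0. Qed.
Lemma graphD x x' y y' :
  graph_mem x y -> graph_mem x' y' -> graph_mem (x + x') (y + y').
Proof. by rewrite /graph_mem linearD => -> ->. Qed.
Lemma graphR x y a : graph_mem x y -> graph_mem (x *r a) (y *r a).
Proof. by rewrite /graph_mem gfunR => ->. Qed.
Lemma graph_comp i x y : graph_mem x y -> graph_mem (comp i x) (comp i y).
Proof. by rewrite /graph_mem gfun_comp => ->. Qed.
Definition graph : grrel M N := GrRel graph0 graphD graphR graph_comp.
Lemma graph_dom : Fdim (grquotient (dom graph)).
Proof.
apply/Fdim_quoP => x; exists 0, (fun=> 0) => a; exists (fun=> 0).
by eexists.
Qed.
Lemma graph_ind : Fdim (grsubmod (ind graph)).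
Proof.
by apply/Fdim_subP => y; rewrite /= /ind_mem /= /graph_mem linear0 => ->; apply: tors0.
Qed.
Definition tails_graph : tails_hom M N := TailsHom graph_dom graph_ind.
End Graph.

Section Composition.
Variables (M N P : grmod A) (S : tails_hom N P) (R : tails_hom M N).

Definition rcomp_mem (x : M) (z : P) : Prop := exists y, R x y /\ S y z.
Lemma rcomp0 : rcomp_mem 0 0.
Proof. by exists 0; split; apply: rel0. Qed.
Lemma rcompD x x' z z' :
  rcomp_mem x z -> rcomp_mem x' z' -> rcomp_mem (x + x') (z + z').
Proof. by move=> [y [? ?]] [y' [? ?]]; exists (y + y'); split; apply: relD. Qed.
Lemma rcompR x z a : rcomp_mem x z -> rcomp_mem (x *r a) (z *r a).
Proof. by move=> [y [? ?]]; exists (y *r a); split; apply: relR. Qed.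
Lemma rcomp_comp i x z : rcomp_mem x z -> rcomp_mem (comp i x) (comp i z).
Proof. by move=> [y [? ?]]; exists (comp i y); split; apply: rel_comp. Qed.
Definition rcomp : grrel M P := GrRel rcomp0 rcompD rcompR rcomp_comp.
Lemma rcomp_dom : Fdim (grquotient (dom rcomp)).
Proof.
apply/Fdim_quoP => x.
apply: (cofiniteT_ext noeth (ideal_colon (dom R) x) (ideal_colon (dom rcomp) x)
  (th_dom_cofinite R x)) => a [y hy].
have := th_dom_cofinite S y; apply: cofinite_sub => b [z hz].
by exists z; exists (y *r b); split=> //; rewrite -ractA; apply: relR.
Qed.
Lemma rcomp_ind : Fdim (grsubmod (ind rcomp)).
Proof.
apply/Fdim_subP => z [y [hy hz]].
apply: (tors_ext (ideal_ann y) (th_ind_tors hy)) => a ya.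
apply: (@th_ind_tors _ _ S).
by have := relR a hz; rewrite ya.
Qed.
Definition tails_cmp : tails_hom M P := TailsHom rcomp_dom rcomp_ind.
End Composition.

Definition tails_id M : tails_hom M M := tails_graph (grhom_id M).

Lemma tails_cmp_eq M N P (S S' : tails_hom N P) (R R' : tails_hom M N) :
  tails_eq S S' -> tails_eq R R' -> tails_eq (tails_cmp S R) (tails_cmp S' R').
Proof.
move=> /tails_eqP SS /tails_eqP RR; apply/tails_eqP => x z z' [y [h1 h2]] [y' [h1' h2']].
apply: (tors_ext (ideal_ann (y - y'))); first exact: RR h1 h1'.
move=> a; rewrite ractBl => /eqP; rewrite subr_eq0 => /eqP ya.
have h2a : S (y *r a) (z *r a) by apply: relR.
rewrite ractBl; apply: SS h2a _.
by rewrite ya; apply: relR.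
Qed.

Lemma tails_cmpA M N P Q (T : tails_hom P Q) (S : tails_hom N P) (R : tails_hom M N) :
  tails_eq (tails_cmp T (tails_cmp S R)) (tails_cmp (tails_cmp T S) R).
Proof.
apply: tails_eq_sub => x t [z [[y [h1 h2]] h3]].
by exists y; split=> //; exists z.
Qed.

Lemma tails_idl M N (R : tails_hom M N) : tails_eq (tails_cmp (tails_id N) R) R.
Proof. by apply: tails_eq_sub => x z [y [h ->]]. Qed.

Lemma tails_idr M N (R : tails_hom M N) : tails_eq (tails_cmp R (tails_id M)) R.
Proof. by apply: tails_eq_sub => x z [y [-> h]]. Qed.

Definition Tails : category :=
  Category tails_eq_refl tails_eq_sym tails_eq_trans tails_cmp_eq
    tails_cmpA tails_idl tails_idr.

Lemma tails_pi_heq M N (f g : grhom M N) :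
  grhom_eq f g -> tails_eq (tails_graph f) (tails_graph g).
Proof. by move=> fg; apply: tails_eq_sub => x y ->; apply: fg. Qed.

Lemma tails_pi_cmp M N P (g : grhom N P) (f : grhom M N) :
  tails_eq (tails_graph (grhom_cmp g f)) (tails_cmp (tails_graph g) (tails_graph f)).
Proof. by apply: tails_eq_sub => x y ->; exists (f x). Qed.

Definition tails_pi : functor GrModules Tails :=
  @Functor GrModules Tails (fun M => M) (fun M N f => tails_graph f)
    tails_pi_heq (fun M => tails_eq_refl (tails_id M)) tails_pi_cmp.

Definition projective P : Prop :=
  forall M N (g : grhom M N) (f : grhom P N), (forall y, exists x, g x = y) ->
    exists h : grhom P M, grhom_eq (grhom_cmp g h) f.

Record projective_resolution Q := ProjectiveResolution {
  pr_ob : nat -> grmod A;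
  pr_projective : forall j, projective (pr_ob j);
  pr_d : forall j, grhom (pr_ob j.+1) (pr_ob j);
  pr_aug : grhom (pr_ob 0) Q;
  pr_aug_surj : forall y, exists x, pr_aug x = y;
  pr_exact0 : forall x, pr_aug x = 0 <-> exists y, pr_d 0 y = x;
  pr_exact : forall j x, pr_d j x = 0 <-> exists y, pr_d j.+1 y = x
}.

Definition cocycle Q (P : projective_resolution Q) j N (z : grhom (pr_ob P j) N) :
  Prop := forall x, z (pr_d P j x) = 0.

Definition coboundary Q (P : projective_resolution Q) j N :
    grhom (pr_ob P j) N -> Prop :=
  match j with
  | 0 => fun w => forall x, w x = 0
  | i.+1 => fun w => exists g : grhom (pr_ob P i) N, forall x, w x = g (pr_d P i x)
  end.

(* The direct sum over [n] of the spaces [Ext^j(Q, N(n)) = H^j(Hom(P, N(n)))] is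
   finite dimensional, that is, it is spanned by finitely many homogeneous elements,
   the class of the cocycle [s i] having degree [deg i].  The choice of the resolution
   [P] is irrelevant by the comparison theorem. *)
Definition graded_ext_finite_dim (Q : grmod A) (j : nat) (N : grmod A) : Prop :=
  exists (P : projective_resolution Q) (m : nat) (deg : 'I_m -> int)
         (s : forall i, grhom (pr_ob P j) (shift N (deg i))),
    (forall i, cocycle (s i)) /\
    forall n (z : grhom (pr_ob P j) (shift N n)), cocycle z ->
      exists (c : 'I_m -> k) (w : grhom (pr_ob P j) (shift N n)), coboundary w /\
        forall x, z x = \sum_(i | deg i == n) kact (c i) (s i x : N) + w x.

Definition chi1 : Prop :=
  forall N, finitely_generated N -> forall j, (j <= 1)%N ->
    graded_ext_finite_dim (grquotient (tail 1)) j N.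

End Graded.

Arguments locally_finite {k} A.
Arguments right_noetherian {k} A.
Arguments chi1 {k} A.
Arguments Tails {k A} noeth.
Arguments tails_pi {k A} noeth.

(* Main.v *)
(** The hypothesis on [M] says that [pi M] is a simple object of [Mod X];
    let [D] be its endomorphism ring, a division ring.  The closed point is the category
    of all direct sums of copies of [pi M].  It is closed under subquotients, has the
    largest semisimple [pi M]-isotypic subobject as coreflection, and is equivalent to
    the right [D]-modules through [Hom(pi M, -)].  The reflection of [X] has to be the
    quotient of [X] by the intersection [rad X] of the kernels of all maps to isotypic
    objects, and the point is that this quotient is again isotypic.  By [chi_1] the
    groups [Ext^1(A/A_{>= 1}, M(d))] vanish for large [d]; hence a map from [xA_{>= n}] to
    [M], with [x] homogeneous of large degree [d], is given by [x |-> m] for some [m] in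
    [M_d].  As [dim M_d] is finite, [xA], modulo [rad X], embeds into a finite direct sum
    of copies of [M].  Every object is generated in large degrees up to torsion, so this
    suffices. *)

From HB Require Import structures.
From Stdlib Require Import Setoid Morphisms.
Require Import Defs.
From mathcomp Require Import all_boot all_order all_algebra.
From mathcomp Require Import zify boolp functions classical_sets.

Set Implicit Arguments.
Unset Strict Implicit.
Unset Printing Implicit Defensive.

Import Defs GRing.Theory.
Local Open Scope ring_scope.

(** * Adjoints and equivalences *)

(** A morphism of [Tails] is a graded relation that is everywhere defined and single valued only up
    to torsion, so the argument composes relations and their converses instead of forming kernels,
    images and sums in the quotient category. The condition [up to torsion] is turned into a
    condition on all [a] of large degree, which is what [sat] and [satrel] express. Local finiteness
    makes [A / A_{>= n}] finite dimensional, and noetherianity makes saturation idempotent. No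
    object is ever decomposed into copies of [M]. Elements of isotypic objects are reached by finite
    lists of maps from [M], and proofs go by induction on such lists: by simplicity, the image of
    one more map either is independent of what is there or is already contained in it. Only the
    existence of bases over the endomorphism ring calls on Zorn's lemma. *)

#[local] Instance heq_equivalence (C : category) (x y : C) : Equivalence (@heq C x y).
Proof. by split; [exact: heq_refl|exact: heq_sym|exact: heq_trans]. Qed.

#[local] Instance cmp_proper (C : category) (x y z : C) :
  Proper (heq ==> heq ==> heq) (@cmp C x y z).
Proof. by move=> g g' gg f f' ff; apply: cmp_heq. Qed.

#[local] Instance fmap_proper (C D : category) (F : functor C D) (x y : C) :
  Proper (heq ==> heq) (@fmap C D F x y).
Proof. by move=> f f'; apply: fmap_heq. Qed.

Section Coreflection.
Variables (C : category) (P : C -> Prop).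
Hypothesis corefl : forall y : C, exists r (e : hom r y),
  [/\ P r, is_mono e & forall x, P x -> forall f : hom x y, exists g, e \oh g =h f].

Let core_ob (y : C) : C := projT1 (cid (corefl y)).
Let core_map y : hom (core_ob y) y := projT1 (cid (projT2 (cid (corefl y)))).
Let coreP y : [/\ P (core_ob y), is_mono (core_map y) &
  forall x, P x -> forall f : hom x y, exists g, core_map y \oh g =h f].
Proof. exact: projT2 (cid (projT2 (cid (corefl y)))). Qed.

Let core (y : C) : full_subcategory P :=
  exist P (core_ob y) (let: And3 h _ _ := coreP y in h).
Let core_mono y : is_mono (core_map y).
Proof. by case: (coreP y). Qed.
Let lift_ex (x : full_subcategory P) y (f : hom (sval x) y) :
  exists g, core_map y \oh g =h f.
Proof. by case: (coreP y) => _ _; apply; exact: svalP x. Qed.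
Let lift (x : full_subcategory P) y (f : hom (sval x) y) : hom x (core y) :=
  projT1 (cid (lift_ex f)).
Let liftK (x : full_subcategory P) y (f : hom (sval x) y) : core_map y \oh lift f =h f.
Proof. exact: projT2 (cid (lift_ex f)). Qed.

Let core_hom y y' (b : hom y y') : hom (core y) (core y') :=
  lift (x := core y) (b \oh core_map y).
Let core_homE y y' (b : hom y y') : core_map y' \oh core_hom b =h b \oh core_map y.
Proof. exact: liftK. Qed.

(** The arrow [e] is universal: as it is monic, factorizations through it are unique, and uniqueness
    gives functoriality and naturality. *)
Lemma coreflection_adjoint :
  exists R : functor C (full_subcategory P), adjoint (inclusion P) R.
Proof.
have core_heq y y' (b b' : hom y y') : b =h b' -> core_hom b =h core_hom b'.
  by move=> bb; apply: core_mono; rewrite !core_homE bb; exact: heq_refl.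
have core_id y : core_hom (idc y) =h idc (core y).
  by apply: core_mono; rewrite core_homE cmp_idl cmp_idr; exact: heq_refl.
have core_cmp y y' y'' (b' : hom y' y'') (b : hom y y') :
    core_hom (b' \oh b) =h core_hom b' \oh core_hom b.
  apply: core_mono; rewrite core_homE (cmpA (core_map y'')) core_homE.
  by rewrite -!cmpA core_homE; exact: heq_refl.
exists (Functor core_heq core_id core_cmp).
exists (fun x y f => lift f), (fun x y g => core_map y \oh g); split.
- by move=> x y f g fg; apply: core_mono; rewrite !liftK.
- by move=> x y f g fg; apply: (@cmp_heq C) fg; exact: heq_refl.
- by move=> x y f; exact: liftK.
- by move=> x y g; apply: core_mono; rewrite liftK; exact: heq_refl.
- move=> x x' y y' a b f /=; apply: core_mono; rewrite liftK.
  rewrite (cmpA (core_map y')) (cmpA (core_map y')) core_homE.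
  rewrite -(cmpA b (core_map y)) liftK.
  exact: heq_refl.
Qed.
End Coreflection.

Section Reflection.
Variables (C : category) (P : C -> Prop).
Hypothesis refl : forall y : C, exists r (e : hom y r),
  [/\ P r, is_epi e & forall x, P x -> forall f : hom y x, exists g, g \oh e =h f].

Let refl_ob (y : C) : C := projT1 (cid (refl y)).
Let refl_map y : hom y (refl_ob y) := projT1 (cid (projT2 (cid (refl y)))).
Let reflP y : [/\ P (refl_ob y), is_epi (refl_map y) &
  forall x, P x -> forall f : hom y x, exists g, g \oh refl_map y =h f].
Proof. exact: projT2 (cid (projT2 (cid (refl y)))). Qed.

Let rfl (y : C) : full_subcategory P :=
  exist P (refl_ob y) (let: And3 h _ _ := reflP y in h).
Let rfl_epi y : is_epi (refl_map y).
Proof. by case: (reflP y). Qed.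
Let desc_ex y (x : full_subcategory P) (f : hom y (sval x)) :
  exists g, g \oh refl_map y =h f.
Proof. by case: (reflP y) => _ _; apply; exact: svalP x. Qed.
Let desc y (x : full_subcategory P) (f : hom y (sval x)) :
    hom (refl_ob y) (sval x) :=
  projT1 (cid (desc_ex f)).
Let descK y (x : full_subcategory P) (f : hom y (sval x)) : desc f \oh refl_map y =h f.
Proof. exact: projT2 (cid (desc_ex f)). Qed.

Let rfl_hom y y' (b : hom y y') : hom (refl_ob y) (refl_ob y') :=
  desc (x := rfl y') (refl_map y' \oh b).
Let rfl_homE y y' (b : hom y y') : rfl_hom b \oh refl_map y =h refl_map y' \oh b.
Proof. exact: (descK (x := rfl y')). Qed.

Lemma reflection_adjoint :
  exists L : functor C (full_subcategory P), adjoint L (inclusion P).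
Proof.
have rfl_heq y y' (b b' : hom y y') : b =h b' -> rfl_hom b =h rfl_hom b'.
  by move=> bb; apply: rfl_epi; rewrite !rfl_homE bb; exact: heq_refl.
have rfl_id y : rfl_hom (idc y) =h idc (refl_ob y).
  by apply: rfl_epi; rewrite rfl_homE cmp_idl cmp_idr; exact: heq_refl.
have rfl_cmp y y' y'' (b' : hom y' y'') (b : hom y y') :
    rfl_hom (b' \oh b) =h rfl_hom b' \oh rfl_hom b.
  apply: rfl_epi; rewrite rfl_homE -(cmpA (rfl_hom b')) rfl_homE.
  by rewrite !cmpA rfl_homE; exact: heq_refl.
exists (@Functor C (full_subcategory P) rfl rfl_hom rfl_heq rfl_id rfl_cmp).
exists (fun x y (f : hom (refl_ob x) (sval y)) => f \oh refl_map x),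
  (fun x y (g : hom x (sval y)) => desc g); split.
- by move=> x y f g fg; apply: (@cmp_heq C) fg _; exact: heq_refl.
- by move=> x y f g fg; apply: rfl_epi; rewrite !descK.
- by move=> x y f; apply: rfl_epi; rewrite descK; exact: heq_refl.
- by move=> x y g; exact: descK.
- have nat x x' (y y' : C) (a : hom x' x) (b : hom y y') (f : hom (refl_ob x) y) :
      b \oh f \oh rfl_hom a \oh refl_map x' =h b \oh (f \oh refl_map x) \oh a.
    by rewrite -(cmpA (b \oh f)) rfl_homE !cmpA; exact: heq_refl.
  by move=> x x' y y' a b f; apply: nat.
Qed.
End Reflection.

Section Equivalence.
Variables (C D : category) (F : functor C D).
Hypotheses (F_full : forall (x y : C) (g : hom (F x) (F y)), exists f, fmap F f =h g)
  (F_faithful : forall (x y : C) (f g : hom x y), fmap F f =h fmap F g -> f =h g)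
  (F_surj : forall d : D, exists c, isomorphic (F c) d).

Let G_ob (d : D) : C := projT1 (cid (F_surj d)).
Let i d : hom (F (G_ob d)) d := projT1 (cid (projT2 (cid (F_surj d)))).
Let i_iso d : is_iso (i d).
Proof. exact: projT2 (cid (projT2 (cid (F_surj d)))). Qed.
Let j d : hom d (F (G_ob d)) := projT1 (cid (i_iso d)).
Let ji d : j d \oh i d =h idc _.
Proof. by case: (projT2 (cid (i_iso d))). Qed.
Let ij d : i d \oh j d =h idc _.
Proof. by case: (projT2 (cid (i_iso d))). Qed.
Let pre (x y : C) (g : hom (F x) (F y)) : hom x y := projT1 (cid (F_full g)).
Let preK (x y : C) (g : hom (F x) (F y)) : fmap F (pre g) =h g.
Proof. exact: projT2 (cid (F_full g)). Qed.

Lemma equivalent_of_full_faithful : equivalent C D.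
Proof.
pose G_hom d d' (g : hom d d') := pre (j d' \oh g \oh i d).
have G_heq d d' (g g' : hom d d') : g =h g' -> G_hom _ _ g =h G_hom _ _ g'.
  by move=> gg; apply: F_faithful; rewrite !preK gg; exact: heq_refl.
have G_id d : G_hom _ _ (idc d) =h idc (G_ob d).
  by apply: F_faithful; rewrite preK fmap_id cmp_idr ji; exact: heq_refl.
have G_cmp d d' d'' (g' : hom d' d'') (g : hom d d') :
    G_hom _ _ (g' \oh g) =h G_hom _ _ g' \oh G_hom _ _ g.
  apply: F_faithful; rewrite fmap_cmp !preK -(cmpA _ (i d')).
  rewrite (cmpA (i d')) (cmpA (i d')) ij cmp_idl !cmpA; exact: heq_refl.
exists F, (Functor G_heq G_id G_cmp); split.
  exists (fun c => pre (i (F c))); split=> [c|c c' f].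
    exists (pre (j (F c))); split; apply: F_faithful; rewrite fmap_cmp !preK fmap_id;
      [exact: ji|exact: ij].
  apply: F_faithful; rewrite !fmap_cmp !preK !cmpA ij cmp_idl; exact: heq_refl.
exists i; split=> [d|d d' g]; first exact: i_iso.
by rewrite /= preK !cmpA ij cmp_idl; exact: heq_refl.
Qed.
End Equivalence.

(** * Bases over a division ring *)

Section Basis.
Variables (R : nzRingType) (V : lmodType R).
Hypothesis divR : forall a : R, a != 0 -> exists b, b * a = 1.

Definition independent (S : set V) : Prop := forall (s : seq V) (f : V -> R), uniq s ->
  (forall v, v \in s -> S v) -> \sum_(v <- s) f v *: v = 0 -> forall v, v \in s -> f v = 0.

Lemma big_extend (I : eqType) (s t : seq I) (F : I -> V) : uniq s -> uniq t ->
  (forall i, i \in s -> i \in t) -> (forall i, i \notin s -> F i = 0) ->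
  \sum_(i <- s) F i = \sum_(i <- t) F i.
Proof.
move=> us ut st Fs; rewrite [RHS](bigID (mem s)) /= [X in _ + X]big1 ?addr0 => [|i /Fs //].
rewrite -[RHS]big_filter; apply: perm_big; apply: uniq_perm => //; first exact: filter_uniq.
by move=> i; rewrite mem_filter; case: (boolP (i \in s)) => // /st ->.
Qed.

Lemma maximal_independent : exists2 S : set V, independent S &
  forall v, exists (s : seq V) (f : V -> R),
    [/\ uniq s, forall w, w \in s -> S w & v = \sum_(w <- s) f w *: w].
Proof.
have [|S [indS maxS]] := @Zorn_bigcup V independent.
  (* A finite list in the union of a chain lies in one member. The alternative [s = [::]] covers the
     empty chain, which has no member to offer. *)
  move=> F FP Ftot s f us sF; suff [X FX sX] : exists2 X, (F X \/ s = [::]) &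
      forall v, v \in s -> X v.
    by case: FX => [FX|->] //; apply: FP FX _ _ us sX.
  elim: s us sF => [_ _|v s IH /= /andP[vs us] sF]; first by exists set0; [right|].
  have [X FX sX] := IH us (fun w ws => sF w (mem_behead (s := v :: s) ws)).
  have [Y FY Yv] := sF v (mem_head _ _).
  case: FX => [FX|s0]; last first.
    by exists Y; [left|move=> w; rewrite s0 inE => /eqP ->].
  have [XY|YX] := Ftot _ _ FX FY.
    exists Y; first by left.
    by move=> w; rewrite in_cons => /orP[/eqP->|/sX/XY].
  exists X; first by left.
  by move=> w; rewrite in_cons => /orP[/eqP->|/sX]; first exact: YX.
exists S => // v; apply: contrapT => nspan.
apply: (maxS (fun w => S w \/ w = v)).
  split; first by move=> w; left.
  move=> /(_ v (or_intror erefl)) Sv; apply: nspan; exists [:: v], (fun=> 1).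
  by split=> // [w|]; rewrite ?inE ?big_seq1 ?scale1r // => /eqP ->.
move=> s f us sS; have [vs|vs] := boolP (v \in s); last first.
  by apply: indS => // w ws; case: (sS w ws) => // wv; rewrite -wv ws in vs.
have remS w : w \in rem v s -> S w.
  by rewrite mem_rem_uniq // inE => /andP[/eqP wv /sS[]].
rewrite (big_rem v vs) /=; have [fv0|fv0] := eqVneq (f v) 0.
  rewrite fv0 scale0r add0r => /(indS _ f (rem_uniq _ us) remS) h w ws.
  by have [->//|wv] := eqVneq w v; apply: h; rewrite mem_rem_uniq // inE wv.
have [b ba] := divR fv0; move=> /(congr1 (fun w => b *: w)).
rewrite scalerDr scalerA ba scale1r scaler0 scaler_sumr => /eqP.
rewrite addr_eq0 => /eqP vE; case: nspan; exists (rem v s), (fun w => - (b * f w)).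
split=> //; first exact: rem_uniq.
by rewrite {1}vE -sumrN; apply: eq_bigr => w _; rewrite scaleNr scalerA.
Qed.

(** The basis is given through its coordinate functions because these are what is compared later
    with the projections of a direct sum of copies of [M] indexed by [B]. *)
Lemma basis_coordinates : exists (B : eqType) (e : B -> V) (c : V -> B -> R),
  [/\ forall v, exists2 s, uniq s & (forall b, b \notin s -> c v b = 0) /\
        v = \sum_(b <- s) c v b *: e b,
      forall a v w b, c (a *: v + w) b = a * c v b + c w b
    & forall s f b, uniq s -> c (\sum_(b <- s) f b *: e b) b = if b \in s then f b else 0].
Proof.
have [S indS spanS] := maximal_independent.
pose B := {v : V | `[< S v >]}; pose e (b : B) := val b.
have ind (s : seq B) (f : B -> R) : uniq s -> \sum_(b <- s) f b *: e b = 0 ->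
    forall b, b \in s -> f b = 0.
  move=> us s0 b bs; pose f' v := if insub v is Some b then f b else 0.
  have -> : f b = f' (val b) by rewrite /f' valK.
  apply: (indS (map val s)).
  - by rewrite map_inj_uniq //; apply: val_inj.
  - by move=> v /mapP[b' _ ->]; apply/asboolP; case: b'.
  - by rewrite big_map -[RHS]s0; apply: eq_bigr => b' _; rewrite /f' valK.
  - by apply: map_f.
have gen v : exists c : B -> R, exists2 s, uniq s & (forall b, b \notin s -> c b = 0) /\
    v = \sum_(b <- s) c b *: e b.
  have [s [f [us sS vE]]] := spanS v.
  have sE : s = map val (pmap insub s : seq B).
    rewrite (pmap_filter (insubK _)); apply/esym/all_filterP/allP => w ws.
    by rewrite /= isSome_insub; apply/asboolP/sS.
  have us' : uniq (pmap insub s : seq B) by rewrite -(map_inj_uniq val_inj) -sE.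
  exists (fun b => if b \in (pmap insub s : seq B) then f (val b) else 0).
  exists (pmap insub s) => //; split=> [b /negbTE -> //|].
  rewrite vE {1}sE big_map; apply: eq_big_seq => b ->; by [].
have /choice[c hc] := gen.
(* Coordinates are unique, by independence on the union of the two supports; the remaining
   properties follow by exhibiting coordinates. *)
have uniqc v s f : uniq s -> (forall b, b \notin s -> f b = 0) ->
    v = \sum_(b <- s) f b *: e b -> forall b, c v b = f b.
  move=> us fs vE b; have [t ut [ct vE']] := hc v.
  pose r := undup (s ++ t); have ur : uniq r by apply: undup_uniq.
  have : \sum_(b <- r) (c v b - f b) *: e b = 0.
    under eq_bigr do rewrite scalerBl; rewrite sumrB.
    rewrite -(@big_extend _ t r) //; last by move=> i /ct ->; rewrite scale0r.
      rewrite -(@big_extend _ s r) //; last by move=> i /fs ->; rewrite scale0r.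
        by rewrite -vE -vE' subrr.
      by move=> i; rewrite mem_undup mem_cat => ->.
    by move=> i; rewrite mem_undup mem_cat orbC => ->.
  move=> /(ind _ _ ur) h; have [br|] := boolP (b \in r).
    by apply/eqP; rewrite -subr_eq0; apply/eqP/h.
  by rewrite mem_undup mem_cat negb_or => /andP[/fs -> /ct ->].
exists B, e, c; split=> [v|a v w b|s f b us]; first exact: hc.
  have [s us [cs vE]] := hc v; have [t ut [ct wE]] := hc w.
  pose r := undup (s ++ t); have ur : uniq r by apply: undup_uniq.
  apply: (uniqc _ r (fun b => a * c v b + c w b)) => // [b'|].
    by rewrite mem_undup mem_cat negb_or => /andP[/cs -> /ct ->]; rewrite mulr0 addr0.
  under eq_bigr do rewrite scalerDl -scalerA; rewrite big_split /= -scaler_sumr.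
  rewrite -(@big_extend _ s r) //; last by move=> i /cs ->; rewrite scale0r.
    rewrite -(@big_extend _ t r) //; last by move=> i /ct ->; rewrite scale0r.
      by rewrite -vE -wE.
    by move=> i; rewrite mem_undup mem_cat orbC => ->.
  by move=> i; rewrite mem_undup mem_cat => ->.
apply: (uniqc _ s (fun b => if b \in s then f b else 0)) => // [b' /negbTE -> //|].
by apply: eq_big_seq => b' ->.
Qed.

End Basis.

(** * Saturation of graded submodules and relations *)

Section Saturation.
Variables (k : fieldType) (A : gralg k).
Hypotheses (noeth : right_noetherian A) (lf : locally_finite A).
Implicit Types (X Y Z : grmod A) (a b : A).

Lemma ractNl X (x : X) a : (- x) *r a = - (x *r a).
Proof. by rewrite /ract scalerN. Qed.

Lemma acomp_supp a : exists2 s : seq nat, uniq s &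
  (forall i, i \notin s -> acomp i a = 0) /\ a = \sum_(i <- s) acomp i a.
Proof.
have [s us as_] := acomp_sum a; exists s => //; split=> // i si.
rewrite as_ acomp_bigsum big1_seq // => j /andP[_ js].
by rewrite acomp_comp; case: eqP => // ij; rewrite ij js in si.
Qed.

Definition tailA n a := tail_mem n (a : regular A).

Lemma tailA_homog n l a : (n <= l)%N -> acomp l a = a -> tailA n a.
Proof.
move=> nl la i im; rewrite -[X in acomp i X]la acomp_comp; case: eqP => // il; lia.
Qed.

Lemma tailA_le n n' a : (n <= n')%N -> tailA n' a -> tailA n a.
Proof. by move=> nn h i im; apply: h; lia. Qed.

Lemma tailA0 a : tailA 0 a.
Proof. by []. Qed.

(** Reduces a claim about [A_{>= n}] to homogeneous elements, whose action shifts components by a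
    known degree. *)
Lemma tailA_ind n (Q : A -> Prop) : Q 0 -> (forall a b, Q a -> Q b -> Q (a + b)) ->
  (forall l a, (n <= l)%N -> acomp l a = a -> Q a) -> forall a, tailA n a -> Q a.
Proof.
move=> Q0 QD Qh a ta; have [s _ [_ ->]] := acomp_supp a.
elim: s => [|l s IH]; first by rewrite big_nil.
rewrite big_cons; apply: QD IH.
have [nl|ln] := leqP n l; first by apply: (Qh l) => //; apply: acomp_id.
by rewrite ta.
Qed.

Lemma tailA_mulr n a b : tailA n a -> tailA n (a * b).
Proof. exact: (@tail_memR _ _ n (a : regular A) b). Qed.

Lemma tailAD n a b : tailA n a -> tailA n b -> tailA n (a + b).
Proof. exact: (@tail_memD _ _ n (a : regular A) b). Qed.

Lemma tailA_0 n : tailA n 0.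
Proof. exact: (@tail_mem0 _ A n). Qed.

Lemma tailA_mul n m a b : tailA n a -> tailA m b -> tailA (n + m) (a * b).
Proof.
move=> ta; move: a ta; apply: tailA_ind => [tb|a a' h h' tb|l a nl ha].
- by rewrite mul0r; apply: tailA_0.
- by rewrite mulrDl; apply: tailAD; [apply: h|apply: h'].
move: b; apply: tailA_ind => [|b b' h h'|l' b ml hb].
- by rewrite mulr0; apply: tailA_0.
- by rewrite mulrDr; apply: tailAD.
by apply: (@tailA_homog _ (l + l')); [lia|apply: acompM].
Qed.

Lemma tailA_mull n a b : tailA n b -> tailA n (a * b).
Proof. by move/(tailA_mul (tailA0 a)). Qed.

Lemma tailA_cofinite n : cofinite (tailA n).
Proof.
have /choice[t ht] : forall i : 'I_n, exists t : {m : nat & 'I_m -> A},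
    forall a, acomp i a = a -> exists c : 'I_(tag t) -> k, a = \sum_j c j *: tagged t j.
  by move=> i; have [m [s [_ hs]]] := lf i; exists (Tagged (fun m => 'I_m -> A) s).
pose T := {i : 'I_n & 'I_(tag (t i))}.
apply: (@cofiniteT k A T _ (fun p => tagged (t (tag p)) (tagged p))) => a.
have /choice[c hc] : forall i : 'I_n, exists c : nat -> k,
    acomp i a = \sum_(j < tag (t i)) c j *: tagged (t i) j.
  move=> i; have [|c hc] := ht i (acomp i a); first exact: acomp_id.
  (* Extending by 0 to all of [nat] avoids a choice of functions whose domain depends on [i]. *)
  exists (fun j => if insub j is Some j then c j else 0); rewrite hc.
  by apply: eq_bigr => j _; rewrite valK.
exists (fun p : T => c (tag p) (nat_of_ord (tagged p))).
have -> : \sum_(p : T) c (tag p) (nat_of_ord (tagged p)) *: tagged (t (tag p)) (tagged p)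
    = \sum_(i < n) \sum_j c i (nat_of_ord j) *: tagged (t i) j.
  exact/esym/(sig_big_dep (fun=> true) (fun _ _ => true)
     (fun i (j : 'I_(tag (t i))) => c i (nat_of_ord j) *: tagged (t i) j)).
rewrite (eq_bigr (fun i : 'I_n => acomp i a)); last by move=> i _; rewrite -hc.
move=> i li; rewrite acompB acomp_bigsum (bigD1 (Ordinal li)) //= acomp_id big1 ?addr0 ?subrr //.
move=> j /eqP ji; rewrite acomp_comp; case: eqP => // ij.
by case: ji; apply: val_inj.
Qed.

Definition mkgrsub X (Q : X -> Prop) (Q0 : Q 0) (QD : forall x y, Q x -> Q y -> Q (x + y))
  (QR : forall x a, Q x -> Q (x *r a)) (QC : forall i x, Q x -> Q (comp i x)) : grsub X :=
  @GrSub k A X (@Submodule _ X Q Q0 QD (fun a x => QR x a)) QC.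

(* [N] is recovered up to torsion: [sat N / N] is the torsion of [X / N] *)
Definition sat X (N : X -> Prop) (x : X) : Prop :=
  exists n, forall a, tailA n a -> N (x *r a).

Lemma sat_sub X (N N' : X -> Prop) x : (forall y, N y -> N' y) -> sat N x -> sat N' x.
Proof. by move=> NN [n h]; exists n => a /h/NN. Qed.

Lemma satI X (N N' : X -> Prop) x : sat N x -> sat N' x -> sat (fun y => N y /\ N' y) x.
Proof.
move=> [n h] [n' h']; exists (maxn n n') => a ta.
by split; [apply: h|apply: h']; apply: tailA_le ta; lia.
Qed.

Lemma satR X (N : X -> Prop) x b : sat N x -> sat N (x *r b).
Proof. by move=> [n h]; exists n => a ta; rewrite ractA; apply: h; apply: tailA_mull. Qed.

(** For [a] homogeneous of degree [l], [comp i x *r a] is the component of degree [i + l] of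
    [x *r a], and [R] is closed under components. *)
Lemma sat_rel_comp X Y (R : grrel X Y) n x y i :
  (forall a, tailA n a -> R (x *r a) (y *r a)) ->
  forall a, tailA n a -> R (comp i x *r a) (comp i y *r a).
Proof.
move=> h; apply: tailA_ind => [|a b ha hb|l a nl ha].
- by rewrite !ract0r; apply: rel0.
- by rewrite !ractDr; apply: relD.
rewrite -[i](addrK l%:Z) -!comp_ract_homog //; apply: rel_comp; apply: h.
exact: tailA_homog ha.
Qed.

Lemma sat_comp X (N : grsub X) i x : sat N x -> sat N (comp i x).
Proof.
move=> [n h]; exists n; apply: tailA_ind => [|a b ha hb|l a nl ha].
- by rewrite ract0r; apply: smem0.
- by rewrite ractDr; apply: smemD.
rewrite -[i](addrK l%:Z) -comp_ract_homog //; apply: gsub_comp; apply: h.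
exact: tailA_homog ha.
Qed.

Lemma sat0 X (N : grsub X) : sat N 0.
Proof. by exists 0 => a _; rewrite ract0l; apply: smem0. Qed.

Lemma satD X (N : grsub X) x y : sat N x -> sat N y -> sat N (x + y).
Proof.
move=> [n h] [n' h']; exists (maxn n n') => a ta; rewrite ractDl.
by apply: smemD; [apply: h|apply: h']; apply: tailA_le ta; lia.
Qed.

Definition satsub X (N : grsub X) : grsub X :=
  mkgrsub (sat0 N) (@satD X N) (fun x a => @satR X N x a) (fun i x => @sat_comp X N i x).

Lemma sat_self X (N : grsub X) x : N x -> sat N x.
Proof. by exists 0 => a _; apply: smem_ract. Qed.

Lemma seqint_bound (s : seq int) : exists b : nat, forall i, i \in s -> `|i| <= b%:Z.
Proof.
elim: s => [|i s [b hb]]; first by exists 0.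
exists (`|i|%N + b)%N => j; rewrite in_cons => /orP[/eqP->|/hb]; lia.
Qed.

(** The saturation of the graph [f] inside the direct sum of [X] and [Y]. *)
Definition satrel X Y (f : grrel X Y) x y := exists n, forall a, tailA n a ->
  f (x *r a) (y *r a).

Lemma satrelR X Y (f : grrel X Y) x y a : satrel f x y -> satrel f (x *r a) (y *r a).
Proof. by move=> [n h]; exists n => b tb; rewrite !ractA; apply: h; apply: tailA_mull. Qed.

Lemma satrelD X Y (f : grrel X Y) x y x' y' :
  satrel f x y -> satrel f x' y' -> satrel f (x + x') (y + y').
Proof.
move=> [n h] [n' h']; exists (maxn n n') => a ta; rewrite !ractDl.
by apply: relD; [apply: h|apply: h']; apply: tailA_le ta; lia.
Qed.

Lemma satrel_comp X Y (f : grrel X Y) i x y :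
  satrel f x y -> satrel f (comp i x) (comp i y).
Proof. by move=> [n h]; exists n; apply: sat_rel_comp. Qed.

Lemma satrel_self X Y (f : grrel X Y) x y : f x y -> satrel f x y.
Proof. by exists 0 => a _; apply: relR. Qed.

(** For [a] homogeneous of large degree, [x *r a] and [y *r a] have no component in degrees near 0.
    Modulo [R] the pair is a combination of the finitely many pairs [(x *r s i, y *r s i)], whose
    components all lie in degrees near 0. Hence each component of the pair is zero or in [R]. *)
Lemma satrel_cofinite X Y (R : grrel X Y) x y :
  cofinite (fun a => R (x *r a) (y *r a)) <-> satrel R x y.
Proof.
split; last by case=> n h; apply: cofinite_sub h (tailA_cofinite n).
case=> m [s hs]; have bound Z (z : Z) : exists b : nat, forall t : int, b%:Z < `|t| ->
    comp t z = 0 /\ forall i, comp t (z *r s i) = 0.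
  have /choice[sp hsp] : forall i : 'I_m, exists b : nat, forall t : int,
      b%:Z < `|t| -> comp t (z *r s i) = 0.
    move=> i; have [q _ hq] := comp_supp (z *r s i); have [b hb] := seqint_bound q.
    by exists b => t bt; apply: hq; apply/negP => /hb; lia.
  have [q _ hq] := comp_supp z; have [b hb] := seqint_bound q.
  exists ((\max_i sp i) + b)%N => t Bt; split; first by apply: hq; apply/negP => /hb; lia.
  by move=> i; apply: hsp; have := leq_bigmax (F := sp) i; lia.
have [bx hbx] := bound X x; have [b' hb'] := bound Y y; pose B := maxn bx b'.
(* If [|t| <= B] and [l > 2B] then [t - l < - B], so the components of [x] and [y] in degree [t - l]
   vanish. *)
exists (B + B).+1; apply: tailA_ind => [|a a' ha ha'|l a nl ha].
- by rewrite !ract0r; apply: rel0.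
- by rewrite !ractDr; apply: relD.
have [c hc] := hs a.
have [p _ hp] := comp_supp (x *r a); have [q _ hq] := comp_supp (y *r a).
have ur : uniq (undup (p ++ q)) by apply: undup_uniq.
have ex : x *r a = \sum_(i <- undup (p ++ q)) comp i (x *r a).
  by apply: comp_sum_on => // i; rewrite mem_undup mem_cat negb_or => /andP[/hp].
have ey : y *r a = \sum_(i <- undup (p ++ q)) comp i (y *r a).
  by apply: comp_sum_on => // i; rewrite mem_undup mem_cat negb_or => /andP[_ /hq].
rewrite ex ey; elim: (undup _) => [|t r IH]; first by rewrite !big_nil; apply: rel0.
rewrite !big_cons; apply: relD IH.
case: (boolP (B%:Z < `|t|)) => [Bt|tB]; last first.
  rewrite !(comp_ract_homog _ _ ha) (hbx _ _).1 ?(hb' _ _).1 ?ract0l; [exact: rel0|lia|lia].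
have := rel_comp t hc; rewrite !ractBr !compB !ract_sumr !comp_bigsum.
rewrite !big1 ?subr0 // => i _; rewrite kactZ comp_kact.
  by rewrite (hb' t _).2 ?kact0 //; lia.
by rewrite (hbx t _).2 ?kact0 //; lia.
Qed.

Definition satgr X Y (R : grrel X Y) : grrel X Y :=
  @GrRel k A X Y (satrel R) (satrel_self (rel0 R))
    (fun x x' y y' h h' => satrelD h h') (fun x y a h => satrelR a h)
    (fun i x y h => satrel_comp i h).

(** The right ideal that carries [(x, y)] into [satgr R] is finitely generated, so finite
    codimension passes from it to the ideal for [R]. *)
Lemma satrel_idem X Y (R : grrel X Y) x y : satrel (satgr R) x y -> satrel R x y.
Proof.
have ideal (S : grrel X Y) : right_ideal (fun a => S (x *r a) (y *r a)).
  split; first by rewrite !ract0r; apply: rel0.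
  - by move=> a b Sa Sb; rewrite !ractDr; apply: relD.
  - by move=> a b Sa; rewrite -!ractA; apply: relR.
move=> /satrel_cofinite Rxy; apply/satrel_cofinite.
apply: (cofiniteT_ext noeth (ideal (satgr R)) (ideal R) Rxy) => a /satrel_cofinite.
by apply: cofinite_sub => b; rewrite !ractA.
Qed.

Lemma sat_cofinite X (N : grsub X) x : cofinite (fun a => N (x *r a)) <-> sat N x.
Proof.
(* A relation that ignores its second coordinate. *)
pose R := @GrRel k A X X (fun x _ => N x) (smem0 N) (fun _ _ _ _ h h' => smemD h h')
  (fun _ _ a h => smem_ract a h) (fun i _ _ h => gsub_comp i h).
exact: (satrel_cofinite R x 0).
Qed.

Lemma colon_ideal X (N : grsub X) x : right_ideal (fun a => N (x *r a)).
Proof. exact: (ideal_colon (N : submodule X)). Qed.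

Lemma sat_sat X (N : grsub X) x : sat (sat N) x -> sat N x.
Proof.
move/(sat_cofinite (satsub N) x).2 => h; apply/sat_cofinite.
apply: (cofiniteT_ext noeth (colon_ideal (satsub N) x) (colon_ideal N x) h) => a.
by move/sat_cofinite; apply: cofinite_sub => b; rewrite ractA.
Qed.

Lemma sat_trans X (N N' : grsub X) x :
  (forall y, N y -> sat N' y) -> sat N x -> sat N' x.
Proof. by move=> h /(sat_sub h)/sat_sat. Qed.

Lemma torsP X (x : X) : tors x <-> exists n, forall a, tailA n a -> x *r a = 0.
Proof.
pose O : grsub X := mkgrsub (erefl (0 : X))
  (fun x y (hx : x = 0) (hy : y = 0) => etrans (congr2 +%R hx hy) (addr0 0))
  (fun x a (hx : x = 0) => etrans (congr1 (fun x => x *r a) hx) (ract0l X a))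
  (fun i x (hx : x = 0) => etrans (congr1 (comp i) hx) (comp0 X i)).
exact: (sat_cofinite O x).
Qed.

Lemma tors_comp X i (x : X) : tors x -> tors (comp i x).
Proof.
move/torsP => [n h]; apply/torsP; exists n; apply: tailA_ind => [|a b ha hb|l a nl ha].
- by rewrite ract0r.
- by rewrite ractDr ha hb addr0.
rewrite -[i](addrK l%:Z) -comp_ract_homog // h ?comp0 //; exact: tailA_homog ha.
Qed.

Definition torsub X : grsub X :=
  mkgrsub (tors0 X) (@torsD k A noeth X) (fun x a => @torsR k A X x a) (@tors_comp X).

Lemma sat_tors X (x : X) : sat (@tors k A X) x -> tors x.
Proof.
move=> h; apply: (tors_ext noeth (colon_ideal (torsub X) x)) => //.
exact/(sat_cofinite (torsub X) x).
Qed.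

Lemma sat_dom X Y (R : tails_hom X Y) x : sat (dom R) x.
Proof. exact/sat_cofinite/th_dom_cofinite. Qed.

Definition mktails X Y (R : grrel X Y) (hd : forall x, sat (dom R) x)
  (hi : forall y, R 0 y -> tors y) : tails_hom X Y :=
  @TailsHom k A X Y R ((Fdim_quoP (dom R)).2 (fun x => (sat_cofinite (dom R) x).2 (hd x)))
    ((Fdim_subP (ind R)).2 hi).

Lemma rel_tors X Y (R : grrel X Y) x y :
  (forall y, R 0 y -> tors y) -> R x y -> tors x -> tors y.
Proof.
move=> hi Rxy /torsP[n h]; apply: sat_tors; exists n => a ta.
by apply: hi; rewrite -(h a ta); apply: relR.
Qed.

Lemma th_tors X Y (R : tails_hom X Y) x y : R x y -> tors x -> tors y.
Proof. by apply: rel_tors => z; apply: th_ind_tors. Qed.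

Lemma torsB X (x y : X) : tors x -> tors y -> tors (x - y).
Proof. by move=> tx ty; apply: torsD => //; apply: torsN. Qed.

Lemma quo_tors X (N : grsub X) x : tors (quo N x : grquotient N) <-> sat N x.
Proof.
have E a : (quo N x : grquotient N) *r a = 0 <-> N (x *r a).
  by rewrite -quo_ract -(quo0 N) quo_eq subr0.
by rewrite torsP; split=> -[n h]; exists n => a /h /E.
Qed.


Definition preim_mem X Y (R : grrel X Y) (N : grsub Y) (m : X) : Prop :=
  exists x : Y, R m x /\ N x.

Lemma preim_mem0 X Y (R : grrel X Y) (N : grsub Y) : preim_mem R N 0.
Proof. by exists 0; split; [apply: rel0|apply: smem0]. Qed.
Lemma preim_memD X Y (R : grrel X Y) (N : grsub Y) m m' :
  preim_mem R N m -> preim_mem R N m' -> preim_mem R N (m + m').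
Proof.
by move=> [x [h n]] [x' [h' n']]; exists (x + x'); split; [apply: relD|apply: smemD].
Qed.
Lemma preim_memR X Y (R : grrel X Y) (N : grsub Y) m a :
  preim_mem R N m -> preim_mem R N (m *r a).
Proof. by move=> [x [h n]]; exists (x *r a); split; [apply: relR|apply: smem_ract]. Qed.
Lemma preim_comp X Y (R : grrel X Y) (N : grsub Y) i m :
  preim_mem R N m -> preim_mem R N (comp i m).
Proof.
by move=> [x [h n]]; exists (comp i x); split; [apply: rel_comp|apply: gsub_comp].
Qed.
Definition preim X Y (R : grrel X Y) (N : grsub Y) : grsub X :=
  mkgrsub (preim_mem0 R N) (@preim_memD X Y R N) (@preim_memR X Y R N) (@preim_comp X Y R N).

(** In general not a morphism, even if [R] is one: it serves to run a morphism backwards and to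
    express its image as a domain. *)
Definition relconv X Y (R : grrel X Y) : grrel Y X :=
  @GrRel k A Y X (fun y x => R x y) (rel0 R) (fun _ _ _ _ h h' => relD h h')
    (fun _ _ a h => relR a h) (fun i _ _ h => rel_comp i h).

Definition relcomp X Y Z (S : grrel Y Z) (R : grrel X Y) : grrel X Z.
Proof.
apply: (@GrRel k A X Z (fun x z => exists y, R x y /\ S y z)).
- by exists 0; split; apply: rel0.
- by move=> x x' z z' [y [? ?]] [y' [? ?]]; exists (y + y'); split; apply: relD.
- by move=> x z a [y [? ?]]; exists (y *r a); split; apply: relR.
- by move=> i x z [y [? ?]]; exists (comp i y); split; apply: rel_comp.
Defined.

Definition zerorel X Y : grrel X Y := graph (grzero X Y).

Definition restr X Y (R : grrel X Y) (N : grsub X) : grrel X Y.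
Proof.
apply: (@GrRel k A X Y (fun x y => R x y /\ N x)).
- by split; [apply: rel0|apply: smem0].
- by move=> x x' y y' [? ?] [? ?]; split; [apply: relD|apply: smemD].
- by move=> x y a [? ?]; split; [apply: relR|apply: smem_ract].
- by move=> i x y [? ?]; split; [apply: rel_comp|apply: gsub_comp].
Defined.

(** * Isotypic objects *)

Section SimpleObject.
Variable M : grmod A.
Hypotheses (Mtf : forall m : M, tors m -> m = 0) (Mne : exists m : M, m <> 0)
  (Msimple : forall N : grsub M, (exists x, N x /\ x <> 0) -> forall x, sat N x).

(** The preimage of [N] in [M] is zero or, by simplicity, has saturation [M]. Torsion is required in
    [N] because the values of [u] are determined only up to torsion. *)
Lemma dichotomy X (u : tails_hom M X) (N : grsub X) : (forall x, tors x -> N x) ->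
  (forall m x, u m x -> N x -> m = 0) \/ (forall m x, u m x -> sat N x).
Proof.
move=> NT; have [h|/existsNP[m /not_implyP[[x [ux Nx]] m0]]] :=
  pselect (forall m, preim u N m -> m = 0); [left|right].
  by move=> m x ux Nx; apply: h; exists x.
move=> m' x' ux'.
have [n h] : sat (preim u N) m' by apply: Msimple; exists m; split=> //; exists x.
exists n => a /h [y [uy Ny]]; rewrite -(subrK y (x' *r a)); apply: smemD Ny.
by apply: NT; apply: (th_ind_tors (R := u)); apply: rel_ind uy; apply: relR.
Qed.

(** Torsion is put in so that [dichotomy] applies to the span. *)
Fixpoint span X (us : seq (tails_hom M X)) (x : X) : Prop :=
  if us is u :: us' then exists m y z, [/\ u m y, span us' z & x = y + z] else tors x.

Lemma span_tors X (us : seq (tails_hom M X)) x : tors x -> span us x.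
Proof.
elim: us => //= u us IH tx; exists 0, 0, x; rewrite add0r.
by split=> //; [apply: rel0|apply: IH].
Qed.
Lemma spanD X (us : seq (tails_hom M X)) x x' : span us x -> span us x' -> span us (x + x').
Proof.
elim: us x x' => /= [|u us IH] x x'; first exact: torsD.
move=> [m [y [z [h1 h2 ->]]]] [m' [y' [z' [h1' h2' ->]]]].
by exists (m + m'), (y + y'), (z + z'); rewrite addrACA; split=> //; [apply: relD|apply: IH].
Qed.
Lemma spanR X (us : seq (tails_hom M X)) x a : span us x -> span us (x *r a).
Proof.
elim: us x => /= [|u us IH] x; first exact: torsR.
move=> [m [y [z [h1 h2 ->]]]]; exists (m *r a), (y *r a), (z *r a).
by rewrite ractDl; split=> //; [apply: relR|apply: IH].
Qed.
Lemma span_comp X (us : seq (tails_hom M X)) i x : span us x -> span us (comp i x).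
Proof.
elim: us x => /= [|u us IH] x; first exact: tors_comp.
move=> [m [y [z [h1 h2 ->]]]]; exists (comp i m), (comp i y), (comp i z).
by rewrite compD; split=> //; [apply: rel_comp|apply: IH].
Qed.
Definition spansub X (us : seq (tails_hom M X)) : grsub X :=
  mkgrsub (span_tors us (tors0 X)) (@spanD X us) (@spanR X us) (@span_comp X us).

Lemma span_in X (us : seq (tails_hom M X)) u m x : List.In u us -> u m x -> span us x.
Proof.
elim: us => //= v us IH [->|uus] ux.
  by exists m, x, 0; rewrite addr0; split=> //; apply/span_tors/tors0.
exists 0, 0, x; rewrite add0r; split=> //; [exact: rel0|exact: IH].
Qed.

Lemma span_sub X (us : seq (tails_hom M X)) (N : grsub X) :
  (forall x, tors x -> N x) -> (forall u m x, List.In u us -> u m x -> sat N x) ->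
  forall x, span us x -> sat N x.
Proof.
move=> NT; elim: us => [|u us IH] h x /=; first by move/NT/sat_self.
move=> [m [y [z [uy sz ->]]]]; apply: satD; first by apply: h uy; left.
by apply: IH sz => v m' x' vus; apply: h; right.
Qed.

Lemma span_cat X (us vs : seq (tails_hom M X)) x y :
  span us x -> span vs y -> span (us ++ vs) (x + y).
Proof.
elim: us x => /= [|u us IH] x; first by move=> /(span_tors vs); apply: spanD.
move=> [m [z [t [uz st ->]]]] sy; exists m, z, (t + y).
by rewrite addrA; split=> //; apply: IH.
Qed.

(* the largest subobject of [X] that is a sum of images of [M] *)
Definition soc X : grsub X.
Proof.
refine (@mkgrsub X (fun x => exists us : seq (tails_hom M X), span us x) _ _ _ _).
- by exists [::]; apply: tors0.
- by move=> x y [us sx] [vs sy]; exists (us ++ vs); apply: span_cat.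
- by move=> x a [us sx]; exists us; apply: spanR.
- by move=> i x [us sx]; exists us; apply: span_comp.
Defined.

Lemma soc_tors X (x : X) : tors x -> soc X x.
Proof. by exists [::]. Qed.

Lemma soc_image X (u : tails_hom M X) m x : u m x -> soc X x.
Proof. by move=> ux; exists [:: u]; apply: span_in ux; left. Qed.

(* In the quotient category, [X] is a direct sum of copies of [M]. *)
Definition isotypic X : Prop := forall x : X, sat (soc X) x.

Section AddRel.
Variables (X Y : grmod A) (p : grrel X Y) (u : grrel M X) (v : grrel M Y).
(* extends [p] by sending [u m] to [v m] *)
Definition addrel_mem (x : X) (y : Y) : Prop :=
  exists m w w' z z', [/\ u m w, v m w', p z z', x = w + z & y = w' + z'].
Definition addrel : grrel X Y.
Proof.
apply: (@GrRel k A X Y addrel_mem).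
- by exists 0, 0, 0, 0, 0; rewrite !addr0; split=> //; apply: rel0.
- move=> x x' y y' [m [w [w' [z [z' [h1 h2 h3 -> ->]]]]]].
  move=> [m2 [w2 [w2' [z2 [z2' [h4 h5 h6 -> ->]]]]]].
  exists (m + m2), (w + w2), (w' + w2'), (z + z2), (z' + z2').
  by rewrite (addrACA w z) (addrACA w' z'); split=> //; apply: relD.
- move=> x y a [m [w [w' [z [z' [h1 h2 h3 -> ->]]]]]].
  exists (m *r a), (w *r a), (w' *r a), (z *r a), (z' *r a).
  by rewrite !ractDl; split=> //; apply: relR.
- move=> i x y [m [w [w' [z [z' [h1 h2 h3 -> ->]]]]]].
  exists (comp i m), (comp i w), (comp i w'), (comp i z), (comp i z').
  by rewrite !compD; split=> //; apply: rel_comp.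
Defined.
End AddRel.

Definition zerohom X Y : tails_hom X Y := tails_graph (grzero X Y).

(** For [a] of large degree [w *r a = - (x *r a)] lies in [N], so [m *r a = 0]; thus [m] is torsion,
    and [M] is torsion free. *)
Lemma disjoint_sum X (u : tails_hom M X) (N : grsub X) m w x :
  (forall m x, u m x -> N x -> m = 0) -> u m w -> N x -> tors (w + x) ->
  [/\ m = 0, tors w & tors x].
Proof.
move=> disj uw Nx twx; have m0 : m = 0.
  have /torsP[n h] := twx; apply/Mtf/torsP; exists n => a ta.
  apply: (disj _ (w *r a)); first exact: relR.
  by have := h a ta; rewrite ractDl addrC => /addr0_eq <-; apply/smemN/smem_ract.
have tw : tors w by apply: th_tors uw _; rewrite m0; apply: tors0.
by split=> //; rewrite -(addKr w x) addrC; apply: torsB.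
Qed.

(* By induction on [us]: either [u(M)] is already in the domain of the retraction [p]
   onto [I], or it meets this domain trivially, and then [p] is extended by [0]. *)
Lemma partial_retraction X (I : grsub X) (us : seq (tails_hom M X)) :
  exists p : grrel X X,
    [/\ forall x, tors x -> p x 0, forall x y, p x y -> tors x -> tors y,
        forall x y, p x y -> I y, forall x, I x -> p x x
      & forall u m x, List.In u us -> u m x -> sat (dom p) x].
Proof.
elim: us => [|u us [p [p1 p2 p3 p4 p5]]].
  (* Without maps, the retraction is the identity of [I] up to torsion. *)
  have q0 : I 0 /\ tors (0 - 0 : X) by rewrite subr0; split; [apply: smem0|apply: tors0].
  pose q := @GrRel k A X X (fun x y => I y /\ tors (x - y)) q0.
  have qD (x x' y y' : X) : I y /\ tors (x - y) -> I y' /\ tors (x' - y') ->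
      I (y + y') /\ tors (x + x' - (y + y')).
    move=> [? ?] [? ?]; rewrite opprD addrACA; split; [exact: smemD|exact: torsD].
  have qR (x y : X) a : I y /\ tors (x - y) -> I (y *r a) /\ tors (x *r a - y *r a).
    by move=> [? ?]; rewrite -ractBl; split; [apply: smem_ract|apply: torsR].
  have qC i (x y : X) : I y /\ tors (x - y) -> I (comp i y) /\ tors (comp i x - comp i y).
    by move=> [? ?]; rewrite -compB; split; [apply: gsub_comp|apply: tors_comp].
  exists (q qD qR qC); split=> //=.
  - by move=> x tx; rewrite subr0; split=> //; apply: smem0.
  - by move=> x y [_ txy] tx; rewrite -(subKr x y); apply: torsB.
  - by move=> x y [].
  - by move=> x Ix; rewrite subrr; split=> //; apply: tors0.
have [|disj|sub] := dichotomy u (N := dom p); first by move=> x /p1; exists 0.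
  exists (addrel p u (zerorel M X)).
  have p_sub x y : p x y -> addrel p u (zerorel M X) x y.
    move=> pxy; exists 0, 0, 0, x, y; rewrite !add0r; split=> //; exact: rel0.
  split.
  - by move=> x /p1/p_sub.
  - move=> x y [m [w [w' [z [z' [uw /= -> pz -> ->]]]]]] twz; rewrite add0r.
    have dz : dom p z by exists z'.
    by have [_ _ tz] := disjoint_sum disj uw dz twz; apply: p2 pz tz.
  - by move=> x y [m [w [w' [z [z' [uw /= -> /p3 + _ ->]]]]]]; rewrite add0r.
  - by move=> x /p4/p_sub.
  - move=> v m x [<- ux|vus vx].
      apply: sat_self; exists 0, m, x, 0, 0, 0; rewrite !addr0; split=> //; exact: rel0.
    by apply: sat_sub (p5 v m x vus vx) => y [z /p_sub]; exists z.
exists p; split=> // v m x [<- ux|]; [exact: sub ux|exact: p5].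
Qed.

(* [R] exhibits [dom R] as a quotient of a subobject of [Z]. *)
Lemma isotypic_subquotient Y Z (R : grrel Y Z) :
  (forall y z, R y z -> tors z -> tors y) -> isotypic Z ->
  forall y z, R y z -> sat (soc Y) y.
Proof.
move=> Rtors isoZ y z Ryz; have [n hn] := isoZ z.
apply: sat_sat; exists n => a /hn [us sus].
have [p [p1 p2 p3 p4 p5]] := partial_retraction (dom (relconv R)) us.
(* The relation [p] retracts onto the image of [R]. Followed by the converse of [R], it turns each
   [u] in [us] into a map from [M] to [Y], single valued up to torsion by [Rtors]. *)
pose q : grrel Z Y := relcomp (relconv R) p.
have q_tors x y' : q x y' -> tors x -> tors y'.
  by move=> [z' [pxz Ry] tx]; apply: Rtors Ry _; apply: p2 pxz tx.
have p_dom x : dom p x -> dom q x.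
  by move=> [z' pxz]; have [y' Ry'] := p3 _ _ pxz; exists y', z'.
have : sat (preim q (soc Y)) (z *r a).
  apply: span_sub sus => [x tx|u m w uus umw].
    by exists 0; split; [exists 0; split; [apply: p1|apply: rel0]|apply: smem0].
  have qu_dom m' : sat (dom (relcomp q u)) m'.
    apply: sat_trans (sat_dom u m') => m1 [w1 uw1].
    have [n1 h1] := p5 u _ _ uus uw1; exists n1 => b /h1/p_dom[y' qy'].
    by exists y', (w1 *r b); split=> //; apply: relR.
  have qu_ind y' : relcomp q u 0 y' -> tors y'.
    by move=> [w' [uw qw]]; apply: q_tors qw _; apply: th_tors uw _; apply: tors0.
  have [n1 h1] := p5 u _ _ uus umw; exists n1 => b /h1/p_dom[y' qy'].
  exists y'; split=> //; apply: (@soc_image Y (mktails qu_dom qu_ind) (m *r b)).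
  by exists (w *r b); split=> //; apply: relR.
move=> [n1 h1]; exists n1 => b /h1 [y' [qy' sy']].
have q2 : q (z *r a *r b) (y *r a *r b).
  have Ryzb : R (y *r a *r b) (z *r a *r b) by do 2!apply: relR.
  by exists (z *r a *r b); split=> //; apply: p4; exists (y *r a *r b).
rewrite -(subrK y' (y *r a *r b)); apply: smemD sy'; apply: soc_tors.
by apply: q_tors (relB q2 qy') _; rewrite subrr; apply: tors0.
Qed.

Lemma sat_not_tors X (N : X -> Prop) x : sat N x -> ~ tors x ->
  exists a, N (x *r a) /\ ~ tors (x *r a).
Proof.
move=> [n h] ntx; apply: contrapT => hN; apply: ntx; apply: sat_tors.
by exists n => a /h Na; apply: contrapT => nt; apply: hN; exists a.
Qed.

(** Maps from a sum of images of [M] to [M] separate its elements modulo torsion. As [f] is defined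
    only up to saturation, it is nonzero at some multiple of [x] rather than at [x]. *)
Lemma separation X (us : seq (tails_hom M X)) x : span us x -> ~ tors x ->
  exists f : grrel X M,
    [/\ forall y, tors y -> f y 0, forall y m, f y m -> tors y -> m = 0,
        forall u m w, List.In u us -> u m w -> sat (dom f) w
      & exists a m, f (x *r a) m /\ m <> 0].
Proof.
elim: us x => [//|u us IH] x sx ntx.
have [|disj|sub] := dichotomy u (N := spansub us); first exact: span_tors.
  have [m [w [z [uw sz xwz]]]] := sx.
  (* If [x] has a nonzero coordinate along [u], the projection to this coordinate, zero on the span
     of [us], will do. Otherwise a map that separates [z] is extended by zero along [u]. *)
  have [m0|m0] := pselect (m = 0); last first.
    pose p := restr (zerorel X M) (spansub us).
    have p0 z' : span us z' -> p z' 0 by [].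
    exists (addrel p u (tails_id M)); split.
    - move=> y ty; exists 0, 0, 0, y, 0; rewrite !addr0 !add0r.
      by split=> //; [exact: rel0|apply/p0/span_tors].
    - move=> y m' [m1 [w1 [w' [z1 [z' [uw1 /= -> [/= -> sz1] -> ->]]]]]].
      by move=> /(disjoint_sum disj uw1 sz1)[-> _ _]; rewrite addr0.
    - move=> v m' w' [<- uw'|vus vw']; apply: sat_self.
        exists m', m', w', m', 0, 0; rewrite !addr0; split=> //.
        by apply/p0/span_tors/tors0.
      exists 0, 0, 0, 0, w', 0; rewrite !add0r; split=> //; first exact: rel0.
      by apply: p0; apply: span_in vw'.
    - exists 1, m; rewrite ract1; split=> //; exists m, w, m, z, 0.
      by rewrite addr0; split=> //; apply: p0.
  have tw : tors w by apply: th_tors uw _; rewrite m0; apply: tors0.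
  have [|f [f1 f2 f3 [a [m1 [fm1 m10]]]]] := IH z sz.
    by move=> tz; apply: ntx; rewrite xwz; apply: torsD.
  pose p := restr f (spansub us).
  have add_p y m' : p y m' -> addrel p u (zerorel M M) y m'.
    by move=> pm; exists 0, 0, 0, y, m'; rewrite !add0r; split=> //; exact: rel0.
  exists (addrel p u (zerorel M M)); split.
  - by move=> y ty; apply: add_p; split; [exact: f1|exact: span_tors].
  - move=> y m' [m2 [w1 [w' [z1 [z' [uw1 /= -> [/= fz sz1] -> ->]]]]]].
    by move=> /(disjoint_sum disj uw1 sz1)[_ _ /(f2 _ _ fz)->]; rewrite addr0.
  - move=> v m' w' [<- uw'|vus vw'].
      apply: sat_self; exists 0, m', w', 0, 0, 0; rewrite !addr0; split=> //.
      by split; [exact: rel0|apply/span_tors/tors0].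
    have [n h] := f3 v m' w' vus vw'; exists n => b /h [m2 fm2]; exists m2; apply: add_p.
    by split=> //; apply: spanR; apply: span_in vw'.
  - exists a, m1; split=> //; exists (m *r a), (w *r a), 0, (z *r a), m1.
    rewrite add0r -ractDl xwz; split=> //; first exact: relR.
    by split=> //; apply: spanR.
have ssx : sat (span us) x.
  by apply: (@span_sub X (u :: us) (spansub us)) sx => [|v m w [<-|vus vw]];
    [exact: span_tors|exact: sub|apply: sat_self; exact: span_in vw].
have [a [sxa ntxa]] := sat_not_tors ssx ntx.
have [f [f1 f2 f3 [b [m [fm m0]]]]] := IH _ sxa ntxa.
exists f; split=> //; last by exists (a * b), m; rewrite -ractA.
move=> v m' w [<- /sub|vus vw]; last exact: f3 vw.
apply: sat_trans => y; apply: span_sub => [z tz|u' m2 w2 uus].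
  by exists 0; apply: f1.
exact: f3.
Qed.

(** * Condition chi_1 and the largest isotypic quotient *)

Section Extension.
Hypotheses (Mfd : forall N : grsub M, (exists x, N x /\ x <> 0) -> finite_dim (grquotient N))
  (chi : chi1 A).

Lemma comp_generator X d (x : X) l a : comp d x = x ->
  comp (d + l%:Z) (x *r a) = x *r acomp l a.
Proof.
move=> hx; move: a (tailA0 a); apply: tailA_ind => [|a b ha hb|l' a _ ha].
- by rewrite acomp0 !ract0r comp0.
- by rewrite acompD !ractDr compD ha hb.
rewrite (comp_ract_homog _ _ ha) -[in LHS]hx comp_comp -[in RHS]ha acomp_comp.
have [->|ne] := eqVneq l l'; first by rewrite addrK eqxx ha hx.
by rewrite ract0r ifF ?ract0l //; apply/eqP => e; move/eqP: ne; apply; lia.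
Qed.

Lemma comp_generator_lt X d (x : X) i a : comp d x = x -> (i < d)%R ->
  comp i (x *r a) = 0.
Proof.
move=> hx id; move: a (tailA0 a); apply: tailA_ind => [|a b ha hb|l' a _ ha].
- by rewrite ract0r comp0.
- by rewrite ractDr compD ha hb addr0.
rewrite (comp_ract_homog _ _ ha) -hx comp_comp ifF ?ract0l //.
by apply/eqP => e; lia.
Qed.

(** As [x] is homogeneous, the components of its multiples are again multiples of [x], and so is
    their sum. *)
Lemma hull_homog X d (x y : X) : comp d x = x -> hull x y -> exists a, y = x *r a.
Proof.
move=> hx hy; have [s _ ->] := comp_sum y.
elim: s => [|i s [a ha]]; first by exists 0; rewrite big_nil ract0r.
rewrite big_cons ha; have [b ->] := hy i.
have [id|di] := boolP (i < d)%R.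
  by exists a; rewrite (comp_generator_lt b hx id) add0r.
exists (acomp `|i - d|%N b + a); rewrite ractDr -(comp_generator _ _ hx).
by congr (comp _ _ + _); lia.
Qed.

Lemma homog_generator : exists d (m : M), comp d m = m /\ m <> 0.
Proof.
have [m m0] := Mne; apply: contrapT => h; apply: m0.
have [s _ ->] := comp_sum m; apply: big1 => i _.
apply: contrapT => c0; apply: h; exists i, (comp i m); split=> //; exact: comp_id.
Qed.

Lemma mod_generator d (m : M) : comp d m = m -> m <> 0 ->
  exists n (t : 'I_n -> M), forall y, exists (c : 'I_n -> k) a,
    y = \sum_j kact (c j) (t j) + m *r a.
Proof.
move=> hm m0; have [|n [t ht]] := Mfd (N := hull m).
  by exists m; split=> //; apply: hull_self.
exists n, (fun j => lift_quo (t j)) => y.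
have [c hc] := ht (quo (hull m) y); exists c.
have [|a ha] := @hull_homog M d m (y - \sum_j kact (c j) (lift_quo (t j))) hm.
  apply/quo_eq; rewrite hc raddf_sum /=; apply: eq_bigr => j _.
  have := quo_ract (hull m) (lift_quo (t j)) (c j)%:A; rewrite lift_quoK => h; exact: esym h.
by exists a; rewrite -ha addrC subrK.
Qed.

Lemma finitely_generatedT (T : finType) X (s : T -> X) :
  (forall x, exists a : T -> A, x = \sum_t s t *r a t) -> finitely_generated X.
Proof.
move=> h; exists #|T|, (fun i => s (enum_val i)) => x; have [a ->] := h x.
by exists (fun i => a (enum_val i)); rewrite -(big_enum_val (fun t => s t *r a t)).
Qed.

Lemma M_finitely_generated : finitely_generated M.
Proof.
have [d [m [hm m0]]] := homog_generator; have [n [t ht]] := mod_generator hm m0.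
apply: (@finitely_generatedT ('I_n + 'I_1)%type M
  (fun o => if o is inl j then t j else m)) => y.
have [c [a ->]] := ht y; exists (fun o => if o is inl j then (c j)%:A else a).
by rewrite big_sumType big_ord1.
Qed.

(** [M] is finite dimensional modulo [g A] for a homogeneous [g], and [g A] inherits local
    finiteness from [A]. *)
Lemma M_locally_finite d : exists (T : finType) (s : T -> M),
  (forall t, comp d (s t) = s t) /\
  forall m, comp d m = m -> exists c : T -> k, m = \sum_t kact (c t) (s t).
Proof.
have [e [g [hg g0]]] := homog_generator; have [n [t ht]] := mod_generator hg g0.
have [de|ed] := boolP (d < e)%R.
  exists 'I_n, (fun j => comp d (t j)); split=> [j|m hm]; first exact: comp_id.
  have [c [a hy]] := ht m; exists c; rewrite -[LHS]hm hy compD comp_bigsum.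
  rewrite (comp_generator_lt a hg de) addr0; apply: eq_bigr => j _.
  exact: comp_kact.
pose l := `|d - e|%N; have {ed}dl : d = e + l%:Z by rewrite /l; lia.
have [r [s [hs ss]]] := lf l.
exists ('I_n + 'I_r)%type, (fun p => match p with inl j => comp d (t j) | inr i => g *r s i end).
split=> [[j|i]|m hm]; first exact: comp_id; first by rewrite dl comp_ract.
have [c [a hy]] := ht m; have [c' hc'] := ss (acomp l a) (acomp_id l a).
exists (fun p => match p with inl j => c j | inr i => c' i end).
rewrite big_sumType /= -[LHS]hm hy compD comp_bigsum; congr (_ + _).
  by apply: eq_bigr => j _; rewrite comp_kact.
rewrite dl (comp_generator _ _ hg) hc' ract_sumr.
by apply: eq_bigr => i _; rewrite kactZ.
Qed.

(* The functions [g] are the elements of [Hom(A_{>= 1}, M(d))]; modulo those that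
   extend to [A] they form [Ext^1(A / A_{>= 1}, M(d))], which vanishes for large [d]. *)
Lemma ext1_vanishes : exists e : int, forall (d : int) (g : A -> M), (e <= d)%R ->
  (forall a b, tailA 1 a -> tailA 1 b -> g (a + b) = g a + g b) ->
  (forall a b, tailA 1 a -> g (a * b) = g a *r b) ->
  (forall i a, tailA 1 a -> g (acomp i a) = comp (d + i%:Z) (g a)) ->
  exists m, forall a, tailA 1 a -> g a = m *r a.
Proof.
have [P [n [deg [s [_ hs]]]]] := chi M_finitely_generated (j := 1) isT.
have [b hb] := seqint_bound [seq deg i | i <- enum 'I_n].
(* The degrees of the spanning classes of the graded [Ext^1] are at most [b], so none of them has
   degree [d]. *)
exists (b%:Z + 1) => d g bd gD gR gC.
have g0 : g 0 = 0.
  by apply: (addrI (g 0)); rewrite -gD ?addr0 //; apply: tailA_0.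
(* For negative [i] the claim is that [g a] has no component below degree [d]. *)
have gcomp i a : tailA 1 a -> g (regular_comp i (a : regular A)) = comp (d + i) (g a).
  case: i => [l|l] ta; first exact: gC.
  rewrite /= g0; have [q _ [_ aq]] := acomp_supp a.
  have : g a = \sum_(j <- q) comp (d + j%:Z) (g a).
    rewrite {1}aq; elim: q {aq} => [|j q IH]; first by rewrite !big_nil.
    rewrite !big_cons gD ?IH ?gC //.
      exact: (@tail_comp k A 1 (Posz j) (a : regular A) ta).
    elim: q {IH} => [|j' q IH]; first by rewrite big_nil; apply: tailA_0.
    rewrite big_cons; apply: tailAD IH.
    exact: (@tail_comp k A 1 (Posz j') (a : regular A) ta).
  move=> ->; rewrite comp_bigsum big1 // => j _.
  by rewrite comp_comp ifF //; apply/eqP; lia.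
(* Lifting the augmentation to [A] sends the boundaries into [A_{>= 1}], where [g] makes sense; [g]
   after [h] after the differential is a cocycle. *)
have [h hh] : exists h : grhom (pr_ob P 0) (regular A),
    grhom_eq (grhom_cmp (grquo (tail A 1)) h) (pr_aug P).
  apply: pr_projective => q; exists (lift_quo q); exact: lift_quoK.
have hquo x : quo (tail A 1) (h x) = pr_aug P x by rewrite -hh.
have hd_tail x : tailA 1 (h (pr_d P 0 x)).
  have /quo_eq : quo (tail A 1) (h (pr_d P 0 x)) = quo (tail A 1) 0.
    by rewrite hquo quo0; exact ((pr_exact0 (pr_d P 0 x)).2 (ex_intro _ x erefl)).
  by rewrite subr0.
pose z (x : pr_ob P 1) : shift M d := g (h (pr_d P 0 x)).
have z_lin : linear z.
  move=> a x y; rewrite /z !linearP gD; [|exact: tailA_mulr|exact: hd_tail].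
  by congr (_ + _); exact: (gR _ _ (hd_tail x)).
have z_comp i x : z (comp i x) = comp i (z x).
  by rewrite /z !gfun_comp; apply: gcomp.
have [|c [w [[g' hg'] hw]]] := hs d (mkgrhom z_lin z_comp).
  move=> x; rewrite /= /z (_ : pr_d P 0 (pr_d P 1 x) = 0) ?linear0 //.
  by apply: (pr_exact _).2; exists x.
have hz x : z x = g' (pr_d P 0 x).
  rewrite -hg' -[LHS]/(mkgrhom z_lin z_comp x) hw big1 ?add0r // => i /eqP ei.
  have /hb : deg i \in [seq deg i | i <- enum 'I_n] by apply: map_f; rewrite mem_enum.
  by move=> dib; exfalso; move: dib; rewrite ei; lia.
have [p hp] := pr_aug_surj P (quo (tail A 1) 1).
pose q : A := h p; have tp : tailA 1 (1 - q).
  by apply: (quo_eq (tail A 1) (1 : regular A) (h p)).1; rewrite hquo.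
(* For [a] in [A_{>= 1}], [p *r a] is a boundary, so [g (q * a) = g' p *r a]. The other part of
   [a = q * a + (1 - q) * a] is governed by [g (1 - q)], since [1 - q] lies in [A_{>= 1}]. *)
exists ((g' p : M) + g (1 - q)) => a ta.
have [y hy] : exists y, pr_d P 0 y = p *r a.
  apply: (pr_exact0 _).1; rewrite gfunR hp -quo_ract -(quo0 (tail A 1)); apply/quo_eq.
  by rewrite subr0 /ract -[_ *: _]/((1 : A) * a) mul1r.
have ga : g (q * a) = (g' p : M) *r a.
  have := hz y; rewrite /z hy !gfunR => e; exact e.
rewrite ractDl -ga -gR // -gD; [|exact: tailA_mull|exact: tailA_mulr].
by rewrite -mulrDl addrC subrK mul1r.
Qed.

Lemma satrel_fun X (f : grrel X M) x m m' : (forall m, f 0 m -> m = 0) ->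
  satrel f x m -> satrel f x m' -> m = m'.
Proof.
move=> f0 [n h] [n' h']; apply/eqP; rewrite -subr_eq0; apply/eqP/Mtf/torsP.
exists (maxn n n') => a ta; rewrite ractBl; apply: f0.
by rewrite -(subrr (x *r a)); apply: relB; [apply: h|apply: h'];
  apply: tailA_le ta; lia.
Qed.

(* In large degrees [M] agrees with the sections of [pi M]. *)
Lemma extension_in_large_degree : exists e : int,
  forall X (f : grrel X M) d (x : X), (e <= d)%R -> (forall m, f 0 m -> m = 0) ->
  comp d x = x -> sat (dom f) x -> exists m, comp d m = m /\ satrel f x m.
Proof.
have [e he] := ext1_vanishes; exists e => X f d x ed f0 hx [n hn].
(* The extension is pushed down one degree at a time, from [x A_{>= n}] until it reaches [x] itself
   at [j = n]. *)
suff H j : (j <= n)%N -> forall a, tailA (n - j) a -> exists m, satrel f (x *r a) m.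
  have [|m] := H n (leqnn n) 1; first by rewrite subnn; apply: tailA0.
  rewrite ract1 => hm; exists m; split=> //.
  by apply: (satrel_fun f0 _ hm); rewrite -hx; apply: satrel_comp.
elim: j => [_ a|j IH jn].
  by rewrite subn0 => /hn [m /satrel_self]; exists m.
apply: tailA_ind => [|a b [m hm] [m' hm']|l a nl ha].
- by exists 0; rewrite ract0r; apply/satrel_self/rel0.
- by exists (m + m'); rewrite ractDr; apply: satrelD.
(* The extension found so far on [x *r a *r b] for [b] in [A_{>= 1}], with default 0 elsewhere. It
   is a homomorphism from [A_{>= 1}] to [M(d + l)], so the vanishing of [Ext^1] yields its value at
   [x *r a]. *)
have /choice[g hg] : forall b, exists m, tailA 1 b -> satrel f (x *r a *r b) m.
  move=> b; have [tb|] := pselect (tailA 1 b); last by exists 0.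
  have [|m hm] := IH (ltnW jn) (a * b).
    have ta := tailA_homog nl ha.
    by apply: tailA_le (tailA_mul ta tb); lia.
  by exists m; rewrite ractA.
have [| | | |m hm] := he (d + l%:Z) g; first by lia.
- move=> b b' tb tb'; apply: (satrel_fun f0 (hg _ (tailAD tb tb'))).
  by rewrite ractDr; apply: satrelD; apply: hg.
- move=> b b' tb; apply: (satrel_fun f0 (hg _ (tailA_mulr b' tb))).
  by rewrite -ractA; apply: satrelR; apply: hg.
- move=> i b tb; have tib : tailA 1 (acomp i b).
    exact: (@tail_comp k A 1 (Posz i) (b : regular A) tb).
  apply: (satrel_fun f0 (hg _ tib)).
  have hxa : comp (d + l%:Z) (x *r a) = x *r a by rewrite comp_ract.
  by rewrite -(comp_generator _ _ hxa); apply: satrel_comp; apply: hg.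
(* [hm] needs [b] in [A_{>= 1}]; the domain of [f] needs it in [A_{>= n}]. *)
exists m; exists (maxn 1 n) => b tb.
have tb1 : tailA 1 b by apply: tailA_le tb; lia.
have [m' hm'] : dom f (x *r a *r b).
  rewrite ractA; apply: hn; apply: tailA_mull; apply: tailA_le tb; lia.
rewrite -hm // (satrel_fun f0 (hg b tb1) (satrel_self hm')) //.
Qed.

(** A finite list of maps suffices for the finitely many generators of the right ideal
    [A_{>= n}]. *)
Lemma sat_soc_span X (x : X) : sat (soc X) x -> exists us, sat (span us) x.
Proof.
move=> [n hn]; have nid : right_ideal (tailA n).
  by split; [apply: tailA_0|apply: tailAD|apply: tailA_mulr].
have [r [g [tg gspan]]] := noeth nid.
have [us hus] : exists us : seq (tails_hom M X), forall i, span us (x *r g i).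
  have : exists us : seq (tails_hom M X), forall i, i \in enum 'I_r -> span us (x *r g i).
    elim: (enum _) => [|i s [us IH]]; first by exists [::].
    have [vs hvs] := hn _ (tg i); exists (vs ++ us) => j.
    rewrite in_cons => /orP[/eqP->|/IH h].
      by rewrite -[X in span _ X]addr0; apply: span_cat => //; apply/span_tors/tors0.
    by rewrite -[X in span _ X]add0r; apply: span_cat => //; apply/span_tors/tors0.
  by move=> [us h]; exists us => i; apply: h; rewrite mem_enum.
exists us, n => a /gspan [b ->]; rewrite ract_sumr.
apply: (@smem_sum _ _ (spansub us)) => i _; rewrite -ractA; exact: spanR.
Qed.

(** * Direct sums of copies of [M] *)

Section DirectSum.
Variable B : eqType.

Definition finsupp (x : B -> M) : Prop := exists s : seq B, forall o, o \notin s -> x o = 0.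

Lemma finsupp0 : finsupp 0.
Proof. by exists [::]. Qed.
Lemma finsuppD x y : finsupp x -> finsupp y -> finsupp (x + y).
Proof.
move=> [s hs] [t ht]; exists (s ++ t) => o.
by rewrite mem_cat negb_or => /andP[/hs xb /ht yb]; rewrite fctE xb yb addr0.
Qed.
Lemma finsuppZ (a : A^c) x : finsupp x -> finsupp (a *: x).
Proof. by move=> [s hs]; exists s => o /hs xb; rewrite fctE xb scaler0. Qed.

Definition finsupp_submodule : submodule (B -> M) :=
  @Submodule _ _ finsupp finsupp0 finsuppD finsuppZ.

Definition dsum_type := submod finsupp_submodule.
HB.instance Definition _ := GRing.Lmodule.on dsum_type.

Definition mkdsum (x : B -> M) (hx : finsupp x) : dsum_type :=
  Sub x (introT (smembP finsupp_submodule x) hx).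

Lemma dsum_finsupp (x : dsum_type) : finsupp (val x).
Proof. by apply/(smembP finsupp_submodule); case: x. Qed.

Lemma dsum_comp_finsupp i (x : dsum_type) : finsupp (fun o => comp i (val x o)).
Proof. by have [s hs] := dsum_finsupp x; exists s => o /hs ->; rewrite comp0. Qed.
Definition dsum_comp i x := mkdsum (dsum_comp_finsupp i x).

Lemma dsumP (x y : dsum_type) : (forall o, val x o = val y o) -> x = y.
Proof. by move=> h; apply/val_inj/funext. Qed.

Lemma dsum_compD i x y : dsum_comp i (x + y) = dsum_comp i x + dsum_comp i y.
Proof. by apply: dsumP => o; rewrite /= !fctE compD. Qed.
Lemma dsum_comp_comp i j x :
  dsum_comp i (dsum_comp j x) = if i == j then dsum_comp j x else 0.
Proof. by apply: dsumP => o; rewrite /= comp_comp; case: eqP. Qed.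
Lemma val_dsum_sum (I : Type) (s : seq I) (F : I -> dsum_type) o :
  val (\sum_(i <- s) F i) o = \sum_(i <- s) val (F i) o.
Proof. by elim: s => [|i s IH]; rewrite ?big_nil // !big_cons -IH. Qed.
Lemma dsum_comp_sum x : exists2 s : seq int, uniq s & x = \sum_(i <- s) dsum_comp i x.
Proof.
have [t ht] := dsum_finsupp x.
have /choice[sp hsp] : forall o, exists s : seq int, forall i, i \notin s ->
    comp i (val x o) = 0.
  by move=> o; have [s _ hs] := comp_supp (val x o); exists s.
exists (undup (flatten [seq sp o | o <- t])); first exact: undup_uniq.
apply: dsumP => o; rewrite val_dsum_sum; apply: comp_sum_on; first exact: undup_uniq.
move=> i; rewrite mem_undup => it; have [bt|/ht ->] := boolP (o \in t); last exact: comp0.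
apply: hsp; apply: contra it => ib; apply/flattenP; exists (sp o) => //.
exact: map_f.
Qed.
Lemma dsum_comp_ract i n x (a : A) :
  dsum_comp i x = x -> acomp n a = a -> dsum_comp (i + n%:Z) (x *r a) = x *r a.
Proof.
move=> hx ha; apply: dsumP => o.
have E : val (x *r a) o = val x o *r a by rewrite /ract linearZ.
rewrite E -[LHS]/(comp (i + n%:Z) (val (x *r a) o)) E; apply: comp_ract ha.
by rewrite -[in RHS]hx.
Qed.

Definition dsum : grmod A := GrMod dsum_compD dsum_comp_comp dsum_comp_sum dsum_comp_ract.

Lemma dsum_inj_finsupp o (m : M) : finsupp (fun o' => if o' == o then m else 0).
Proof. by exists [:: o] => o'; rewrite inE => /negbTE ->. Qed.
Definition dsum_inj_fun o m : dsum := mkdsum (dsum_inj_finsupp o m).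
Lemma dsum_inj_linear o : linear (dsum_inj_fun o).
Proof.
move=> a x y; apply: dsumP => o' /=; rewrite !fctE.
by case: eqP; rewrite ?scaler0 ?addr0.
Qed.
Lemma dsum_inj_comp o i m : dsum_inj_fun o (comp i m) = comp i (dsum_inj_fun o m).
Proof. by apply: dsumP => o' /=; case: eqP; rewrite ?comp0. Qed.
Definition dsum_inj o : grhom M dsum := mkgrhom (@dsum_inj_linear o) (@dsum_inj_comp o).

Definition dsum_proj_fun o (x : dsum) : M := val (x : dsum_type) o.
Lemma dsum_proj_linear o : linear (dsum_proj_fun o).
Proof. by []. Qed.
Lemma dsum_proj_comp o i x : dsum_proj_fun o (comp i x) = comp i (dsum_proj_fun o x).
Proof. by []. Qed.
Definition dsum_proj o : grhom dsum M := mkgrhom (@dsum_proj_linear o) (@dsum_proj_comp o).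

Lemma dsum_projK o o' m : dsum_proj o' (dsum_inj o m) = if o' == o then m else 0.
Proof. by []. Qed.

Lemma dsum_sumE (x : dsum) (s : seq B) : uniq s ->
  (forall o, o \notin s -> dsum_proj o x = 0) ->
  x = \sum_(o <- s) dsum_inj o (dsum_proj o x).
Proof.
move=> us hs; apply: dsumP => o; rewrite val_dsum_sum.
have [bs|bs] := boolP (o \in s).
  rewrite (bigD1_seq o) //= eqxx big1 ?addr0 // => o' /negbTE oo'.
  by rewrite eq_sym oo'.
rewrite -[LHS]/(dsum_proj o x) hs // big1_seq // => o' /andP[_ o's] /=.
by case: eqP => // oo'; rewrite oo' o's in bs.
Qed.

Lemma isotypic_dsum : isotypic dsum.
Proof.
move=> x; apply: sat_self; have [s hs] := dsum_finsupp x.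
rewrite (@dsum_sumE x (undup s)) ?undup_uniq //; last first.
  by move=> o; rewrite mem_undup => /hs.
apply: (@smem_sum _ _ (soc dsum)) => o _.
by apply: (@soc_image _ (tails_graph (dsum_inj o)) (dsum_proj o x)).
Qed.

Lemma dsum_tors (x : dsum) o : tors x -> dsum_proj o x = 0.
Proof. by move=> tx; apply/Mtf/tors_gfun. Qed.

End DirectSum.

(* the kernel of the largest isotypic quotient of [X] *)
Definition rad X : grsub X.
Proof.
refine (@mkgrsub X (fun x => forall N : grsub X, isotypic (grquotient N) -> sat N x) _ _ _ _).
- by move=> N _; apply: sat0.
- by move=> x y hx hy N iN; apply: satD; [apply: hx|apply: hy].
- by move=> x a hx N iN; apply: satR; apply: hx.
- by move=> i x hx N iN; apply: sat_comp; apply: hx.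
Defined.

Section MultiRel.
Variables (X : grmod A) (x : X) (d : int) (hx : comp d x = x).
Variables (T : finType) (s : T -> M) (hs : forall t, comp d (s t) = s t).

(** Generated by the pair of [x] and the family [s]. It is the converse that has to be single valued
    up to torsion: a map from a submodule of the direct sum onto the multiples of [x]. *)
Definition multirel_mem (q : grquotient (rad X)) (z : dsum T) : Prop :=
  exists a, q = quo (rad X) (x *r a) /\ forall t, dsum_proj t z = s t *r a.

Lemma multirel_comp i q z : multirel_mem q z -> multirel_mem (comp i q) (comp i z).
Proof.
move=> [a [-> hz]]; have [id|di] := boolP (i < d)%R.
  exists 0; split=> [|t]; last first.
    by rewrite gfun_comp hz (comp_generator_lt _ (hs t) id) ract0r.
  by rewrite -[LHS]/(comp i (grquo (rad X) (x *r a))) -gfun_comp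
    (comp_generator_lt _ hx id) ract0r.
have -> : i = d + `|i - d|%N%:Z by lia.
exists (acomp `|i - d|%N a); split=> [|t].
  by rewrite -[LHS]/(comp _ (grquo (rad X) (x *r a))) -gfun_comp (comp_generator _ _ hx).
by rewrite gfun_comp hz (comp_generator _ _ (hs t)).
Qed.

Definition multirel : grrel (grquotient (rad X)) (dsum T).
Proof.
apply: (@GrRel k A _ _ multirel_mem _ _ _ multirel_comp).
- by exists 0; split=> [|t]; rewrite ract0r ?quo0 ?linear0.
- move=> q q' z z' [a [-> hz]] [b [-> hz']]; exists (a + b).
  by split=> [|t]; rewrite ractDr ?quoD // linearD hz hz'.
- move=> q z b [a [-> hz]]; exists (a * b).
  split=> [|t]; rewrite -ractA; first exact: esym (quo_ract _ _ _).
  by rewrite gfunR hz.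
Defined.
End MultiRel.

(* A partial map to [M] sends a homogeneous [x] of large degree [d] into the finite
   dimensional space [M_d].  Hence, if the [s t] span [M_d], the annihilator of all
   the [s t] maps [x] into [rad X], and [multirel] embeds [xA], modulo [rad X], into a
   finite direct sum of copies of [M]. *)
Lemma isotypic_grquotient_rad X : isotypic (grquotient (rad X)).
Proof.
have [e he] := extension_in_large_degree.
suff H d x : (e <= d)%R -> comp d x = x -> sat (soc (grquotient (rad X))) (quo (rad X) x).
  move=> q; rewrite -[q]lift_quoK; move: (lift_quo q) => {q} x.
  pose G := grquotient (rad X); have [r _ ->] := comp_sum x.
  rewrite -[quo _ _]/(grquo (rad X) (\sum_(i <- r) comp i x)) raddf_sum.
  apply: (@smem_sum _ G (satsub (soc G))) => i _.
  (* Multiplication by an element of degree [l >= |e - i|] takes degree [i] to a degree at least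
     [e]. *)
  apply: (@sat_sat G (soc G)); exists `|e - i|%N.
  apply: tailA_ind => [|a b ha hb|l a nl ha].
  - by rewrite ract0r; apply: sat0.
  - by rewrite ractDr; apply: satD.
  rewrite -gfunR; apply: (H (i + l%:Z)); first by lia.
  by rewrite comp_ract ?comp_id.
move=> ed hx; have [T [s [hs sspan]]] := M_locally_finite d.
pose z0 : dsum T := \sum_t dsum_inj t (s t).
have hz0 t : dsum_proj t z0 = s t.
  rewrite /z0 raddf_sum (eq_bigr (fun t' => if t == t' then s t' else 0)) => [|t' _ //].
  by rewrite -big_mkcond (big_pred1 t) // => t'; rewrite eq_sym.
apply: (isotypic_subquotient (R := multirel hx hs) (z := z0) _ (isotypic_dsum (B := T))).
  move=> q z [a [-> hz]] tz; apply/quo_tors/sat_self => N iN.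
  have sa0 t : s t *r a = 0 by rewrite -hz dsum_tors.
  apply: contrapT => nxa.
  pose Q := grquotient N; pose y : Q := quo N x.
  have yE b : quo N (x *r b) = y *r b by apply: quo_ract.
  have ntya : ~ tors (y *r a) by rewrite -yE quo_tors.
  have [us sus] := sat_soc_span (iN y).
  have [b [suab ntyab]] := sat_not_tors (satR a sus) ntya.
  have [f [f1 f2 f3 [c [m1 [fm1 m10]]]]] := separation suab ntyab.
  (* The map [f] on [X / N] is nonzero at a multiple of [y *r a]. Pulled back to [X] it extends to
     [x] with a value [m] in [M_d], and [m *r a = 0] because [a] kills all the [s t]: a
     contradiction. *)
  pose f' : grrel X M := relcomp f (graph (grquo N)).
  have [m0 f'm0|||m [hm [n' hf]]] := he X f' d x ed.
  - by case: f'm0 => w [-> fm]; apply: f2 fm _; rewrite linear0; apply: tors0.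
  - exact: hx.
  - have : sat (dom f) y.
      apply: (@sat_trans Q (spansub us) (dom f) y _ sus) => w.
      by apply: span_sub => [v tv|]; [exists 0; exact: f1|exact: f3].
    move=> [n h]; exists n => b' /h; rewrite -yE => -[m fm].
    by exists m, (quo N (x *r b')).
  have [c' hc'] := sspan m hm.
  have ma0 : m *r a = 0.
    by rewrite hc' ract_suml big1 // => t _; rewrite kactA sa0 kact0.
  apply: m10; apply/Mtf/torsP; exists n' => b' tb'.
  have [w [wE fw]] := hf _ (tailA_mull (a * b * c) tb').
  apply: f2 (tors0 Q); rewrite -(subrr (y *r a *r b *r c *r b')).
  have := relB (relR b' fm1) fw; rewrite wE -[grquo N _]/(quo N _ : Q) yE -!ractA ma0 !ract0l.
  by rewrite subr0.
by exists 1; rewrite ract1; split=> // t; rewrite ract1.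
Qed.

End Extension.

Notation "S \of R" := (tails_cmp noeth S R) (at level 40, left associativity).

(** * The isotypic objects as a closed subspace *)

Lemma tails_eqT X Y (R S : tails_hom X Y) :
  tails_eq R S <-> forall x y y', R x y -> S x y' -> tors (y - y').
Proof. exact: tails_eqP. Qed.

Lemma tors_sub X (N : grsub X) (s : grsubmod N) : tors (grval N s) -> tors s.
Proof.
move=> /torsP[n h]; apply/torsP; exists n => a /h e; apply: val_inj.
by rewrite -[LHS]/(grval N (s *r a)) gfunR e.
Qed.

Definition grsub_in X (N : grsub X) x (Nx : N x) : grsubmod N :=
  Sub x (introT (smembP N x) Nx).

Lemma grsub_mem X (N : grsub X) (s : grsubmod N) : N (grval N s).
Proof. by apply/(smembP N); case: s. Qed.

(** The hypotheses say that the converse relation is itself a morphism, and it is the inverse. *)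
Lemma tails_is_iso X Y (f : tails_hom X Y) : (forall x y, f x y -> tors y -> tors x) ->
  (forall y, sat (dom (relconv f)) y) -> @is_iso (Tails noeth) X Y f.
Proof.
move=> fi fs; have g0 x : relconv f 0 x -> tors x by move=> /fi; apply; apply: tors0.
exists (mktails fs g0); split; apply/tails_eqT.
  move=> x x' _ [y [fxy fx'y]] ->; apply: (fi _ (y - y)); first exact: relB.
  by rewrite subrr; apply: tors0.
move=> y y' _ [x [fxy fxy']] ->.
by apply: (th_ind_tors (R := f)); apply: rel_ind fxy' fxy.
Qed.

(** The hypothesis concerns only maps from the kernel of [f], so that the lemma also serves for
    monomorphisms of a full subcategory that contains this kernel. *)
Lemma mono_tors X Y (f : tails_hom X Y) :
  (forall g h : tails_hom (grsubmod (preim f (torsub Y))) X,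
    tails_eq (f \of g) (f \of h) -> tails_eq g h) ->
  forall x y, f x y -> tors y -> tors x.
Proof.
move=> fm x y fxy ty; pose N := preim f (torsub Y).
have Nx : N x by exists y.
have /tails_eqT h : tails_eq (tails_graph (grval N)) (zerohom (grsubmod N) X).
  apply: fm; apply/tails_eqT => s z z' [w [-> fz]] [w' [-> fz']].
  have [z1 [fz1 tz1]] := grsub_mem s.
  apply: torsB; last by apply: (th_ind_tors (R := f)); exact: fz'.
  rewrite -(subrK z1 z); apply: (torsD noeth) tz1.
  by apply: (th_ind_tors (R := f)); apply: rel_ind fz fz1.
by have := h (grsub_in Nx) x 0 erefl erefl; rewrite subr0.
Qed.

(** The projection of [Y] onto the cokernel agrees with zero after [f], hence is zero. *)
Lemma epi_image X Y (f : tails_hom X Y) : @is_epi (Tails noeth) X Y f ->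
  forall y, sat (dom (relconv f)) y.
Proof.
move=> fe y; pose N := dom (relconv f); apply/quo_tors.
have /tails_eqT h : tails_eq (tails_graph (grquo N)) (zerohom Y (grquotient N)).
  apply: fe; apply/tails_eqT => x q q' [z [fz ->]] [z' [_ ->]].
  have -> : grquo N z = grquo N 0 by apply/quo_eq; rewrite subr0; exists x.
  by change (tors (grquo N 0 - 0)); rewrite linear0 subr0; apply: tors0.
by have := h y (quo N y) 0 erefl erefl; rewrite subr0.
Qed.

Lemma isotypic_M : isotypic M.
Proof. by move=> m; apply: sat_self; apply: (@soc_image M (tails_id M) m). Qed.

Lemma isotypic_grsub X (N : grsub X) : isotypic X -> isotypic (grsubmod N).
Proof.
move=> iX s; apply: (isotypic_subquotient (R := graph (grval N))) iX _ _ erefl.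
by move=> s' x -> ; apply: tors_sub.
Qed.

Lemma isotypic_closed : closed_under_subquotients (isotypic : Tails noeth -> Prop).
Proof.
split=> [X Y f fm iX y|X Y f fe iX y].
  have ft := mono_tors (fm _).
  apply: sat_trans (sat_dom f y) => y' [x fy'x].
  exact: isotypic_subquotient ft iX _ _ fy'x.
apply: sat_trans (epi_image fe y) => y' [x fxy'].
exact: (isotypic_subquotient (R := relconv f) (fun _ _ => @th_tors X _ f _ _) iX fxy').
Qed.

Lemma isotypic_sub_soc X : isotypic (grsubmod (soc X)).
Proof.
move=> s; apply: sat_self; pose S := grsubmod (soc X).
have [us sus] := grsub_mem s; rewrite -/S.
elim: us s sus => [|u us IH] s /=; first by move=> /tors_sub; apply: soc_tors.
move=> [m [y [z [uy sz syz]]]].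
pose v := relcomp (relconv (graph (grval (soc X)))) u.
have v_dom m' : sat (dom v) m'.
  by apply: sat_sub (sat_dom u m') => m1 [w uw]; exists (grsub_in (soc_image uw)), w.
have v_ind s' : v 0 s' -> tors s'.
  by move=> [w [uw ws]]; apply: tors_sub; rewrite -ws; apply: (th_ind_tors (R := u)).
pose sy : S := grsub_in (soc_image uy).
rewrite -(subrK sy s); apply: (@smemD _ _ (soc S)); last first.
  by apply: (@soc_image _ (mktails v_dom v_ind) m); exists y.
apply: IH; rewrite linearB; change (span us (grval (soc X) s - y)).
by rewrite (syz : grval (soc X) s = y + z) addrC addKr.
Qed.

Lemma isotypic_coreflective :
  exists R : functor (Tails noeth) (full_subcategory (isotypic : Tails noeth -> Prop)),
    adjoint (inclusion _) R.
Proof.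
apply: coreflection_adjoint => X.
pose S := grsubmod (soc X); exists S, (tails_graph (grval (soc X))); split.
- exact: isotypic_sub_soc.
- move=> Z g h /tails_eqT gh; apply/tails_eqT => z s s' gs hs.
  have ge t t' (u : tails_hom Z S) : u t t' -> (tails_graph (grval (soc X)) \of u) t (grval _ t').
    by exists t'.
  by apply: tors_sub; rewrite linearB; apply: gh (ge _ _ _ gs) (ge _ _ _ hs).
move=> Z iZ f; pose g := relcomp (relconv (graph (grval (soc X)))) f.
have g_ind s : g 0 s -> tors s.
  by move=> [w [fw ws]]; apply: tors_sub; rewrite -ws; apply: (th_ind_tors (R := f)).
have g_soc z w : f z w -> soc X w -> dom g z.
  by move=> fzw sw; exists (grsub_in sw), w.
(* [f] carries the image of a map from [M] to the image of a map from [M], hence into the socle. *)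
have g_dom z : sat (dom g) z.
  apply: sat_trans (iZ z) => z' [us sus]; apply: sat_sat.
  apply: (@span_sub Z us (satsub (dom g))) sus => [w tw|u m w _ uw].
    have [n h] := sat_dom f w; exists n => a /h [w' fw'].
    by apply: (g_soc _ _ fw'); apply: soc_tors; apply: th_tors fw' _; apply: torsR.
  apply: sat_self; have [n h] := sat_dom f w; exists n => a /h [w' fw'].
  apply: (g_soc _ _ fw'); apply: (@soc_image X (f \of u) (m *r a)).
  by exists (w *r a); split=> //; apply: relR.
exists (mktails g_dom g_ind); apply/tails_eqT => z x x' [s [[w [fw ws]] ->]] fx'.
apply: (th_ind_tors (R := f)); rewrite -[grval _ s]ws.
by apply: rel_ind fw fx'.
Qed.

Lemma graph_lift_quo X (N : grsub X) (q : grquotient N) a :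
  graph (grquo N) (lift_quo q *r a) (q *r a).
Proof.
have e : q = grquo N (lift_quo q) by rewrite -[LHS]lift_quoK.
exact: (@graphR _ _ _ _ (grquo N) _ _ a e).
Qed.

(** The quotient of [X] by the kernel of [f] embeds into [Z]. Hence [rad X] is killed by every map
    to an isotypic object, which therefore descends to [X / rad X]. *)
Lemma isotypic_quotient X Z (f : tails_hom X Z) : isotypic Z ->
  isotypic (grquotient (preim f (torsub Z))).
Proof.
move=> iZ; set N := preim _ _ => q.
pose R := relcomp f (relconv (graph (grquo N))).
have R_tors q' z : R q' z -> tors z -> tors q'.
  move=> [x [-> fxz]] tz; apply/quo_tors/sat_self; by exists z.
have : sat (dom R) q.
  have [n h] := sat_dom f (lift_quo q); exists n => a /h [z fz].
  by exists z, (lift_quo q *r a); split=> //; apply: graph_lift_quo.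
apply: sat_trans => q' [z Rz]; exact: isotypic_subquotient R_tors iZ _ _ Rz.
Qed.

Lemma isotypic_reflective (Mfd : forall N : grsub M, (exists x, N x /\ x <> 0) ->
    finite_dim (grquotient N)) (chi : chi1 A) :
  exists L : functor (Tails noeth) (full_subcategory (isotypic : Tails noeth -> Prop)),
    adjoint L (inclusion _).
Proof.
apply: reflection_adjoint => X.
exists (grquotient (rad X)), (tails_graph (grquo (rad X))); split.
- exact: isotypic_grquotient_rad.
- move=> Z g h /tails_eqT gh; apply/tails_eqT => q z z'; rewrite -[q]lift_quoK => gz hz.
  by apply: (gh (lift_quo q)); [exists (quo (rad X) (lift_quo q))|
    exists (quo (rad X) (lift_quo q))].
move=> Z iZ f; pose g := relcomp (f : tails_hom X Z) (relconv (graph (grquo (rad X)))).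
have g_dom q : sat (dom g) q.
  have [n h] := sat_dom f (lift_quo q); exists n => a /h [z fz].
  by exists z, (lift_quo q *r a); split=> //; apply: graph_lift_quo.
have g_ind z : g 0 z -> tors z.
  move=> [x [xE fxz]].
  have rx : rad X x by rewrite -[x]subr0; apply/quo_eq; rewrite quo0.
  have [n h] := rx _ (@isotypic_quotient X Z f iZ).
  apply: sat_tors; exists n => a /h [z' [fz' tz']].
  rewrite -(subrK z' (z *r a)); apply: (torsD noeth) tz'.
  by apply: (th_ind_tors (R := f)); apply: rel_ind fz'; apply: relR.
exists (mktails g_dom g_ind); apply/tails_eqT => x z z' [q [-> [x' [xE fz]]]] fz'.
apply: (g_ind _); exists (x' - x); split; last exact: relB.
by rewrite /= /graph_mem linearB -xE subrr.
Qed.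

(** [Psub] places the kernel of a monomorphism in the subcategory, as [mono_tors] requires. *)
Lemma simple_M (P : Tails noeth -> Prop) (PM : P M)
    (Psub : forall X (N : grsub X), P X -> P (grsubmod N)) :
  simple (exist P M PM : full_subcategory P).
Proof.
split=> [z|[Y PY] f fm].
  have [[f hf] _] := z (exist P M PM).
  have [m m0] := Mne; apply: m0; apply: Mtf.
  have /tails_eqT h : tails_eq (tails_id M) (zerohom M M).
    apply: (tails_eq_trans noeth (hf (tails_id M))).
    exact: (tails_eq_sym noeth (hf (zerohom M M))).
  by rewrite -[m]subr0; apply: (h m).
have [f0|/existsNP[y /existsNP[m /not_implyP[fym m0]]]] :=
  pselect (forall y m, f y m -> m = 0); [left|right].
  have /tails_eqT h : tails_eq (tails_id Y) (zerohom Y Y).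
    apply: (fm (exist P Y PY)); apply/tails_eqT => y m m' [y' [_ /f0 ->]] [y'' [_ /f0 ->]].
    by rewrite subrr; apply: tors0.
  have tY (y : Y) : tors y by rewrite -[y]subr0; apply: (h y).
  move=> [Z PZ]; split.
    exists (zerohom Y Z) => g; apply/tails_eqT => y z _ gz ->; rewrite subr0.
    exact: th_tors gz _.
  exists (zerohom Z Y) => g; apply/tails_eqT => z y y' _ _; exact: tY.
apply: (tails_is_iso (f := f)).
  apply: mono_tors => g h gh.
  by apply: (fm (exist P _ (Psub Y (preim f (torsub M)) PY))).
by move=> m'; apply: Msimple; exists m; split=> //; exists y.
Qed.

(** * The endomorphism ring and the equivalence *)

Section HomGroup.

HB.instance Definition _ X Y := gen_eqMixin (tails_hom X Y).
HB.instance Definition _ X Y := gen_choiceMixin (tails_hom X Y).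

Section Quotient.
Variables X Y : grmod A.
Implicit Types f g h : tails_hom X Y.

Definition tails_eqb f g : bool := `[< tails_eq f g >].
Lemma tails_eqb_refl : reflexive tails_eqb.
Proof. by move=> f; apply/asboolP/(tails_eq_refl noeth). Qed.
Lemma tails_eqb_sym : symmetric tails_eqb.
Proof. by move=> f g; apply/asboolP/asboolP; apply: (tails_eq_sym noeth). Qed.
Lemma tails_eqb_trans : transitive tails_eqb.
Proof.
by move=> f g h /asboolP gf /asboolP fh; apply/asboolP/(tails_eq_trans noeth gf fh).
Qed.
Canonical tails_equiv := EquivRel tails_eqb tails_eqb_refl tails_eqb_sym tails_eqb_trans.

(** Rings and modules need equality where morphisms have [tails_eq]; hence the quotient. *)
Definition thom : Type := {eq_quot tails_equiv}%qT.
HB.instance Definition _ := Choice.on thom.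
HB.instance Definition _ := EqQuotient.on thom.

Definition cls f : thom := (\pi_thom f)%qT.

Lemma clsP f g : cls f = cls g <-> tails_eq f g.
Proof. by split=> [/eqmodP/asboolP|/asboolP h]; [|apply/eqmodP]. Qed.

Lemma thom_ind (P : thom -> Prop) : (forall f, P (cls f)) -> forall q, P q.
Proof. by move=> h q; rewrite -[q]reprK; apply: h. Qed.

Lemma repr_cls f : tails_eq (repr (cls f)) f.
Proof. by apply/clsP; rewrite /cls reprK. Qed.

Definition sumrel (f g : grrel X Y) : grrel X Y.
Proof.
apply: (@GrRel k A X Y (fun x y => exists y1 y2, [/\ f x y1, g x y2 & y = y1 + y2])).
- by exists 0, 0; rewrite addr0; split=> //; apply: rel0.
- move=> x x' y y' [y1 [y2 [h1 h2 ->]]] [y1' [y2' [h1' h2' ->]]].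
  by exists (y1 + y1'), (y2 + y2'); rewrite addrACA; split=> //; apply: relD.
- move=> x y a [y1 [y2 [h1 h2 ->]]]; exists (y1 *r a), (y2 *r a).
  by rewrite ractDl; split=> //; apply: relR.
- move=> i x y [y1 [y2 [h1 h2 ->]]]; exists (comp i y1), (comp i y2).
  by rewrite compD; split=> //; apply: rel_comp.
Defined.

Lemma sumrel_dom f g x : sat (dom (sumrel f g)) x.
Proof.
apply: sat_sub (satI (sat_dom f x) (sat_dom g x)) => y [[z fz] [t gt]].
by exists (z + t), z, t.
Qed.
Lemma sumrel_ind f g y : sumrel f g 0 y -> tors y.
Proof.
move=> [y1 [y2 [h1 h2 ->]]]; apply: (torsD noeth).
  exact: (th_ind_tors (R := f)) h1.
exact: (th_ind_tors (R := g)) h2.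
Qed.
Definition th_add f g : tails_hom X Y := mktails (@sumrel_dom f g) (@sumrel_ind f g).

Definition opprel (f : grrel X Y) : grrel X Y.
Proof.
apply: (@GrRel k A X Y (fun x y => f x (- y))).
- by rewrite oppr0; apply: rel0.
- by move=> x x' y y' h h'; rewrite opprD; apply: relD.
- by move=> x y a h; rewrite -ractNl; apply: relR.
- by move=> i x y h; rewrite -compN; apply: rel_comp.
Defined.
Lemma opprel_dom f x : sat (dom (opprel f)) x.
Proof. by apply: sat_sub (sat_dom f x) => y [z fz]; exists (- z); rewrite /= opprK. Qed.
Lemma opprel_ind f y : opprel f 0 y -> tors y.
Proof.
move=> h; rewrite -[y]opprK; apply: torsN.
exact: (th_ind_tors (R := f)) h.
Qed.
Definition th_opp f : tails_hom X Y := mktails (@opprel_dom f) (@opprel_ind f).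

Lemma th_addP f f' g g' : tails_eq f f' -> tails_eq g g' ->
  tails_eq (th_add f g) (th_add f' g').
Proof.
move=> /tails_eqT ff /tails_eqT gg; apply/tails_eqT.
move=> x _ _ [y1 [y2 [h1 h2 ->]]] [y1' [y2' [h1' h2' ->]]].
by rewrite opprD addrACA; apply: (torsD noeth); [apply: ff h1'|apply: gg h2'].
Qed.
Lemma th_oppP f f' : tails_eq f f' -> tails_eq (th_opp f) (th_opp f').
Proof.
move=> /tails_eqT ff; apply/tails_eqT => x y y' h h'.
by rewrite -[y]opprK -[y']opprK -opprD; apply/torsN/(ff x).
Qed.

Definition thom_add (p q : thom) : thom := cls (th_add (repr p) (repr q)).
Definition thom_opp (p : thom) : thom := cls (th_opp (repr p)).
Definition thom_zero : thom := cls (zerohom X Y).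

Lemma thom_addE f g : thom_add (cls f) (cls g) = cls (th_add f g).
Proof. by apply/clsP/th_addP; apply: repr_cls. Qed.
Lemma thom_oppE f : thom_opp (cls f) = cls (th_opp f).
Proof. by apply/clsP/th_oppP/repr_cls. Qed.

Lemma cls_sub f g : (forall x y, f x y -> g x y) -> cls f = cls g.
Proof. by move=> fg; apply/clsP/(tails_eq_sub noeth fg). Qed.

Lemma thom_addA : associative thom_add.
Proof.
elim/thom_ind=> f; elim/thom_ind=> g; elim/thom_ind=> h; rewrite !thom_addE.
apply: cls_sub => x _ [y1 [_ [fy [y2 [y3 [gy hy ->]]] ->]]].
by exists (y1 + y2), y3; rewrite addrA; split=> //; exists y1, y2.
Qed.
Lemma thom_addC : commutative thom_add.
Proof.
elim/thom_ind=> f; elim/thom_ind=> g; rewrite !thom_addE.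
by apply: cls_sub => x _ [y1 [y2 [fy gy ->]]]; exists y2, y1; rewrite addrC.
Qed.
Lemma thom_add0 : left_id thom_zero thom_add.
Proof.
elim/thom_ind=> f; rewrite thom_addE; apply: cls_sub => x _ [y1 [y2 [/= -> fy ->]]].
by rewrite add0r.
Qed.
Lemma thom_addN : left_inverse thom_zero thom_opp thom_add.
Proof.
elim/thom_ind=> f; rewrite thom_oppE thom_addE; apply/clsP/tails_eqT.
move=> x _ _ [y1 [y2 [fy1 fy2 ->]]] ->; rewrite subr0.
have := relB fy2 fy1; rewrite subrr opprK addrC.
exact: th_ind_tors.
Qed.
HB.instance Definition _ :=
  GRing.isZmodule.Build thom thom_addA thom_addC thom_add0 thom_addN.

Lemma clsD f g : cls f + cls g = cls (th_add f g).
Proof. exact: thom_addE. Qed.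
Lemma clsN f : - cls f = cls (th_opp f).
Proof. exact: thom_oppE. Qed.

Lemma cls_eq0 f : cls f = 0 <-> forall x y, f x y -> tors y.
Proof.
rewrite (clsP f (zerohom X Y)) tails_eqT; split=> [h x y fy|h x y _ /h ty ->].
  by have := h x y 0 fy erefl; rewrite subr0.
by rewrite subr0.
Qed.
End Quotient.

Definition hcomp X Y Z (q : thom Y Z) (p : thom X Y) : thom X Z :=
  cls (repr q \of repr p).

Lemma hcompE X Y Z (g : tails_hom Y Z) (f : tails_hom X Y) :
  hcomp (cls g) (cls f) = cls (g \of f).
Proof. by apply/clsP/(tails_cmp_eq noeth); apply: repr_cls. Qed.

Lemma hcompA X Y Z T (r : thom Z T) (q : thom Y Z) (p : thom X Y) :
  hcomp r (hcomp q p) = hcomp (hcomp r q) p.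
Proof.
elim/thom_ind: r => r; elim/thom_ind: q => q; elim/thom_ind: p => p.
by rewrite !hcompE; apply/clsP/(tails_cmpA noeth).
Qed.

Lemma hcomp1l X Y (p : thom X Y) : hcomp (cls (tails_id Y)) p = p.
Proof. by elim/thom_ind: p => p; rewrite hcompE; apply/clsP/(tails_idl noeth). Qed.
Lemma hcomp1r X Y (p : thom X Y) : hcomp p (cls (tails_id X)) = p.
Proof. by elim/thom_ind: p => p; rewrite hcompE; apply/clsP/(tails_idr noeth). Qed.

Lemma hcompDl X Y Z (q q' : thom Y Z) (p : thom X Y) :
  hcomp (q + q') p = hcomp q p + hcomp q' p.
Proof.
elim/thom_ind: q => q; elim/thom_ind: q' => q'; elim/thom_ind: p => p.
rewrite clsD !hcompE clsD; apply: cls_sub => x _ [y [py [z [z' [qz qz' ->]]]]].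
by exists z, z'; split=> //; exists y.
Qed.

Lemma hcompDr X Y Z (q : thom Y Z) (p p' : thom X Y) :
  hcomp q (p + p') = hcomp q p + hcomp q p'.
Proof.
elim/thom_ind: q => q; elim/thom_ind: p => p; elim/thom_ind: p' => p'.
rewrite clsD !hcompE clsD; apply/clsP/tails_eqT.
move=> x z _ [_ [[y [y' [py py' ->]]] qz]] [z1 [z2 [[y1 [py1 qz1]] [y2 [py2 qz2]] ->]]].
apply: (th_tors (relB qz (relD qz1 qz2))); rewrite opprD addrACA; apply: (torsD noeth).
  by apply: (th_ind_tors (R := p)); apply: rel_ind py py1.
by apply: (th_ind_tors (R := p')); apply: rel_ind py' py2.
Qed.

Lemma hcomp0l X Y Z (p : thom X Y) : hcomp (0 : thom Y Z) p = 0.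
Proof. by apply: (addrI (hcomp 0 p)); rewrite -hcompDl !addr0. Qed.
Lemma hcomp0r X Y Z (q : thom Y Z) : hcomp q (0 : thom X Y) = 0.
Proof. by apply: (addrI (hcomp q 0)); rewrite -hcompDr !addr0. Qed.
Lemma hcompNl X Y Z (q : thom Y Z) (p : thom X Y) : hcomp (- q) p = - hcomp q p.
Proof. by apply: (addrI (hcomp q p)); rewrite -hcompDl !subrr hcomp0l. Qed.
Lemma hcompNr X Y Z (q : thom Y Z) (p : thom X Y) : hcomp q (- p) = - hcomp q p.
Proof. by apply: (addrI (hcomp q p)); rewrite -hcompDr !subrr hcomp0r. Qed.

End HomGroup.

Definition endo := thom M M.
HB.instance Definition _ := GRing.Zmodule.on endo.

(** Schur's lemma: a nonzero kernel or a nonzero image has saturation [M]. *)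
Lemma endo_neq0 (q : endo) : q != 0 ->
  exists p : endo, hcomp p q = cls (tails_id M) /\ hcomp q p = cls (tails_id M).
Proof.
elim/thom_ind: q => f /eqP f0.
have [m [m' [fm m'0]]] : exists m m', f m m' /\ m' <> 0.
  apply: contrapT => h; apply: f0; apply/cls_eq0 => m m' fm.
  suff -> : m' = 0 by apply: tors0.
  by apply: contrapT => m'0; apply: h; exists m, m'.
have [| |g [gf fg]] := @tails_is_iso M M f.
- move=> x y fxy ty; suff -> : x = 0 by apply: tors0.
  apply: contrapT => x0; apply: m'0; apply: Mtf.
  have [|n h] := Msimple (N := preim f (torsub M)) _ m; first by exists x; split=> //; exists y.
  apply: sat_tors; exists n => a /h [z [fz tz]]; rewrite -(subrK z (m' *r a)).
  apply: (torsD noeth) tz; apply: (th_ind_tors (R := f)); apply: rel_ind fz.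
  exact: relR.
- by move=> y; apply: Msimple; exists m'; split=> //; exists m.
by exists (cls g); rewrite !hcompE; split; apply/clsP.
Qed.

Lemma endo1_neq0 : cls (tails_id M) != 0 :> endo.
Proof.
apply/eqP => /cls_eq0 h; have [m m0] := Mne; apply: m0; apply: Mtf.
by apply: (h m).
Qed.

HB.instance Definition _ := GRing.Zmodule_isNzRing.Build endo
  (@hcompA M M M M) (@hcomp1l M M) (@hcomp1r M M)
  (fun p q r => hcompDl p q r) (fun p q r => hcompDr p q r) endo1_neq0.

(** At 0 the value is the one that the ring structure prescribes for non-units. *)
Definition endo_inv (q : endo) : endo :=
  if pselect (q != 0) is left h then projT1 (cid (endo_neq0 h)) else q.

Lemma endo_mulVr : {in [pred q : endo | q != 0], left_inverse 1 endo_inv *%R}.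
Proof.
move=> q /= q0; rewrite /endo_inv; case: pselect => // h.
by case: (cid _) => p [].
Qed.
Lemma endo_divrr : {in [pred q : endo | q != 0], right_inverse 1 endo_inv *%R}.
Proof.
move=> q /= q0; rewrite /endo_inv; case: pselect => // h.
by case: (cid _) => p [].
Qed.
Lemma endo_unitrP (q p : endo) : p * q = 1 /\ q * p = 1 -> [pred q : endo | q != 0] q.
Proof.
move=> [pq _] /=; apply: contra_eq_neq pq => ->; rewrite mulr0 eq_sym.
exact: oner_neq0.
Qed.
Lemma endo_invr_out : {in [predC [pred q : endo | q != 0]], endo_inv =1 id}.
Proof. by move=> q; rewrite /endo_inv; case: pselect => // h; rewrite !inE h. Qed.

HB.instance Definition _ := GRing.NzRing_hasMulInverse.Build endo
  endo_mulVr endo_divrr endo_unitrP endo_invr_out.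

Lemma endo_division : division_ring endo.
Proof. by move=> q q0; rewrite unitrE; apply/eqP/endo_divrr. Qed.

Definition sections X := thom M X.
HB.instance Definition _ X := GRing.Zmodule.on (sections X).

(** Precomposition is a right action of [endo], hence a left action of the converse ring. *)
Definition sections_scale X (d : endo^c) (q : sections X) : sections X := hcomp q d.
Lemma sections_scaleA X (a b : endo^c) (q : sections X) :
  sections_scale a (sections_scale b q) = sections_scale (a * b) q.
Proof. by rewrite /sections_scale -hcompA. Qed.
HB.instance Definition _ X := GRing.Zmodule_isLmodule.Build endo^c (sections X)
  (@sections_scaleA X) (fun q => hcomp1r q) (fun d p q => hcompDl p q d)
  (fun q d e => hcompDr q d e).

Lemma sections_scaleE X (d : endo^c) (q : sections X) : d *: q = hcomp q d.
Proof. by []. Qed.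

Section PostComposition.
Variables (X Y : grmod A) (f : tails_hom X Y).
Definition postcomp (q : sections X) : sections Y := hcomp (cls f) q.
Lemma postcomp_linear : linear postcomp.
Proof. by move=> d p q; rewrite /postcomp hcompDr !sections_scaleE hcompA. Qed.
HB.instance Definition _ :=
  GRing.isLinear.Build endo^c (sections X) (sections Y) _ postcomp postcomp_linear.
Definition postcomp_map : {linear sections X -> sections Y} := postcomp.
End PostComposition.

Let isoP : Tails noeth -> Prop := isotypic.

Lemma sections_heq (X Y : full_subcategory isoP) (f g : hom X Y) :
  f =h g -> modhom_eq (@postcomp_map (sval X) (sval Y) f) (@postcomp_map (sval X) (sval Y) g).
Proof. by move=> /clsP fg q; rewrite /= /postcomp fg. Qed.
Lemma sections_id (X : full_subcategory isoP) :
  modhom_eq (@postcomp_map (sval X) (sval X) (idc X)) (modhom_id _).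
Proof. by move=> q; apply: hcomp1l. Qed.
Lemma sections_cmp (X Y Z : full_subcategory isoP) (g : hom Y Z) (f : hom X Y) :
  modhom_eq (@postcomp_map (sval X) (sval Z) (g \oh f))
    (modhom_cmp (@postcomp_map (sval Y) (sval Z) g) (@postcomp_map (sval X) (sval Y) f)).
Proof. by move=> q; rewrite /= /postcomp hcompA hcompE. Qed.

Definition sections_functor : functor (full_subcategory isoP) (right_modules endo) :=
  @Functor (full_subcategory isoP) (right_modules endo)
    (fun U => (sections (sval U) : lmodType endo^c))
    (fun U V f => @postcomp_map (sval U) (sval V) f) sections_heq sections_id sections_cmp.

(** The kernel of [f] contains the image of every map from [M], hence up to saturation all of the
    isotypic [X]. *)
Lemma sections_separate X Y (f : tails_hom X Y) : isotypic X ->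
  (forall u : tails_hom M X, cls (f \of u) = 0) -> cls f = 0.
Proof.
move=> iX fu; apply/cls_eq0 => x y fxy.
have : sat (preim f (torsub Y)) x.
  apply: sat_trans (iX x) => x' [us sus].
  apply: sat_sat; apply: (@span_sub X us (satsub (preim f (torsub Y)))) sus => [w tw|u m w _ uw].
    have [n h] := sat_dom f w; exists n => a /h [z fz]; exists z; split=> //.
    by apply: th_tors fz _; apply: torsR.
  have /cls_eq0 fu0 := fu u.
  apply: sat_self; have [n h] := sat_dom f w; exists n => a /h [z fz]; exists z.
  by split=> //; apply: (fu0 (m *r a)); exists (w *r a); split=> //; apply: relR.
move=> [n h]; apply: sat_tors; exists n => a /h [z [fz tz]].
rewrite -(subrK z (y *r a)); apply: (torsD noeth) tz.
by apply: (th_ind_tors (R := f)); apply: rel_ind fz; apply: relR.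
Qed.

Lemma sections_faithful (X Y : full_subcategory isoP) (f g : hom X Y) :
  modhom_eq (@postcomp_map (sval X) (sval Y) f) (@postcomp_map (sval X) (sval Y) g) -> f =h g.
Proof.
move=> fg; apply/clsP/eqP; rewrite -subr_eq0 clsN clsD; apply/eqP.
apply: sections_separate => [|u]; first exact: (svalP X).
have := fg (cls u); rewrite /= /postcomp -hcompE -clsD -clsN hcompDl hcompNl => ->.
by rewrite subrr.
Qed.

Definition torsrel X Y : grrel X Y.
Proof.
apply: (@GrRel k A X Y (fun x y => tors x /\ tors y)).
- by split; apply: tors0.
- by move=> x x' y y' [? ?] [? ?]; split; apply: (torsD noeth).
- by move=> x y a [? ?]; split; apply: torsR.
- by move=> i x y [? ?]; split; apply: tors_comp.
Defined.

(** * Linear maps between sections are induced by morphisms *)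

Section Fullness.
Variables (X Y : grmod A) (phi : {linear sections X -> sections Y}).
Implicit Types (ps : seq (tails_hom M X * tails_hom M Y)) (p : tails_hom M X * tails_hom M Y).

Definition matching p : Prop := phi (cls p.1) = cls p.2.

(* [span2 ps] relates [\sum_i u_i m_i] to [\sum_i v_i m_i], where [ps] lists the [(u_i, v_i)] *)
Fixpoint span2 ps : grrel X Y :=
  if ps is p :: ps' then addrel (span2 ps') p.1 p.2 else torsrel X Y.

Lemma span2_tail p ps x y : span2 ps x y -> span2 (p :: ps) x y.
Proof. by move=> h; exists 0, 0, 0, x, y; rewrite !add0r; split=> //; apply: rel0. Qed.

Lemma span2_head p ps m x y : p.1 m x -> p.2 m y -> span2 (p :: ps) x y.
Proof. by move=> h h'; exists m, x, y, 0, 0; rewrite !addr0; split=> //; apply: rel0. Qed.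

Lemma span2_cat ps ps' x x' y y' :
  span2 ps x y -> span2 ps' x' y' -> span2 (ps ++ ps') (x + x') (y + y').
Proof.
elim: ps x y => [|p ps IH] x y /=.
  move=> [tx ty] h; apply: relD h; elim: ps' => [//|p ps' IH]; exact: span2_tail.
move=> [m [w [w' [z [z' [h1 h2 h3 -> ->]]]]]] h.
by exists m, w, w', (z + x'), (z' + y'); rewrite !addrA; split=> //; apply: IH.
Qed.

Lemma span2_span ps x y : span2 ps x y -> span (map fst ps) x.
Proof.
elim: ps x y => [|p ps IH] x y /=; first by case.
by move=> [m [w [w' [z [z' [h1 _ /IH h3 -> _]]]]]]; exists m, w, z.
Qed.

(* If [u] factors through the span of the [u_i] then [u = \sum_i u_i d_i] with [d_i]
   in the endomorphism ring, and [phi] preserves such a linear dependence. *)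
Lemma span2_factor ps p : (forall q, List.In q ps -> matching q) -> matching p ->
  (forall m w, p.1 m w -> sat (span (map fst ps)) w) ->
  forall m w w', p.1 m w -> p.2 m w' -> satrel (span2 ps) w w'.
Proof.
elim: ps p => [|p1 ps IH] p ps_match p_match psub m w w' pw pw'.
  have tp w1 m1 : p.1 m1 w1 -> tors w1 by move=> /psub/sat_tors.
  apply: satrel_self; split; first exact: tp pw.
  have /cls_eq0 p0 : cls p.1 = 0 by apply/cls_eq0 => m1 w1; exact: tp.
  have : cls p.2 = 0 by rewrite -p_match (_ : cls p.1 = 0) ?linear0 //; apply/cls_eq0.
  by move/cls_eq0 => h; apply: h pw'.
have ps_match' q : List.In q ps -> matching q by move=> qps; apply: ps_match; right.
have p1_match : matching p1 by apply: ps_match; left.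
have [|disj|sub] := dichotomy p1.1 (N := spansub (map fst ps)); first exact: span_tors.
  pose N := spansub (map fst ps).
  (* The coordinate of [p.1] along [p1.1], modulo the span of the other maps; it is single valued
     because [p1.1] is independent of them. *)
  pose d_mem (m m1 : M) := exists w w1, [/\ p.1 m w, p1.1 m1 w1 & N (w - w1)].
  have d0 : d_mem 0 0.
    by exists 0, 0; rewrite subr0; split; [exact: rel0|exact: rel0|exact: smem0].
  have dD m1 m2 m1' m2' : d_mem m1 m1' -> d_mem m2 m2' -> d_mem (m1 + m2) (m1' + m2').
    move=> [y [y' [h1 h2 h3]]] [z [z' [h4 h5 h6]]]; exists (y + z), (y' + z').
    by rewrite opprD addrACA; split; [exact: relD|exact: relD|exact: smemD].
  have dR m1 m1' a : d_mem m1 m1' -> d_mem (m1 *r a) (m1' *r a).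
    move=> [y [y' [h1 h2 h3]]]; exists (y *r a), (y' *r a).
    by rewrite -ractBl; split; [exact: relR|exact: relR|exact: smem_ract].
  have dC i m1 m1' : d_mem m1 m1' -> d_mem (comp i m1) (comp i m1').
    move=> [y [y' [h1 h2 h3]]]; exists (comp i y), (comp i y').
    by rewrite -compB; split; [exact: rel_comp|exact: rel_comp|exact: gsub_comp].
  pose drel : grrel M M := GrRel d0 dD dR dC.
  have d_dom m1 : sat (dom drel) m1.
    apply: sat_trans (sat_dom p.1 m1) => m2 [y py]; have [n h] := psub _ _ py.
    exists n => a /h [m3 [z [t [p1z Nt yE]]]]; exists m3, (y *r a), z.
    by split=> //; [exact: relR|rewrite yE addrC addKr].
  have d_ind m1 : drel 0 m1 -> tors m1.
    move=> [y [z [py p1z Nyz]]]; suff -> : m1 = 0 by apply: tors0.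
    apply: disj p1z _; rewrite -(subKr y z); apply: smemB Nyz.
    by apply: span_tors; apply: (th_ind_tors (R := p.1)).
  pose d := mktails d_dom d_ind.
  (* Subtracting [p1] composed with [d] puts the first component into the span of the rest, and the
     pair still matches because [phi] is linear. *)
  pose p2 := (th_add p.1 (th_opp (p1.1 \of d)), th_add p.2 (th_opp (p1.2 \of d))).
  have p2_match : matching p2.
    rewrite /matching /= -!clsD -!clsN -!hcompE linearB p_match.
    by rewrite -(sections_scaleE (cls d) (cls p1.1)) linearZ p1_match.
  have p2_sub m1 y : p2.1 m1 y -> sat (span (map fst ps)) y.
    move=> [y1 [y2 [py1 [m2 [[y3 [z [py3 p1z Nz]]] p1y2]] ->]]].
    apply: (@sat_self _ N); rewrite -(subrK y3 y1) -addrA.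
    apply: smemD.
      by apply: span_tors; apply: (th_ind_tors (R := p.1)); apply: rel_ind py1 py3.
    rewrite -(subrK z y3) -addrA; apply: smemD => //; apply: span_tors.
    by rewrite -[y2]opprK; apply: (th_ind_tors (R := p1.1)); apply: rel_ind p1z p1y2.
  apply: satrel_idem; have [n h] := d_dom m; exists n => a /h [m1 dm1].
  apply: satrel_idem; have [n1 h1] := satI (sat_dom p1.1 m1) (sat_dom p1.2 m1).
  exists n1 => b /h1 [[z p1z] [z' p1z']].
  have pwab : p.1 (m *r a *r b) (w *r a *r b) by do 2!apply: relR.
  have pwab' : p.2 (m *r a *r b) (w' *r a *r b) by do 2!apply: relR.
  have dab : d (m *r a *r b) (m1 *r b) by apply: (relR (g := drel)).
  have [||n2 h2] := IH p2 ps_match' p2_match p2_sub (m *r a *r b)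
      (w *r a *r b - z) (w' *r a *r b - z').
  - exists (w *r a *r b), (- z); split=> //; exists (m1 *r b); split=> //.
    by rewrite opprK.
  - exists (w' *r a *r b), (- z'); split=> //; exists (m1 *r b); split=> //.
    by rewrite opprK.
  exists n2 => c /h2 h3; exists (m1 *r b *r c), (z *r c), (z' *r c).
  exists ((w *r a *r b - z) *r c), ((w' *r a *r b - z') *r c).
  by rewrite -!ractDl ![_ + (_ - _)]addrC !subrK; split=> //; apply: relR.
have [|n h] := IH p ps_match' p_match _ m w w' pw pw'.
  move=> m1 w1 /psub; apply: (@sat_trans X (spansub (map fst (p1 :: ps))) (spansub (map fst ps))).
  move=> x; apply: (@span_sub X (p1.1 :: map fst ps) (spansub (map fst ps))) => [y|v m2 w2].
    exact: span_tors.
  by move=> [<- /sub|vps vw] //; apply: sat_self; apply: span_in vw.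
by exists n => a /h; apply: span2_tail.
Qed.

(** This makes the induced map single valued. If the first map is independent of the others, its
    argument [m] is zero; if not, [span2_factor] expresses its contribution through the others. *)
Lemma span2_tors ps x y : (forall q, List.In q ps -> matching q) -> span2 ps x y ->
  tors x -> tors y.
Proof.
elim: ps x y => [|p ps IH] x y ps_match /=; first by case.
have ps_match' q : List.In q ps -> matching q by move=> qps; apply: ps_match; right.
have p_match : matching p by apply: ps_match; left.
move=> [m [w [w' [z [z' [pw pw' szz' -> ->]]]]]] twz.
have [|disj|sub] := dichotomy p.1 (N := spansub (map fst ps)); first exact: span_tors.
  have [m0 _ tz] := disjoint_sum disj pw (span2_span szz') twz.
  apply: (torsD noeth); last exact: IH szz' tz.
  by apply: th_tors pw' _; rewrite m0; apply: tors0.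
have [n h] := satrelD (span2_factor ps_match' p_match sub pw pw') (satrel_self szz').
apply: sat_tors; exists n => a /h /(IH _ _ ps_match'); apply; exact: torsR.
Qed.

Definition lift_mem (x : X) (y : Y) : Prop :=
  exists2 ps, forall q, List.In q ps -> matching q & span2 ps x y.

Definition liftrel : grrel X Y.
Proof.
apply: (@GrRel k A X Y lift_mem).
- by exists [::] => //; apply: rel0.
- move=> x x' y y' [ps mps h] [ps' mps' h']; exists (ps ++ ps'); last exact: span2_cat.
  by move=> q /List.in_app_iff[/mps|/mps'].
- by move=> x y a [ps mps h]; exists ps => //; apply: relR.
- by move=> i x y [ps mps h]; exists ps => //; apply: rel_comp.
Defined.

Lemma liftrel_ind y : liftrel 0 y -> tors y.
Proof. by move=> [ps mps h]; apply: span2_tors mps h (tors0 X). Qed.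

Lemma liftrel_dom : isotypic X -> forall x, sat (dom liftrel) x.
Proof.
move=> iX x; apply: sat_trans (iX x) => x' [us sus]; apply: sat_sat.
apply: (@span_sub X us (satsub (dom liftrel))) sus => [w tw|u m w _ uw].
  by apply: sat_self; exists 0, [::] => //; split=> //; apply: tors0.
pose v : tails_hom M Y := repr (phi (cls u) : thom M Y).
apply: sat_self; have [n h] := sat_dom v m; exists n => a /h [y vy].
exists y, [:: (u, v)].
  by move=> q [<-|//]; rewrite /matching /= /cls reprK.
by apply: (span2_head (p := (u, v)) [::] _ vy); apply: relR.
Qed.

Lemma linear_map_induced : isotypic X ->
  exists f : tails_hom X Y, forall q, phi q = hcomp (cls f) q.
Proof.
move=> iX; exists (mktails (liftrel_dom iX) liftrel_ind); elim/thom_ind=> u.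
pose v : tails_hom M Y := repr (phi (cls u) : thom M Y).
have vE : phi (cls u) = cls v by rewrite /cls reprK.
rewrite vE hcompE; apply/clsP/tails_eqT => m y y' vy [w [uw lwy']].
apply: liftrel_ind; rewrite -(subrr w); apply: relB lwy'.
exists [:: (u, v)]; first by move=> q [<-|].
exact: (span2_head (p := (u, v)) [::] uw vy).
Qed.

End Fullness.

Lemma sections_full (U V : full_subcategory isoP)
    (g : modhom (sections_functor U) (sections_functor V)) :
  exists f : hom U V, fmap sections_functor f =h (g : @hom (right_modules endo) _ _).
Proof.
have [f hf] := linear_map_induced g (svalP U).
by exists f => q; rewrite /= /postcomp -hf.
Qed.

(** * Every module is the module of sections of a direct sum *)

Section DirectSumSections.
Variable B : eqType.

Lemma dsum_sections_eq0 (q : sections (dsum B)) :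
  (forall b : B, hcomp (cls (tails_graph (dsum_proj b))) q = 0) -> q = 0.
Proof.
elim/thom_ind: q => u hu; apply/cls_eq0 => m z uz.
suff -> : z = 0 by apply: tors0.
apply: dsumP => b; apply: Mtf; have := hu b; rewrite hcompE => /cls_eq0 /(_ m).
by apply; exists z.
Qed.

Lemma dsum_proj_inj (b b' : B) :
  hcomp (cls (tails_graph (dsum_proj b'))) (cls (tails_graph (dsum_inj b))) =
  if b' == b then cls (tails_id M) else 0.
Proof.
rewrite hcompE; case: eqP => [->|/eqP/negbTE bb'].
  by apply: cls_sub => m m' [z [-> ->]]; have := dsum_projK b b m; rewrite eqxx.
apply/cls_eq0 => m m' [z [-> ->]]; have := dsum_projK b b' m; rewrite bb' => E.
by have := tors0 M; rewrite -E.
Qed.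

Lemma dsum_tors0 (z : dsum B) : tors z -> z = 0.
Proof. by move=> tz; apply: dsumP => b; apply: (dsum_tors b tz). Qed.

(* [M] is finitely generated up to torsion, so it maps into finitely many summands. *)
Lemma dsum_sections_finite (q : sections (dsum B)) : exists2 s : seq B, uniq s &
  forall b : B, b \notin s -> hcomp (cls (tails_graph (dsum_proj b))) q = 0.
Proof.
elim/thom_ind: q => u; have [m m0] := Mne.
have [a [[z uz] nt]] := sat_not_tors (sat_dom u m) (fun t => m0 (Mtf t)).
have [s hs] := dsum_finsupp z; exists (undup s); first exact: undup_uniq.
pose Q (x : dsum B) := forall b : B, b \notin s -> dsum_proj b x = 0.
have QD x y : Q x -> Q y -> Q (x + y).
  by move=> hx hy b bs; rewrite linearD hx // hy // addr0.
have QR x c : Q x -> Q (x *r c) by move=> hx b bs; rewrite gfunR hx // ract0l.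
have QC i x : Q x -> Q (comp i x) by move=> hx b bs; rewrite gfun_comp hx // comp0.
(* The elements supported in [s]. Their preimage under [u] contains the nonzero element [m *r a], so
   by simplicity its saturation is [M]. *)
pose N : grsub (dsum B) := mkgrsub (Q := Q) (fun (b : B) _ => linear0 (dsum_proj b)) QD QR QC.
move=> b; rewrite mem_undup => bs; rewrite hcompE; apply/cls_eq0 => m1 _ [z1 [uz1 ->]].
have [|n h] := Msimple (N := preim u N) _ m1.
  exists (m *r a); split; first by exists z; split=> // b' /hs.
  by move=> ma0; apply: nt; rewrite ma0; apply: tors0.
apply/torsP; exists n => c /h [z2 [uz2 Nz2]].
have -> : dsum_proj b z1 *r c = dsum_proj b (z1 *r c - z2).
  by rewrite linearB Nz2 // subr0 gfunR.
rewrite (dsum_tors0 (z := z1 *r c - z2)) ?linear0 //.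
by apply: (th_ind_tors (R := u)); apply: rel_ind uz2; apply: relR.
Qed.

End DirectSumSections.

Lemma endo_c_inverse (d : endo^c) : d != 0 -> exists e : endo^c, e * d = 1.
Proof. by move=> d0; exists (endo_inv d); apply: endo_divrr. Qed.

Lemma sections_surj (V : lmodType endo^c) : exists U : full_subcategory isoP,
  @isomorphic (right_modules endo) (sections_functor U) V.
Proof.
have [B [e [c [c_sum c_lin c_coord]]]] := basis_coordinates V endo_c_inverse.
exists (exist isoP (dsum B) (isotypic_dsum (B := B))).
pose pr (b : B) := cls (tails_graph (dsum_proj b)).
pose coord (q : sections (dsum B)) (b : B) : endo^c := hcomp (pr b) q.
have coord_lin (a : endo^c) p q (b : B) : coord (a *: p + q) b = a * coord p b + coord q b.
  by rewrite /coord hcompDr sections_scaleE hcompA.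
have coord_eq p q : (forall b : B, coord p b = coord q b) -> p = q.
  move=> h; apply/eqP; rewrite -subr_eq0; apply/eqP/dsum_sections_eq0 => b.
  by rewrite hcompDr hcompNr -[hcomp _ p]/(coord p b) h subrr.
have coord_sum (s : seq B) (f : B -> endo^c) (b : B) : uniq s ->
    coord (\sum_(b <- s) f b *: (cls (tails_graph (dsum_inj b)) : sections (dsum B))) b =
    if b \in s then f b else 0.
  move=> us; have coord0 : coord 0 b = 0 by rewrite /coord hcomp0r.
  elim: s us => [|b' s IH] /=; first by rewrite big_nil.
  move=> /andP[b's us]; rewrite big_cons coord_lin IH // in_cons /coord dsum_proj_inj.
  case: eqP => [->|_] /=; first by rewrite (negbTE b's) mulr1 addr0.
  by rewrite mulr0 add0r.
(* Both [theta] and [eta] are prescribed by equality of coordinates. Finite supports make them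
   exist; since elements are determined by their coordinates, they are linear and mutually
   inverse. *)
have /choice[theta theta_coord] : forall v, exists q, forall b : B, coord q b = c v b.
  move=> v; have [s us [cs _]] := c_sum v.
  exists (\sum_(b <- s) c v b *: (cls (tails_graph (dsum_inj b)) : sections (dsum B))) => b.
  by rewrite coord_sum //; case: ifPn => // /cs ->.
have /choice[eta eta_coord] : forall q, exists v, forall b : B, c v b = coord q b.
  move=> q; have [s us hs] := dsum_sections_finite q.
  exists (\sum_(b <- s) coord q b *: e b) => b.
  by rewrite c_coord //; case: ifPn => // /hs.
have c_eq v w : (forall b : B, c v b = c w b) -> v = w.
  move=> vw; have [s us [cs vE]] := c_sum (-1 *: v + w).
  have cvw (b : B) : c (-1 *: v + w) b = 0 by rewrite c_lin vw mulN1r addNr.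
  apply/eqP; rewrite -subr_eq0 -oppr_eq0 opprB -scaleN1r addrC vE.
  by rewrite big1 // => b _; rewrite cvw scale0r.
have theta_lin : linear theta.
  by move=> a v w; apply: coord_eq => b; rewrite coord_lin !theta_coord c_lin.
have eta_lin : linear eta.
  by move=> a p q; apply: c_eq => b; rewrite c_lin !eta_coord coord_lin.
pose thetaL : {linear V -> sections (dsum B)} :=
  HB.pack theta (GRing.isLinear.Build endo^c V (sections (dsum B)) _ theta theta_lin).
pose etaL : {linear sections (dsum B) -> V} :=
  HB.pack eta (GRing.isLinear.Build endo^c (sections (dsum B)) V _ eta eta_lin).
exists etaL, thetaL; split=> [q|v].
  by apply: coord_eq => b; rewrite /= theta_coord eta_coord.
by apply: c_eq => b; rewrite /= eta_coord theta_coord.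
Qed.

Lemma isotypic_equivalent : equivalent (full_subcategory isoP) (right_modules endo).
Proof.
apply: (@equivalent_of_full_faithful _ _ sections_functor).
- exact: sections_full.
- exact: sections_faithful.
- exact: sections_surj.
Qed.

Lemma isotypic_closed_point :
  (forall N : grsub M, (exists x, N x /\ x <> 0) -> finite_dim (grquotient N)) ->
  chi1 A -> closed_point isoP.
Proof.
move=> Mfd chi; split; first split.
- exact: isotypic_closed.
- exact: isotypic_reflective.
- exact: isotypic_coreflective.
by exists endo; split; [exact: endo_division|exact: isotypic_equivalent].
Qed.

End SimpleObject.

(** * From finite dimensional quotients to a simple object *)

Lemma finite_dim_extension (M : grmod A) (N : grsub M) :
  finite_dim (grsubmod N) -> finite_dim (grquotient N) -> finite_dim M.
Proof.
move=> [m [s hs]] [n [t ht]].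
pose r (p : 'I_m + 'I_n) := match p with inl i => grval N (s i) | inr j => lift_quo (t j) end.
exists #|{: 'I_m + 'I_n}|, (fun i => r (enum_val i)) => x.
have [c hc] := ht (quo N x); have Ny : N (x - \sum_j kact (c j) (lift_quo (t j))).
  apply/quo_eq; rewrite hc raddf_sum; apply: eq_bigr => j _.
  have := quo_ract N (lift_quo (t j)) (c j)%:A; rewrite lift_quoK => h; exact: esym h.
have [d hd] := hs (grsub_in Ny).
pose f (p : 'I_m + 'I_n) := match p with inl i => d i | inr j => c j end.
exists (fun i => f (enum_val i)).
rewrite -(big_enum_val (fun p => kact (f p) (r p))) big_sumType /=.
have e : grval N (grsub_in Ny) = \sum_i kact (d i) (grval N (s i)).
  by rewrite hd raddf_sum; apply: eq_bigr => i _; exact: (gfun_kact (grval N)).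
by rewrite -e /= subrK.
Qed.

Lemma simple_point (M : grmod A) : ~ finite_dim M ->
  (forall N : grsub M, (exists x, N x /\ x <> 0) -> finite_dim (grquotient N)) ->
  chi1 A ->
  exists p : Tails noeth -> Prop, closed_point p /\
    exists Op : full_subcategory p,
      simple Op /\ isomorphic (tails_pi noeth M) (inclusion p Op).
Proof.
move=> infM Mfd chi.
(* A nonzero torsion element would generate a finite dimensional submodule with finite dimensional
   quotient. *)
have Mtf (m : M) : tors m -> m = 0.
  move=> tm; apply: contrapT => m0; apply: infM.
  apply: (finite_dim_extension (hull_finite_dim tm)); apply: Mfd.
  by exists m; split=> //; apply: hull_self.
have Mne : exists m : M, m <> 0.
  apply: contrapT => h; apply: infM; exists 0, (fun=> 0) => m; exists (fun=> 0).
  by rewrite big_ord0; apply: contrapT => m0; apply: h; exists m.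
have Msimple (N : grsub M) : (exists x, N x /\ x <> 0) -> forall x, sat N x.
  by move=> /Mfd fN x; apply/quo_tors/finite_dim_tors.
exists (isotypic M : Tails noeth -> Prop); split.
  exact: isotypic_closed_point.
exists (exist _ (M : Tails noeth) (isotypic_M (M := M))); split.
  by apply: simple_M => // X N; apply: isotypic_grsub.
by exists (idc _), (idc _); split; apply: cmp_idl.
Qed.

End Saturation.

Theorem proposition5p8 (k : fieldType) (A : gralg k)
    (noeth : right_noetherian A) (lf : locally_finite A) (M : grmod A) :
  ~ finite_dim M ->
  (forall N : grsub M, (exists x, N x /\ x <> 0%R) -> finite_dim (grquotient N)) ->
  chi1 A ->
  exists p : Tails noeth -> Prop,
    closed_point p /\
    exists Op : full_subcategory p,
      simple Op /\ isomorphic (tails_pi noeth M) (inclusion p Op).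
Proof. exact: simple_point. Qed.
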